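(* Let $2<p<+\infty$, let $d\in\mathbb{N}$, and let $p'$ be given by $\frac1p+\frac1{p'}=1$. Let $\{\lambda_i\}_{i\in\mathbb{N}}\subseteq\mathbb{R}^d$ be an unbounded sequence. Then there are a subsequence $\{\lambda_{m_i}\}_{i\in\mathbb{N}}$, a function $f\in L_p(\mathbb{R}^d)$, and a seminormalized sequence $\{F_i'\}_{i\in\mathbb{N}}\subseteq L_{p'}(\mathbb{R}^d)$ such that $\{T_{\lambda_{m_i}}f,F_i'\}_{i\in\mathbb{N}}$ is an unconditional Schauder frame for $L_p(\mathbb{R}^d)$.
   Context: Scalars are $\mathbb{K}\in\{\mathbb{R},\mathbb{C}\}$. For $\lambda\in\mathbb{R}^d$, $T_\lambda$ is the translation operator $(T_\lambda f)(x)=f(x-\lambda)$. The dual space $(L_p(\mathbb{R}^d))'$ is identified with $L_{p'}(\mathbb{R}^d)$ in the usual way. A sequence in a normed space is seminormalized if there are $0<r\le R<\infty$ such that all its terms have norm between $r$ and $R$. For a Banach space $X$ with dual $X'$, a sequence $\{f_i,f_i'\}_{i\in\mathbb{N}}\subseteq X\times X'$ is a Schauder frame for $X$ if $g=\sum_{i=1}^\infty f_i'(g)f_i$ for every $g\in X$; it is unconditional if this series converges unconditionally for every $g\in X$. *)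

(* Defs.v *)
From HB Require Import structures.
From mathcomp Require Import all_boot all_order all_algebra.
From mathcomp Require Import complex.
From mathcomp Require Import all_classical all_reals all_analysis.
From mathcomp Require Import measurable_realfun ess_sup_inf hoelder.
From mathcomp Require Import generic_quotient ring_quotient.
Import Order.TTheory GRing.Theory Num.Theory.
Import numFieldNormedType.Exports.
Local Open Scope classical_set_scope.
Local Open Scope ring_scope.

Set Implicit Arguments.
Unset Strict Implicit.
Unset Printing Implicit Defensive.

Definition measure_rV_display : measure_display -> measure_display.
Proof. exact. Qed.

Section measurable_rV.
Context {d} {T : measurableType d} (n : nat).

(* The sigma-algebra generated by the coordinates, as for [n.-tuple T]; on
   ['rV[R]_n] it is the Borel sigma-algebra, so that "measurable" means Borel
   measurable. This gives the same [L_p] classes as Lebesgue measurability. *)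
Let coord : 'I_n -> 'rV[T]_n -> T := fun i v => v ord0 i.

Let rV_set0 : g_sigma_preimage coord set0.
Proof. exact: sigma_algebra0. Qed.

Let rV_setC A : g_sigma_preimage coord A -> g_sigma_preimage coord (~` A).
Proof. exact: sigma_algebraC. Qed.

Let rV_bigcup (F : _^nat) : (forall i, g_sigma_preimage coord (F i)) ->
  g_sigma_preimage coord (\bigcup_i (F i)).
Proof. exact: sigma_algebra_bigcup. Qed.

HB.instance Definition _ := @isMeasurable.Build (measure_rV_display d)
  'rV[T]_n (g_sigma_preimage coord) rV_set0 rV_setC rV_bigcup.

Lemma measurable_coord (i : 'I_n) :
  measurable_fun [set: 'rV[T]_n] (fun v : 'rV[T]_n => v ord0 i).
Proof.
move=> _ Y mY; rewrite setTI; apply: sub_sigma_algebra => /=.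
rewrite -bigcup_seq/=; exists i => /=; first by rewrite mem_index_enum.
by exists Y => //; rewrite setTI.
Qed.

Lemma measurable_fun_rVP d1 (T1 : measurableType d1) (f : T1 -> 'rV[T]_n) :
  measurable_fun [set: T1] f <->
  forall i, measurable_fun [set: T1] (fun x => f x ord0 i).
Proof.
split=> [mf i|mf].
  exact: (measurableT_comp (measurable_coord i) mf).
pose G : set (set 'rV[T]_n) :=
  \big[setU/set0]_(i < n) preimage_set_system setT (coord i) measurable.
apply: (measurability G) => //.
move=> _ [B + <-]; rewrite /G -bigcup_seq/= => -[i _ [C mC <-]].
rewrite setTI; have := mf i measurableT C mC.
by rewrite !setTI.
Qed.

End measurable_rV.

Section lebesgue_rV.
Context (R : realType).

Definition rV_cons n (x : measurableTypeR R * 'rV[R]_n) : 'rV[R]_n.+1 :=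
  row_mx (x.1%:M : 'rV[R]_1) x.2.

Lemma rV_cons0 n x : @rV_cons n x ord0 ord0 = x.1.
Proof.
have -> : ord0 = lshift n ord0 :> 'I_(1 + n) by exact/val_inj.
by rewrite [LHS]row_mxEl mxE eqxx.
Qed.

Lemma rV_consS n x i : @rV_cons n x ord0 (lift ord0 i) = x.2 ord0 i.
Proof.
have -> : lift ord0 i = rshift 1 i :> 'I_(1 + n) by exact/val_inj.
by rewrite [LHS]row_mxEr.
Qed.

Lemma measurable_rV_cons n : measurable_fun setT (@rV_cons n).
Proof.
apply/measurable_fun_rVP => i; case: (fintype.unliftP ord0 i) => [j ->|->]; last first.
  rewrite (_ : (fun _ => _) = fst); first exact: measurable_fst.
  by apply/funext => x; rewrite rV_cons0.
rewrite (_ : (fun _ => _) = (fun v : 'rV[R]_n => v ord0 j) \o snd).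
  exact: (measurableT_comp (measurable_coord j) measurable_snd).
by apply/funext => x; rewrite rV_consS.
Qed.

Section step.
Variables (n : nat) (mu : {sigma_finite_measure set 'rV[R]_n -> \bar R}).

Definition lebesgue_rVS : set 'rV[R]_n.+1 -> \bar R :=
  pushforward (@lebesgue_measure R \x mu)%E (@rV_cons n).

Let mcons := @measurable_rV_cons n.

Let lebesgue_rVS0 : lebesgue_rVS set0 = 0%E.
Proof. exact: measure0. Qed.

Let lebesgue_rVS_ge0 A : (0 <= lebesgue_rVS A)%E.
Proof. exact: measure_ge0. Qed.

Let lebesgue_rVS_sigma_additive : semi_sigma_additive lebesgue_rVS.
Proof. exact: measure_semi_sigma_additive. Qed.

HB.instance Definition _ := isMeasure.Build _ _ _ lebesgue_rVS
  lebesgue_rVS0 lebesgue_rVS_ge0 lebesgue_rVS_sigma_additive.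

Let lebesgue_rVS_sigma_finite : sigma_finite setT lebesgue_rVS.
Proof.
have [F FT Foo] : sigma_finite setT (@lebesgue_measure R \x mu)%E.
  have /sigma_finiteP[F [FT ndF Foo]] := sigma_finiteT (@lebesgue_measure R).
  have /sigma_finiteP[G [GT ndG Goo]] := sigma_finiteT mu.
  exists (fun k => F k `*` G k).
    apply/seteqP; split=> // -[x y] _.
    have [i _ Fx] : (\bigcup_k F k) x by rewrite -FT.
    have [j _ Gy] : (\bigcup_k G k) y by rewrite -GT.
    exists (maxn i j) => //; split => /=.
      by move: x Fx; exact/subsetPset/ndF/leq_maxl.
    by move: y Gy; exact/subsetPset/ndG/leq_maxr.
  move=> k; have [? ?] := Foo k; have [? ?] := Goo k.
  split; first exact: measurableX.
  by rewrite product_measure1E// lte_mul_pinfty// ge0_fin_numE.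
exists (fun k => @rV_cons n @` F k).
  apply/seteqP; split=> // v _.
  have [k _ Fk] : (\bigcup_k F k) (v ord0 ord0, \row_i v ord0 (lift ord0 i)).
    by rewrite -FT.
  exists k => //; exists (v ord0 ord0, \row_i v ord0 (lift ord0 i)) => //.
  apply/rowP => i; case: (fintype.unliftP ord0 i) => [j ->|->]; last first.
    by rewrite rV_cons0.
  by rewrite rV_consS mxE.
move=> k; have [mF Fy] := Foo k.
suff FE : @rV_cons n @^-1` (@rV_cons n @` F k) = F k.
  split; last by rewrite /lebesgue_rVS /pushforward FE.
  pose g := fun v : 'rV[R]_n.+1 =>
    (v ord0 ord0 : measurableTypeR R, \row_i v ord0 (lift ord0 i)).
  have mg : measurable_fun setT g.
    apply/measurable_fun_pair; first exact: measurable_coord.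
    apply/measurable_fun_rVP => i; under eq_fun do rewrite mxE.
    exact: measurable_coord.
  have gK : cancel g (@rV_cons n).
    move=> v; apply/rowP => i; case: (fintype.unliftP ord0 i) => [j ->|->]; last first.
      by rewrite rV_cons0.
    by rewrite rV_consS mxE.
  rewrite (_ : _ @` _ = setT `&` g @^-1` F k); first exact: mg.
  rewrite setTI -[in RHS]FE; apply/seteqP; split=> v.
    by rewrite /preimage /= gK.
  by rewrite /preimage /= gK.
apply/seteqP; split=> x; last by move=> Fx; exists x.
move=> [y Fy' yx]; suff -> : x = y by [].
case: x y yx {Fy'} => [x1 x2] [y1 y2] yx; congr pair.
  by have := congr1 (fun v : 'rV_n.+1 => v ord0 ord0) yx; rewrite !rV_cons0.
apply/rowP => i.
have := congr1 (fun v : 'rV_n.+1 => v ord0 (lift ord0 i)) yx.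
by rewrite !rV_consS.
Qed.

HB.instance Definition _ := Measure_isSigmaFinite.Build _ _ _ lebesgue_rVS
  lebesgue_rVS_sigma_finite.

End step.

Fixpoint lebesgue_rV n : {sigma_finite_measure set 'rV[R]_n -> \bar R} :=
  match n with
  | 0 => dirac (0 : 'rV[R]_0)
  | n.+1 => lebesgue_rVS (lebesgue_rV n)
  end.

Lemma lebesgue_rV_box n (A : 'I_n -> set R) : (forall i, measurable (A i)) ->
  lebesgue_rV n [set v | forall i, A i (v ord0 i)] =
  (\prod_(i < n) @lebesgue_measure R (A i))%E.
Proof.
elim: n A => [|n IH] A mA /=.
  by rewrite big_ord0 diracE mem_set//= => -[].
pose B := [set v : 'rV[R]_n | forall i, A (lift ord0 i) (v ord0 i)].
have mB : measurable B.
  rewrite (_ : B = \bigcap_(i in [set: 'I_n])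
      ((fun v : 'rV[R]_n => v ord0 i) @^-1` A (lift ord0 i))).
    apply: fin_bigcap_measurable => // i _; rewrite -[X in measurable X]setTI.
    exact: measurable_coord.
  by apply/seteqP; split=> [v vA i _|v vA i]; exact: vA.
rewrite big_ord_recl -(IH (fun i => A (lift ord0 i)))// -/B.
transitivity ((@lebesgue_measure R \x lebesgue_rV n) (A ord0 `*` B))%E; last first.
  exact: (product_measure1E lebesgue_measure (lebesgue_rV n) (mA ord0) mB).
rewrite /lebesgue_rVS /pushforward; congr ((_ \x _)%E _).
apply/seteqP; split=> [[x v] /= xv|[x v] /= [Ax Av] i].
  split; first by have := xv ord0; rewrite rV_cons0.
  by move=> i; have := xv (lift ord0 i); rewrite rV_consS.
case: (fintype.unliftP ord0 i) => [j ->|->]; last by rewrite rV_cons0.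
by rewrite rV_consS.
Qed.

Lemma measurable_rV_shift n (a : 'rV[R]_n) :
  measurable_fun setT (fun v : 'rV[R]_n => v + a).
Proof.
apply/measurable_fun_rVP => i; under eq_fun do rewrite mxE.
by apply: measurable_funD => //; exact: measurable_coord.
Qed.

Lemma measurable_shift (a : R) : measurable_fun [set: R] (fun x => x + a).
Proof. exact: measurable_funD. Qed.

Lemma lebesgue_measure_shift (a : R) (A : set (measurableTypeR R)) :
  measurable A ->
  pushforward (@lebesgue_measure R)
    ((fun x : R => x + a) : _ -> measurableTypeR R) A = lebesgue_measure A.
Proof.
move=> mA.
have ma : measurable_fun [set: measurableTypeR R]
    ((fun x : R => x + a) : _ -> measurableTypeR R).
  exact: measurable_shift.
apply/esym/lebesgue_measure_unique => //= _ [[b c]] _ <-.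
rewrite /pushforward.
rewrite (_ : _ @^-1` _ = `](b - a), (c - a)]%classic); last first.
  by apply/seteqP; split=> x; rewrite /= !in_itv/= ltrBlDr lerBrDr.
rewrite !lebesgue_measure_itv/= !lte_fin ltrD2r; case: ifPn => // _.
by rewrite -!EFinB opprB addrA subrK.
Qed.

Lemma lebesgue_rV_shift n (a : 'rV[R]_n) (A : set 'rV[R]_n) : measurable A ->
  pushforward (lebesgue_rV n) (fun v => v + a) A = lebesgue_rV n A.
Proof.
elim: n a A => [|n IH] a A mA /=.
  by rewrite /pushforward; congr dirac; apply/seteqP; split=> v;
    rewrite /= [v + a](_ : _ = v)//; apply/rowP => -[].
pose a0 := a ord0 ord0; pose a' := \row_i a ord0 (lift ord0 i).
pose f (p : measurableTypeR R * 'rV[R]_n) : measurableTypeR R * 'rV[R]_n :=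
  ((p.1 : R) + a0, p.2 + a').
have ma0 : measurable_fun setT
    ((fun x : R => x + a0) : measurableTypeR R -> measurableTypeR R).
  exact: measurable_shift.
have ma' := measurable_rV_shift a'.
have mf : measurable_fun setT f.
  apply/measurable_fun_pair.
    exact: (measurableT_comp ma0 measurable_fst).
  exact: (measurableT_comp ma' measurable_snd).
have fE : (fun v => v + a) \o @rV_cons n = @rV_cons n \o f.
  apply/funext => -[x v]; apply/rowP => i /=; rewrite mxE.
  case: (fintype.unliftP ord0 i) => [j ->|->]; last by rewrite !rV_cons0.
  by rewrite !rV_consS !mxE.
pose m : {measure set (measurableTypeR R * 'rV[R]_n) -> \bar R} :=
  (@lebesgue_measure R \x lebesgue_rV n)%E.
change (m (@rV_cons n @^-1` ((fun v => v + a) @^-1` A)) =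
        m (@rV_cons n @^-1` A)).
rewrite -[in LHS]comp_preimage fE comp_preimage.
apply/esym; apply: (product_measure_unique (m' := pushforward m f)).
  move=> B C mB mC.
  pose B' : set (measurableTypeR R) := (fun x : R => x + a0) @^-1` B.
  pose C' := (fun v : 'rV[R]_n => v + a') @^-1` C.
  have mB' : measurable B' by rewrite -[B']setTI; exact: ma0.
  have mC' : measurable C' by rewrite -[C']setTI; exact: ma'.
  have BE : lebesgue_measure B' = lebesgue_measure B.
    exact: lebesgue_measure_shift.
  have CE : lebesgue_rV n C' = lebesgue_rV n C := IH a' C mC.
  apply: (etrans (product_measure1E lebesgue_measure (lebesgue_rV n) mB' mC')).
  exact: (congr2 mule BE CE).
by rewrite -[X in measurable X]setTI; exact: measurable_rV_cons.
Qed.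
End lebesgue_rV.
Arguments lebesgue_rV : simpl never.

Variant scalar_kind := real_scalars | complex_scalars.

Section scalar.
Context {R : realType}.

Definition scalar (k : scalar_kind) : numFieldType :=
  match k with real_scalars => R | complex_scalars => R[i] end.

Definition scalar_Re {k} : scalar k -> R :=
  match k with real_scalars => fun z => z | complex_scalars => @complex.Re R end.

Definition scalar_Im {k} : scalar k -> R :=
  match k with real_scalars => fun=> 0 | complex_scalars => @complex.Im R end.

(* [a + i b]; the imaginary part is dropped over the reals. *)
Definition scalar_of {k} (a b : R) : scalar k :=
  match k with real_scalars => a | complex_scalars => Complex a b end.

Definition modulus {k} (z : scalar k) : R :=
  Num.sqrt (scalar_Re z ^+ 2 + scalar_Im z ^+ 2).

Context {k : scalar_kind}.
Implicit Types z w : scalar k.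

Lemma norm_modulus z : `|z| = scalar_of (modulus z) 0.
Proof.
rewrite /modulus; case: k z => /= z; last exact: normc_def.
by rewrite expr0n addr0 sqrtr_sqr.
Qed.

Lemma scalar_Re_norm z : scalar_Re `|z| = modulus z.
Proof. by rewrite norm_modulus; move: (modulus z); case: k. Qed.

Lemma scalar_ofD (a b : R) :
  scalar_of (a + b) 0 = scalar_of a 0 + scalar_of b 0 :> scalar k.
Proof. by case: k => //=; apply/eqP; rewrite eq_complex/= addr0 !eqxx. Qed.

Lemma scalar_ofM (a b : R) :
  scalar_of (a * b) 0 = scalar_of a 0 * scalar_of b 0 :> scalar k.
Proof.
by case: k => //=; apply/eqP; rewrite eq_complex/= !(mulr0, mul0r, subr0, addr0) !eqxx.
Qed.

Lemma scalar_of_le (a b : R) :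
  (scalar_of a 0 <= scalar_of b 0 :> scalar k) = (a <= b).
Proof. by case: k => //=; rewrite lecE/= eqxx. Qed.

Lemma scalar_of_inj (a b : R) :
  scalar_of a 0 = scalar_of b 0 :> scalar k -> a = b.
Proof. by case: k => //= -[]. Qed.

Lemma modulus_ge0 z : 0 <= modulus z. Proof. exact: sqrtr_ge0. Qed.

Lemma modulusD z w : modulus (z + w) <= modulus z + modulus w.
Proof. by rewrite -scalar_of_le scalar_ofD -!norm_modulus ler_normD. Qed.

Lemma modulusM z w : modulus (z * w) = modulus z * modulus w.
Proof.
by apply: scalar_of_inj; rewrite scalar_ofM -!norm_modulus normrM.
Qed.

Lemma modulus0 : modulus (0 : scalar k) = 0.
Proof.
apply: scalar_of_inj; rewrite -norm_modulus normr0; case: k => //.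
Qed.

Lemma modulus_eq0 z : modulus z = 0 -> z = 0.
Proof.
move=> z0; apply/normr0_eq0; rewrite norm_modulus z0.
by rewrite -[in RHS](normr0 (scalar k)) norm_modulus modulus0.
Qed.

Lemma scalar_ReD z w : scalar_Re (z + w) = scalar_Re z + scalar_Re w.
Proof. by case: k z w => //= -[? ?] [? ?]. Qed.

Lemma scalar_ImD z w : scalar_Im (z + w) = scalar_Im z + scalar_Im w.
Proof. by case: k z w => //= [? ?|[? ?] [? ?]] //; rewrite addr0. Qed.

Lemma scalar_ReM z w :
  scalar_Re (z * w) = scalar_Re z * scalar_Re w - scalar_Im z * scalar_Im w.
Proof. by case: k z w => //= [? ?|[? ?] [? ?]] //; rewrite mul0r subr0. Qed.

Lemma scalar_ImM z w :
  scalar_Im (z * w) = scalar_Re z * scalar_Im w + scalar_Im z * scalar_Re w.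
Proof. by case: k z w => //= [? ?|[? ?] [? ?]] //; rewrite mulr0 mul0r addr0. Qed.

End scalar.
Arguments scalar : clear implicits.

Section scalar_functions.
Context d (T : measurableType d) (R : realType) (k : scalar_kind).
Variable mu : {measure set T -> \bar R}.
Implicit Types f g : T -> scalar R k.

Definition scalar_measurable f :=
  measurable_fun [set: T] (scalar_Re \o f) /\
  measurable_fun [set: T] (scalar_Im \o f).

Definition scalar_integral f : scalar R k :=
  scalar_of (\int[mu]_x scalar_Re (f x))%R (\int[mu]_x scalar_Im (f x))%R.

Lemma scalar_measurableD f g : scalar_measurable f -> scalar_measurable g ->
  scalar_measurable (f + g).
Proof.
move=> [fr fi] [gr gi]; split.
  rewrite (_ : _ \o _ = (scalar_Re \o f) \+ (scalar_Re \o g)).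
    exact: measurable_funD.
  by apply/funext => x /=; rewrite -scalar_ReD.
rewrite (_ : _ \o _ = (scalar_Im \o f) \+ (scalar_Im \o g)).
  exact: measurable_funD.
by apply/funext => x /=; rewrite -scalar_ImD.
Qed.

Lemma scalar_measurable_cst z : scalar_measurable (cst z).
Proof.
split; first exact: (measurable_cst (scalar_Re z)).
exact: (measurable_cst (scalar_Im z)).
Qed.

Lemma scalar_measurableZ (a : scalar R k) f :
  scalar_measurable f -> scalar_measurable (a *: f).
Proof.
move=> [fr fi]; split.
  rewrite (_ : _ \o _ = (cst (scalar_Re a) \* (scalar_Re \o f)) \-
                        (cst (scalar_Im a) \* (scalar_Im \o f))).
    by apply: measurable_funB; exact: measurable_funM.
  by apply/funext => x /=; rewrite -scalar_ReM.
rewrite (_ : _ \o _ = (cst (scalar_Re a) \* (scalar_Im \o f)) \+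
                      (cst (scalar_Im a) \* (scalar_Re \o f))).
  by apply: measurable_funD; exact: measurable_funM.
by apply/funext => x /=; rewrite -scalar_ImM.
Qed.

Lemma measurable_modulus f :
  scalar_measurable f -> measurable_fun [set: T] (modulus \o f).
Proof.
move=> [fr fi].
have ms := continuous_measurable_fun (@sqrt_continuous R).
apply: (measurableT_comp ms).
by apply: measurable_funD; exact: measurable_funX.
Qed.

End scalar_functions.

Section Lnorm_extra.
Context d (T : measurableType d) (R : realType).
Variable mu : {measure set T -> \bar R}.
Local Open Scope ereal_scope.

Lemma le_Lnorm (p : \bar R) (f g : T -> R) : 1 <= p ->
  measurable_fun [set: T] f -> measurable_fun [set: T] g ->
  (forall x, `|f x| <= `|g x|)%R ->
  'N[mu]_p[EFin \o f] <= 'N[mu]_p[EFin \o g].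
Proof.
move=> p1 mf mg fg; rewrite unlock; case: p p1 => [r r1|_|//].
  have r0 : (0 <= r)%R by move: r1; rewrite lee_fin; exact: le_trans.
  have mpow (h : T -> R) : measurable_fun [set: T] h ->
      measurable_fun [set: T] (fun x => `|(h x)%:E| `^ r).
    move=> mh; apply/measurable_EFinP => /=.
    apply: (@measurableT_comp _ _ _ _ _ _ (@powR R ^~ r)) => //.
    exact: measurableT_comp.
  apply: gt0_ler_poweR; rewrite ?invr_ge0//.
  - by rewrite in_itv/= leey andbT integral_ge0// => x _; rewrite poweR_ge0.
  - by rewrite in_itv/= leey andbT integral_ge0// => x _; rewrite poweR_ge0.
  apply: ge0_le_integral => //=; [exact: mpow|exact: mpow|].
  move=> x _; rewrite lee_fin; apply: ge0_ler_powR => //; rewrite nnegrE//.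
case: ifPn => // _; apply: le_ess_sup; apply: aeW => x /=.
by rewrite lee_fin.
Qed.

Lemma ae_eq_Lnorm (p : \bar R) (f g : T -> R) : 1 <= p ->
  measurable_fun [set: T] f -> measurable_fun [set: T] g ->
  (\forall x \ae mu, f x = g x) ->
  'N[mu]_p[EFin \o f] = 'N[mu]_p[EFin \o g].
Proof.
move=> p1 mf mg fg; rewrite unlock; case: p p1 => [r r1|_|//].
  have mpow (h : T -> R) : measurable_fun [set: T] h ->
      measurable_fun [set: T] (fun x => `|(h x)%:E| `^ r).
    move=> mh; apply/measurable_EFinP => /=.
    apply: (@measurableT_comp _ _ _ _ _ _ (@powR R ^~ r)) => //.
    exact: measurableT_comp.
  apply: (congr1 (fun z => poweR z r^-1)).
  apply: ge0_ae_eq_integral => //=; [exact: mpow|exact: mpow|].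
  by apply: filterS fg => x -> _.
case: ifPn => // _; apply: eq_ess_sup.
by apply: filterS fg => x /= ->.
Qed.

Variables phi psi : T -> T.
Hypotheses (mphi : measurable_fun [set: T] phi)
  (mpsi : measurable_fun [set: T] psi) (psiK : cancel psi phi).
Hypotheses
  (phimu : forall A, measurable A -> pushforward mu phi A = mu A)
  (psimu : forall A, measurable A -> pushforward mu psi A = mu A).

Lemma ae_preserving (h : T -> T) (P : T -> Prop) :
  measurable_fun [set: T] h ->
  (forall A, measurable A -> pushforward mu h A = mu A) ->
  (\forall x \ae mu, P x) -> \forall x \ae mu, P (h x).
Proof.
move=> mh hmu [N [mN N0 PN]]; exists (h @^-1` N); split.
- by rewrite -[X in measurable X]setTI; exact: mh.
- by rewrite -N0; exact: hmu.
- by move=> x Px; exact: PN.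
Qed.

Lemma Lnorm_preserving (p : \bar R) (g : T -> R) : 1 <= p ->
  measurable_fun [set: T] g ->
  'N[mu]_p[EFin \o (g \o phi)] = 'N[mu]_p[EFin \o g].
Proof.
move=> p1 mg; rewrite unlock; case: p p1 => [r r1|_|//].
  apply: (congr1 (fun z => poweR z r^-1)).
  have mpow : measurable_fun [set: T] (fun x => `|(g x)%:E| `^ r).
    apply/measurable_EFinP => /=.
    apply: (@measurableT_comp _ _ _ _ _ _ (@powR R ^~ r)) => //.
    exact: measurableT_comp.
  rewrite [RHS](eq_measure_integral (pushforward mu phi)); last first.
    by move=> A mA _; rewrite /= phimu.
  rewrite (ge0_integral_pushforward mphi)//.
  by move=> x _; rewrite lee_fin powR_ge0.
case: ifPn => // _; rewrite !ess_supEae; congr ereal_inf.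
apply/seteqP; split=> y /=; last exact: ae_preserving.
move=> /(ae_preserving mpsi psimu); apply: filterS => x /=.
by rewrite psiK.
Qed.

End Lnorm_extra.

Section scalar_Lp.
Context d (T : measurableType d) (R : realType) (k : scalar_kind).
Variables (mu : {measure set T -> \bar R}) (p : \bar R) (p1 : (1 <= p)%E).
Local Notation K := (scalar R k).
Implicit Types f g : T -> K.

Definition scalar_Lnorm f : \bar R := 'N[mu]_p[EFin \o (modulus \o f)]%E.

Lemma scalar_Lnorm_ge0 f : (0 <= scalar_Lnorm f)%E.
Proof. exact: Lnorm_ge0. Qed.

Lemma scalar_LnormD f g : scalar_measurable f -> scalar_measurable g ->
  (scalar_Lnorm (f + g)%R <= scalar_Lnorm f + scalar_Lnorm g)%E.
Proof.
move=> mf mg; have mf' := measurable_modulus mf.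
have mg' := measurable_modulus mg.
apply: le_trans (eminkowski mu mf' mg' p1).
apply: le_Lnorm => //.
- exact: measurable_modulus (scalar_measurableD mf mg).
- exact: measurable_funD.
- move=> x /=; rewrite !ger0_norm ?addr_ge0 ?modulus_ge0//.
  exact: modulusD.
Qed.

(* [p1] is a phantom argument, as in [LfunType]. *)
Definition scalar_Lfun of (1 <= p)%E : {pred T -> K} :=
  mem [set f : T -> K | scalar_measurable f /\ (scalar_Lnorm f < +oo)%E].

Lemma scalar_LfunP f : reflect (scalar_measurable f /\ (scalar_Lnorm f < +oo)%E)
  (f \in scalar_Lfun p1).
Proof. by apply: (iffP idP); rewrite inE. Qed.

Lemma scalar_Lnorm_fine f : f \in scalar_Lfun p1 ->
  (fine (scalar_Lnorm f))%:E = scalar_Lnorm f.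
Proof.
by move=> /scalar_LfunP[_ foo]; rewrite fineK// ge0_fin_numE ?scalar_Lnorm_ge0.
Qed.

Lemma scalar_LnormZ a f : f \in scalar_Lfun p1 ->
  scalar_Lnorm (a *: f) = ((modulus a)%:E * scalar_Lnorm f)%E.
Proof.
move=> /scalar_LfunP[mf foo].
have lf : modulus \o f \in Lfun mu p.
  by apply/andP; split; rewrite inE//=; exact: measurable_modulus.
have := LnormZ (Lfun_Sub p1 lf) (modulus a).
rewrite (ger0_norm (modulus_ge0 _)) => <-.
by apply: eq_Lnorm => x /=; rewrite modulusM.
Qed.

Lemma scalar_Lfun_submod_closed : submod_closed (scalar_Lfun p1).
Proof.
have Z a f : f \in scalar_Lfun p1 -> a *: f \in scalar_Lfun p1.
  move=> fL; apply/scalar_LfunP; rewrite scalar_LnormZ//.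
  move/scalar_LfunP : fL => [mf foo]; split; first exact: scalar_measurableZ.
  by rewrite lte_mul_pinfty// lee_fin modulus_ge0.
split.
  apply/scalar_LfunP; split; first exact: (scalar_measurable_cst T 0).
  rewrite /scalar_Lnorm (@eq_Lnorm _ _ _ _ _ _ (cst 0%E)).
    by rewrite Lnorm0// gt_eqF// (lt_le_trans _ p1).
  by move=> x /=; rewrite [X in modulus X](_ : _ = 0)// modulus0.
move=> a f g /(Z a)/scalar_LfunP[mf foo] /scalar_LfunP[mg goo].
apply/scalar_LfunP; split; first exact: scalar_measurableD.
by rewrite (le_lt_trans (scalar_LnormD _ _))// lte_add_pinfty.
Qed.

HB.instance Definition _ := GRing.isSubmodClosed.Build _ _ (scalar_Lfun p1)
  scalar_Lfun_submod_closed.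

Record LpFun := MkLpFun {
  LpFun_val :> T -> K ;
  LpFun_prop : LpFun_val \in scalar_Lfun p1 }.

HB.instance Definition _ := [isSub for LpFun_val].
HB.instance Definition _ := [Choice of LpFun by <:].
HB.instance Definition _ := [SubChoice_isSubLmodule of LpFun by <:].

Definition Lp_null : {pred LpFun} :=
  mem [set f : LpFun | \forall x \ae mu, f x = 0].

Lemma Lp_nullP (f : LpFun) : reflect (\forall x \ae mu, f x = 0) (f \in Lp_null).
Proof. by apply: (iffP idP); rewrite inE. Qed.

Lemma Lp_null_zmod_closed : zmod_closed Lp_null.
Proof.
split; first by apply/Lp_nullP; exact: aeW.
move=> f g /Lp_nullP f0 /Lp_nullP g0; apply/Lp_nullP.
apply: filterS2 f0 g0 => x fx gx.
rewrite [LHS](_ : _ = LpFun_val f x - LpFun_val g x)//.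
by rewrite fx gx subr0.
Qed.

HB.instance Definition _ := GRing.isZmodClosed.Build _ Lp_null
  Lp_null_zmod_closed.

(* [L_p]-functions modulo equality almost everywhere. *)
Definition Lp : Type := Quotient.quot Lp_null.
HB.instance Definition _ := GRing.Zmodule.on Lp.
HB.instance Definition _ := EqQuotient.on Lp.
Local Open Scope quotient_scope.

Lemma Lp_piP (f g : LpFun) :
  reflect (\forall x \ae mu, f x = g x) (\pi_Lp f == \pi_Lp g).
Proof.
have -> : (\pi_Lp f == \pi_Lp g) = (f - g \in Lp_null).
  by rewrite Quotient.idealrBE.
apply: (iffP (Lp_nullP _)).
  apply: filterS => x; rewrite [LHS](_ : _ = LpFun_val f x - LpFun_val g x)//.
  by move/eqP; rewrite subr_eq0 => /eqP.
apply: filterS => x fgx.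
rewrite [LHS](_ : _ = LpFun_val f x - LpFun_val g x)//.
by rewrite fgx subrr.
Qed.

Lemma Lp_repr_ae (f : LpFun) : \forall x \ae mu, repr (\pi_Lp f) x = f x.
Proof. by apply/Lp_piP; rewrite reprK. Qed.

Lemma Lp_ind (P : Lp -> Prop) : (forall f : LpFun, P (\pi_Lp f)) -> forall u, P u.
Proof. by move=> Ppi u; rewrite -[u]reprK. Qed.

Lemma Lp_piD (f g : LpFun) : \pi_Lp (f + g) = \pi_Lp f + \pi_Lp g.
Proof. exact: raddfD. Qed.

Definition Lp_scale (a : K) (u : Lp) : Lp := \pi_Lp (a *: repr u).

Lemma Lp_piZ (a : K) (f : LpFun) : Lp_scale a (\pi_Lp f) = \pi_Lp (a *: f).
Proof.
apply/eqP/Lp_piP; apply: filterS (Lp_repr_ae f) => x fx.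
rewrite [LHS](_ : _ = a * LpFun_val (repr (\pi_Lp f)) x)//.
by rewrite [RHS](_ : _ = a * LpFun_val f x)// fx.
Qed.

Lemma Lp_scaleA (a b : K) u : Lp_scale a (Lp_scale b u) = Lp_scale (a * b) u.
Proof. by elim/Lp_ind: u => f; rewrite !Lp_piZ scalerA. Qed.

Lemma Lp_scale1 : left_id 1 Lp_scale.
Proof. by elim/Lp_ind => f; rewrite Lp_piZ scale1r. Qed.

Lemma Lp_scaleDr : right_distributive Lp_scale +%R.
Proof.
move=> a; elim/Lp_ind => f; elim/Lp_ind => g; rewrite -Lp_piD !Lp_piZ scalerDr.
exact: Lp_piD.
Qed.

Lemma Lp_scaleDl u : {morph Lp_scale^~ u : a b / a + b}.
Proof. by move=> a b; elim/Lp_ind: u => f; rewrite !Lp_piZ scalerDl -Lp_piD. Qed.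

HB.instance Definition _ := GRing.Zmodule_isLmodule.Build K Lp
  Lp_scaleA Lp_scale1 Lp_scaleDr Lp_scaleDl.

(* The norm of a [normedModType K] has values in [K], hence the injection of
   the real number [||u||_p] into [K]. *)
Definition Lp_norm (u : Lp) : K := scalar_of (fine (scalar_Lnorm (repr u))) 0.

Lemma Lp_norm_pi (f : LpFun) :
  Lp_norm (\pi_Lp f) = scalar_of (fine (scalar_Lnorm f)) 0.
Proof.
congr (scalar_of (fine _) 0); apply: ae_eq_Lnorm => //.
- by apply: measurable_modulus; have /scalar_LfunP[] := LpFun_prop (repr (\pi_Lp f)).
- by apply: measurable_modulus; have /scalar_LfunP[] := LpFun_prop f.
- by apply: filterS (Lp_repr_ae f) => x /= ->.
Qed.

Lemma Lp_ler_normD u v : Lp_norm (u + v) <= Lp_norm u + Lp_norm v.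
Proof.
elim/Lp_ind: u => f; elim/Lp_ind: v => g.
rewrite -Lp_piD !Lp_norm_pi -scalar_ofD scalar_of_le.
rewrite -lee_fin EFinD !scalar_Lnorm_fine; try exact: LpFun_prop.
have /scalar_LfunP[mu' _] := LpFun_prop f.
have /scalar_LfunP[mv _] := LpFun_prop g.
exact: scalar_LnormD.
Qed.

Lemma Lp_normZ a u : Lp_norm (a *: u) = `|a| * Lp_norm u.
Proof.
elim/Lp_ind: u => f; rewrite [a *: _]Lp_piZ !Lp_norm_pi norm_modulus -scalar_ofM.
congr scalar_of; apply: EFin_inj; rewrite EFinM !scalar_Lnorm_fine;
  try exact: LpFun_prop.
exact: scalar_LnormZ (LpFun_prop _).
Qed.

Lemma Lp_norm0_eq0 u : Lp_norm u = 0 -> u = 0.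
Proof.
elim/Lp_ind: u => f; rewrite Lp_norm_pi => f0.
have /scalar_LfunP[mf _] := LpFun_prop f.
have N0 : scalar_Lnorm f = 0%E.
  rewrite -scalar_Lnorm_fine; last exact: LpFun_prop.
  by congr EFin; apply: (@scalar_of_inj _ k); rewrite f0; case: (k).
have mEf : measurable_fun [set: T] (EFin \o (modulus \o f)).
  exact/measurable_EFinP/measurable_modulus.
have := Lnorm_eq0_eq0 mEf (lt_le_trans lte01 p1) N0.
rewrite -[RHS](raddf0 \pi_Lp) => fae; apply/eqP/Lp_piP.
by apply: filterS fae => x /(_ I) [] /modulus_eq0.
Qed.

HB.instance Definition _ := Lmodule_isNormed.Build K Lp
  Lp_ler_normD Lp_normZ Lp_norm0_eq0.

End scalar_Lp.

Section translation.
Context (R : realType) (k : scalar_kind) (n : nat).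
Local Notation K := (scalar R k).
Local Notation mu := (lebesgue_rV R n).
Local Open Scope quotient_scope.
Implicit Types (l : 'rV[R]_n) (f : 'rV[R]_n -> K).

Definition translate l f : 'rV[R]_n -> K := fun x => f (x - l).

Lemma scalar_measurable_translate l f :
  scalar_measurable f -> scalar_measurable (translate l f).
Proof.
move=> [fr fi]; split.
  exact: (measurableT_comp fr (measurable_rV_shift (- l))).
exact: (measurableT_comp fi (measurable_rV_shift (- l))).
Qed.

Variables (p : \bar R) (p1 : (1 <= p)%E).

Lemma scalar_Lnorm_translate l f : scalar_measurable f ->
  scalar_Lnorm mu p (translate l f) = scalar_Lnorm mu p f.
Proof.
move=> /measurable_modulus mf.
apply: (Lnorm_preserving (measurable_rV_shift (- l)) (measurable_rV_shift l)
  (addrK l) (lebesgue_rV_shift (- l)) (lebesgue_rV_shift l)) => //.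
Qed.

Lemma translate_Lfun l (f : LpFun k mu p1) :
  translate l f \in scalar_Lfun mu p1.
Proof.
have /scalar_LfunP[mf foo] := LpFun_prop f; apply/scalar_LfunP.
by rewrite scalar_Lnorm_translate//; split=> //; exact: scalar_measurable_translate.
Qed.

Definition LpFun_translate l (f : LpFun k mu p1) : LpFun k mu p1 :=
  MkLpFun (translate_Lfun l f).

Definition Lp_translate l (u : Lp k mu p1) : Lp k mu p1 :=
  \pi_(Lp k mu p1) (LpFun_translate l (repr u)).

Lemma Lp_translate_pi l (f : LpFun k mu p1) :
  Lp_translate l (\pi_(Lp k mu p1) f) = \pi_(Lp k mu p1) (LpFun_translate l f).
Proof.
apply/eqP/Lp_piP.
exact: (ae_preserving (measurable_rV_shift (- l)) (lebesgue_rV_shift (- l))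
  (Lp_repr_ae f)).
Qed.

End translation.

Section duality.
Context d (T : measurableType d) (R : realType) (k : scalar_kind).
Variable mu : {measure set T -> \bar R}.
Variables (p q : \bar R) (p1 : (1 <= p)%E) (q1 : (1 <= q)%E).
Local Open Scope quotient_scope.

(* The bilinear pairing [u |-> \int F u], without conjugation over the
   complex numbers. *)
Definition Lp_dual (F : Lp k mu q1) (u : Lp k mu p1) : scalar R k :=
  scalar_integral mu (fun x => repr F x * repr u x).

Lemma Lp_dual_pi (F : LpFun k mu q1) (f : LpFun k mu p1) :
  Lp_dual (\pi_(Lp k mu q1) F) (\pi_(Lp k mu p1) f) =
  scalar_integral mu (fun x => F x * f x).
Proof.
have mM (g h : T -> scalar R k) : scalar_measurable g -> scalar_measurable h ->
    scalar_measurable (fun x => g x * h x).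
  move=> [gr gi] [hr hi]; split.
    rewrite (_ : _ \o _ = ((scalar_Re \o g) \* (scalar_Re \o h)) \-
                          ((scalar_Im \o g) \* (scalar_Im \o h))).
      by apply: measurable_funB; exact: measurable_funM.
    by apply/funext => x /=; rewrite -scalar_ReM.
  rewrite (_ : _ \o _ = ((scalar_Re \o g) \* (scalar_Im \o h)) \+
                        ((scalar_Im \o g) \* (scalar_Re \o h))).
    by apply: measurable_funD; exact: measurable_funM.
  by apply/funext => x /=; rewrite -scalar_ImM.
have ml r (r1 : (1 <= r)%E) (g : LpFun k mu r1) : scalar_measurable g.
  by have /scalar_LfunP[] := LpFun_prop g.
have [lr li] := mM _ _ (ml _ _ (repr (\pi_(Lp k mu q1) F)))
                       (ml _ _ (repr (\pi_(Lp k mu p1) f))).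
have [rr ri] := mM _ _ (ml _ _ F) (ml _ _ f).
congr scalar_of; congr fine; apply: ae_eq_integral => //;
  try exact/measurable_EFinP;
  by apply: filterS2 (Lp_repr_ae F) (Lp_repr_ae f) => x -> -> _.
Qed.

End duality.

Section frames.
Context (K : numFieldType) (X : normedModType K).

(* [0 < r] in [K] forces [r] to be real, also when [K] is complex. *)
Definition seminormalized (x : nat -> X) :=
  exists r s : K, 0 < r /\ forall i, r <= `|x i| <= s.

Definition unconditionally_convergent (x : nat -> X) :=
  forall s : nat -> nat, bijective s -> cvgn (series (x \o s)).

Definition dual_element (phi : X -> K) :=
  linear (phi : X -> K^o) /\ continuous phi.

Definition schauder_frame (f : nat -> X) (f' : nat -> X -> K) :=
  (forall i, dual_element (f' i)) /\
  forall g, series (fun i => f' i g *: f i) @ \oo --> g.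

Definition unconditional_schauder_frame (f : nat -> X) (f' : nat -> X -> K) :=
  schauder_frame f f' /\
  forall g, unconditionally_convergent (fun i => f' i g *: f i).

End frames.

Section exponents.
Context (R : realType) (p p' : R).

Lemma exponent_ge1 : 2 < p -> (1 <= p%:E)%E.
Proof. by move=> p2; rewrite lee_fin (le_trans _ (ltW p2))// ler1n. Qed.

Lemma conjugate_exponent_ge1 :
  2 < p -> p^-1 + p'^-1 = 1 -> (1 <= p'%:E)%E.
Proof.
move=> p2 pp'; have p0 : 0 < p^-1 by rewrite invr_gt0 (lt_trans _ p2).
have p1 : p^-1 < 1 by rewrite invf_lt1 ?(lt_trans _ p2)// ltr1n.
have p'E : p'^-1 = 1 - p^-1 by rewrite -pp' addrC addKr.
have p'0 : 0 < p' by rewrite -invr_gt0 p'E subr_gt0.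
by rewrite lee_fin -invf_le1// p'E gerBl ltW.
Qed.

End exponents.

(* Main.v *)
Require Import Defs.
From mathcomp Require Import all_boot all_order all_algebra.
From mathcomp Require Import complex.
From mathcomp Require Import all_classical all_reals all_analysis.
From mathcomp Require Import measurable_realfun hoelder.
From mathcomp Require Import generic_quotient ring_quotient.
From mathcomp Require Import ring lra zify.
Import Order.TTheory GRing.Theory Num.Theory.
Import numFieldNormedType.Exports.
Import Defs.
Local Open Scope classical_set_scope.
Local Open Scope ring_scope.
Set Implicit Arguments.
Unset Strict Implicit.
Unset Printing Implicit Defensive.

(** Let [e_j] be the Haar functions normalised in [L_p], [es_j] the same
    functions normalised in [L_p'], and [h_i] the Rademacher functions of the
    unit cell, seen in [L_p'].  Cut the indices into consecutive blocks, the
    [j]-th one of length [N_j], write [b i] for the block of [i], and put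
      [f = \sum_j c_j \sum_(b i = j) T_(- lambda_i) e_j],
    where [c_j] is [N_j] to the power [- (1/2 + eta)], [eta = (p - 2) / (4 p)].
    If [lambda] is sparse enough (a subsequence of an unbounded sequence can be
    made as sparse as desired) all the translated pieces that matter are
    disjointly supported.  So the [j]-th summand has norm at most [c_j] times
    the [p]-th root of [N_j], which is summable for fast growing [N_j], and
      [T_(lambda_i) f = c_(b i) e_(b i) + r_i],
    where the [r_i] collect the pieces that were not brought back home and
    satisfy an upper [p]-estimate with a small constant ([spread_function]).

    The functionals [F_i = (N_(b i) c_(b i))^-1 es_(b i) + h_i] almost form a
    frame with these vectors.  Indeed [\sum_i F_i(z) T_(lambda_i) f] has three
    parts.  The first, [\sum_i N_(b i)^-1 es_(b i)(z) e_(b i)], is the Haar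
    expansion of [z] in which each term is split into [N_j] equal shares; it
    converges to [z], unconditionally, because the Haar system has bounded
    multipliers.  The second, [\sum_i (N c)^-1 es_(b i)(z) r_i], is small by the
    [p]-estimate of the [r_i], because [N_j c_j] is much larger than the [p]-th
    root of [N_j].  The third, [\sum_i h_i(z) T_(lambda_i) f], is small because
    [p' < 2] gives [(h_i)] an upper [2]-estimate, hence [(h_i(z))] is in [l_2],
    and [\sum_i c_(b i)^2 = \sum_j N_j c_j^2] is small.  This is where [p > 2]
    enters: the powers of [N_j] in these three conditions are negative
    simultaneously because [1/p < 1/2].  The [h_i] are there to keep the norms
    of the [F_i] away from [0].

    The sum is therefore [z + E z] with [E] a strict contraction, and the
    adjoint [E'] of [E] is given by the same series with the two sequences
    exchanged.  Solving [F'_i + E' F'_i = F_i] gives the coefficient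
    functionals ([frame_of_perturbation], [frame_from_blocks]).

    The unconditionality of the Haar system is the inequality for martingale
    transforms by signs.  Burkholder's function [U(x, y)] is concave along the
    directions [(1, 1)] and [(1, -1)] and dominates
    [`|y| ^ p - C `|x| ^ p], so that [\int U] of a martingale and of
    its transform decreases from a nonpositive value ([martingale_transform]).
    Conditional expectations are replaced by the measure preserving
    exchange of the two halves of all dyadic cells of one level.  That the Haar
    functions span a dense subspace ([haar_dense]) follows from Dynkin's lemma,
    the dyadic cells being a generating [pi]-system. *)

(** * Burkholder's function *)

Section burkholder_function.
Variables (R : realType) (q : R).
Hypothesis q0 : 0 < q.

Let qg0 : 0 <= q. Proof. exact: ltW. Qed.
Let q10 : 0 < q + 1. Proof. by rewrite addr_gt0. Qed.
Let q20 : 0 < q + 2. Proof. by rewrite addr_gt0. Qed.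
Let q10' : 0 <= q + 1. Proof. exact: ltW. Qed.
Let q20' : 0 <= q + 2. Proof. exact: ltW. Qed.

Lemma is_derive_powR (r x : R) : 0 < x ->
  is_derive x (1 : R) (fun y : R => y `^ r) (r * x `^ (r - 1)).
Proof.
move=> x0; have xI : x \in `]0, +oo[%R by rewrite in_itv/= x0.
apply: DeriveDef; first exact: derivable_powR.
by rewrite -derive1E powR_derive1.
Qed.

(** The mean value theorem, with the derivative only on a half-line away
    from [0], where the powers below are smooth. *)
Lemma concave_tangent (f f' : R -> R) (b x y : R) : 0 < b ->
  (forall z, b <= z -> is_derive z (1 : R) f (f' z)) ->
  (forall z w, b <= z -> z <= w -> f' w <= f' z) ->
  b <= x -> b <= y -> f y <= f x + f' x * (y - x).
Proof.
move=> b0 df f'd bx by_.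
have cont u v : b <= u -> {within `[u, v], continuous f}.
  move=> bu; apply: derivable_within_continuous => z.
  by rewrite in_itv/= => /andP[uz _]; have [] := df _ (le_trans bu uz).
have dI u v z : b <= u -> z \in `]u, v[%R -> is_derive z (1 : R) f (f' z).
  by move=> bu; rewrite in_itv/= => /andP[uz _]; apply/df/(le_trans bu)/ltW.
case: (ltgtP x y) => [xy|yx|->]; last by rewrite subrr mulr0 addr0.
  have [c] := MVT xy (fun z => @dI x y z bx) (cont _ y bx).
  rewrite in_itv/= => /andP[xc cy] e.
  have : f' c * (y - x) <= f' x * (y - x).
    by rewrite ler_pM2r ?subr_gt0//; apply: f'd => //; exact: ltW.
  by rewrite -e; lra.
have [c] := MVT yx (fun z => @dI y x z by_) (cont _ x by_).
rewrite in_itv/= => /andP[xc cy] e.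
have : f' x * (x - y) <= f' c * (x - y).
  by rewrite ler_pM2r ?subr_gt0//; apply: f'd => //; [exact: (le_trans by_ (ltW xc))|exact: ltW].
by rewrite -e; lra.
Qed.

Definition max_abs (a b : R) : R := Num.max `|a| `|b|.

(** Burkholder's function for the exponent [q + 2] in the rotated coordinates
    [a = x + y], [b = x - y].  It is concave in each of them, and a sign
    transform of a martingale moves one coordinate at a time. *)
Definition biconcave (a b : R) : R :=
  - ((q + 2) * (a * b)) * max_abs a b `^ q - q * max_abs a b `^ (q + 2).

Let ppow (x : R) : 0 <= x -> x `^ (q + 1) = x * x `^ q.
Proof.
by move=> x0; rewrite -[in RHS](addrK 1 q) mulr_powRB1.
Qed.

Let ppow2 (x : R) : 0 <= x -> x `^ (q + 2) = x * x `^ (q + 1).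
Proof.
move=> x0; rewrite -mulr_powRB1//.
by congr (_ * _ `^ _); ring.
Qed.

Let pow_le (r x y : R) : 0 <= r -> 0 <= x -> x <= y -> x `^ r <= y `^ r.
Proof.
by move=> r0 x0 xy; apply: ge0_ler_powR; rewrite ?nnegrE// (le_trans x0).
Qed.

(** For fixed [b >= 0], the function [biconcave^~ b] is affine between [- b] and
    [b], equal to [P b a] for [a >= b], and to [P (- b) (- a)] for [a <= - b]. *)
Let P (b a : R) : R := - ((q + 2) * b) * a `^ (q + 1) - q * a `^ (q + 2).
Let P' (b a : R) : R := - ((q + 2) * (q + 1) * b) * a `^ q - q * (q + 2) * a `^ (q + 1).

Let dP (b a : R) : 0 < a -> is_derive a (1 : R) (P b) (P' b a).
Proof.
move=> a0; have d1 := is_derive_powR (q + 1) a0; have d2 := is_derive_powR (q + 2) a0.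
have -> : P b = (- ((q + 2) * b)) \*: (fun y : R => y `^ (q + 1)) -
     q \*: (fun y : R => y `^ (q + 2)) by [].
apply: is_derive_eq; rewrite /P' /GRing.scale/=.
have -> : q + 1 - 1 = q by ring.
have -> : q + 2 - 1 = q + 1 by ring.
by ring.
Qed.

(** Young's inequality for the conjugate exponents [(q + 1) / q] and [q + 1];
    it makes the slope of [P (- b)] decreasing to the right of [b]. *)
Let young (c d : R) : 0 < c -> c <= d ->
  (q + 1) * c * (d `^ q - c `^ q) <= q * (d `^ (q + 1) - c `^ (q + 1)).
Proof.
move=> c0 cd; have d0 : 0 < d := lt_le_trans c0 cd.
have := @conjugate_powR R (d `^ q) (c) ((q + 1) / q) (q + 1) (powR_ge0 _ _) (ltW c0).
rewrite divr_gt0// => /(_ isT q10).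
have -> : ((q + 1) / q)^-1 + (q + 1)^-1 = 1.
  by field; rewrite !gt_eqF.
move=> /(_ erefl).
rewrite -powRrM (_ : q * ((q + 1) / q) = q + 1); last by field; rewrite gt_eqF.
have cE := ppow (ltW c0).
rewrite cE => H.
have : (q + 1) * (d `^ q * c) <= q * d `^ (q + 1) + c * c `^ q.
  have -> : q * d `^ (q + 1) + c * c `^ q =
     (q + 1) * (d `^ (q + 1) / ((q + 1) / q) + c * c `^ q / (q + 1)).
    by field; rewrite !gt_eqF.
  by rewrite ler_pM2l.
by lra.
Qed.

Let P'_decr (b c d : R) : 0 <= b -> b <= c -> 0 < c -> c <= d -> P' b d <= P' b c.
Proof.
move=> b0 bc c0 cd; rewrite /P'.
have h1 : c `^ q <= d `^ q by apply: pow_le => //; exact: ltW.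
have h2 : c `^ (q + 1) <= d `^ (q + 1) by apply: pow_le => //; exact: ltW.
have h3 : 0 <= (q + 2) * (q + 1) * b * (d `^ q - c `^ q).
  by rewrite !mulr_ge0 ?powR_ge0 ?subr_ge0.
have h4 : 0 <= q * (q + 2) * (d `^ (q + 1) - c `^ (q + 1)).
  by rewrite !mulr_ge0 ?powR_ge0 ?subr_ge0.
by lra.
Qed.

Let PN'_decr (b c d : R) : 0 <= b -> b <= c -> 0 < c -> c <= d -> P' (- b) d <= P' (- b) c.
Proof.
move=> b0 bc c0 cd; rewrite /P'.
have h1 : c `^ q <= d `^ q by apply: pow_le => //; exact: ltW.
have yg := young c0 cd.
have : (q + 1) * b * (d `^ q - c `^ q) <= (q + 1) * c * (d `^ q - c `^ q).
  by rewrite ler_wpM2r ?subr_ge0// ler_wpM2l.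
move=> h2; have {}h2 := le_trans h2 yg.
have : (q + 2) * ((q + 1) * b * (d `^ q - c `^ q)) <=
       (q + 2) * (q * (d `^ (q + 1) - c `^ (q + 1))).
  by rewrite ler_wpM2l.
by lra.
Qed.

Let P_tangent (b c d : R) : 0 < b -> b <= c -> b <= d -> P b d <= P b c + P' b c * (d - c).
Proof.
move=> b0; apply: concave_tangent (b0) _ _.
  by move=> z bz; apply: dP; exact: lt_le_trans bz.
by move=> z w bz zw; apply: P'_decr => //; [exact: ltW|exact: lt_le_trans bz].
Qed.

Let PN_tangent (b c d : R) : 0 < b -> b <= c -> b <= d ->
  P (- b) d <= P (- b) c + P' (- b) c * (d - c).
Proof.
move=> b0; apply: concave_tangent (b0) _ _.
  by move=> z bz; apply: dP; exact: lt_le_trans bz.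
by move=> z w bz zw; apply: PN'_decr => //; [exact: ltW|exact: lt_le_trans bz].
Qed.

(** On the axis [b = 0] the branch extends to the point [0], where the powers
    need not be smooth and the inequality is a direct computation. *)
Let P0_tangent (c d : R) : 0 < c -> 0 <= d -> P 0 d <= P 0 c + P' 0 c * (d - c).
Proof.
move=> c0; rewrite le_eqVlt => /orP[/eqP <-|d0].
  rewrite /P /P' !mulr0 !oppr0 !mul0r !add0r powR0 ?gt_eqF// mulr0 oppr0.
  rewrite (ppow2 (ltW c0)).
  have : 0 <= q * (q + 1) * (c * c `^ (q + 1)).
    by rewrite !mulr_ge0 ?powR_ge0// ltW.
  lra.
have m0 : 0 < Num.min c d by rewrite lt_min c0.
apply: (concave_tangent m0).
- by move=> z bz; apply: dP; exact: lt_le_trans bz.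
- move=> z w bz zw; have z0 := lt_le_trans m0 bz.
  exact: P'_decr (lexx 0) (ltW z0) z0 zw.
- by rewrite ge_min lexx.
- by rewrite ge_min lexx orbT.
Qed.

Let biconcaveC (a b : R) : biconcave a b = biconcave b a.
Proof. by rewrite /biconcave /max_abs [in LHS]maxC [a * b]mulrC. Qed.

Let biconcaveNN (a b : R) : biconcave (- a) (- b) = biconcave a b.
Proof. by rewrite /biconcave /max_abs !normrN mulrNN. Qed.

Let biconcave_mid (a b : R) : 0 <= b -> `|a| <= b -> biconcave a b = - ((q + 2) * b `^ (q + 1)) * a - q * b `^ (q + 2).
Proof.
move=> b0 ab; rewrite /biconcave /max_abs (ger0_norm b0) (max_idPr ab) (ppow b0); ring.
Qed.

Let biconcave_pos (a b : R) : 0 <= b -> b <= a -> biconcave a b = P b a.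
Proof.
move=> b0 ab; have a0 := le_trans b0 ab.
rewrite /biconcave /max_abs (ger0_norm b0) (ger0_norm a0) (max_idPl ab) /P (ppow a0); ring.
Qed.

Let biconcave_neg (a b : R) : 0 <= b -> b <= a -> biconcave (- a) b = P (- b) a.
Proof.
move=> b0 ab; have a0 := le_trans b0 ab.
rewrite /biconcave /max_abs normrN (ger0_norm b0) (ger0_norm a0) (max_idPl ab) /P (ppow a0); ring.
Qed.

Let split3 (a b : R) : 0 <= b -> [\/ `|a| <= b, b <= a | b <= - a].
Proof.
move=> b0; have [ab|ab] := leP `|a| b; first by constructor 1.
have [a0|a0] := leP 0 a.
  by constructor 2; rewrite -(ger0_norm a0) ltW.
by constructor 3; rewrite -(ltr0_norm a0) ltW.
Qed.

Let line (b a : R) : R := - ((q + 2) * b `^ (q + 1)) * a - q * b `^ (q + 2).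

Let biconcave_line (a b : R) : 0 < b -> biconcave a b <= line b a.
Proof.
move=> b0; have bg0 := ltW b0; have [ab|ab|ab] := @split3 a b bg0.
- by rewrite biconcave_mid.
- rewrite biconcave_pos// /line /P.
  have a0 := le_trans bg0 ab.
  have h1 : b `^ q <= a `^ q by apply: pow_le => //; exact: ltW.
  have h2 : b `^ (q + 2) <= a `^ (q + 2) by apply: pow_le => //.
  have h3 : q * b `^ (q + 2) <= q * a `^ (q + 2) by rewrite ler_pM2l.
  have h4 : (q + 2) * b * a * b `^ q <= (q + 2) * b * a * a `^ q.
    by rewrite ler_wpM2l// !mulr_ge0.
  rewrite (ppow a0) (ppow bg0); lra.
- rewrite -[a]opprK biconcave_neg//.
  have /(PN_tangent b0 (lexx b)) := ab; move/le_trans; apply.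
  rewrite /line /P /P' (ppow2 bg0) (ppow bg0) opprK; lra.
Qed.

Let biconcave_line_at (b : R) : 0 < b -> (line b b = P b b) * (line b (- b) = P (- b) b).
Proof.
move=> b0; rewrite /line /P (ppow2 (ltW b0)); split; ring.
Qed.

(** Concavity in the first variable, as the existence of a line above the graph
    through each point.  The line of the middle branch lies above the whole
    graph ([biconcave_line]).  The tangent of an outer branch lies above that
    branch, and beyond its end above the middle line, by comparing values and
    slopes at the end. *)
Let biconcave_tangent (a0 b : R) : 0 <= b ->
  exists L, forall a, biconcave a b <= biconcave a0 b + L * (a - a0).
Proof.
rewrite le_eqVlt => /orP[/eqP <-|b0].
  have e a : biconcave a 0 = P 0 `|a|.
    by rewrite /biconcave /max_abs normr0 (max_idPl (normr_ge0 a)) /P; ring.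
  have [->|an0] := eqVneq a0 0.
    exists 0 => a; rewrite mul0r addr0 !e /P normr0 !mulr0 !oppr0 !mul0r !add0r.
    rewrite (@powR0 _ (q + 2)) ?gt_eqF ?addr_gt0// mulr0 oppr0 oppr_le0.
    by rewrite !mulr_ge0 ?powR_ge0 ?subr_ge0.
  have na0 : 0 < `|a0| by rewrite normr_gt0.
  have P'0 : P' 0 `|a0| <= 0.
    rewrite /P' !mulr0 oppr0 mul0r add0r oppr_le0.
    by rewrite !mulr_ge0 ?powR_ge0 ?subr_ge0.
  exists (P' 0 `|a0| * Num.sg a0) => a; rewrite !e.
  apply: le_trans (P0_tangent na0 (normr_ge0 a)) _; rewrite lerD2l -mulrA.
  rewrite ler_wnM2l// mulrBr -(normrEsg a0) lerD2r.
  by rewrite -[leRHS]ger0_norm// (le_trans (ler_norm _))// normrM normr_sg an0 mul1r normr_id.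
have bg0 := ltW b0; have [ab|ab|ab] := @split3 a0 b bg0.
- exists (- ((q + 2) * b `^ (q + 1))) => a.
  rewrite (biconcave_mid bg0 ab); apply: le_trans (biconcave_line a b0) _; rewrite /line; lra.
- have a00 := lt_le_trans b0 ab.
  exists (P' b a0) => a; rewrite (biconcave_pos bg0 ab).
  have [ba|ba] := leP b a; first by rewrite biconcave_pos//; exact: P_tangent.
  apply: le_trans (biconcave_line a b0) _.
  have := P_tangent b0 ab (lexx b); rewrite -(biconcave_line_at b0).1.
  have : P' b a0 <= P' b b by apply: P'_decr.
  have h : P' b b <= - ((q + 2) * b `^ (q + 1)).
    rewrite /P' (ppow bg0).
    have : 0 <= q * (q + 2) * (b * b `^ q) by rewrite !mulr_ge0 ?powR_ge0.
    by nra.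
  move=> /le_trans/(_ h){}h H.
  have : (P' b a0 + (q + 2) * b `^ (q + 1)) * (b - a) <= 0.
    by apply: mulr_le0_ge0; lra.
  move: H; rewrite /line; lra.
- have a00 := lt_le_trans b0 ab.
  exists (- P' (- b) (- a0)) => a; rewrite -[X in _ <= biconcave X _ + _]opprK (biconcave_neg bg0 ab).
  have [ba|ba] := leP b (- a).
    rewrite -[a]opprK biconcave_neg//; apply: le_trans (PN_tangent b0 ab ba) _; lra.
  apply: le_trans (biconcave_line a b0) _.
  have := PN_tangent b0 ab (lexx b); rewrite -(biconcave_line_at b0).2.
  have : P' (- b) (- a0) <= P' (- b) b by apply: PN'_decr.
  have h : P' (- b) b <= (q + 2) * b `^ (q + 1) by rewrite /P' (ppow bg0); nra.
  move=> /le_trans/(_ h){}h H.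
  have : (P' (- b) (- a0) - (q + 2) * b `^ (q + 1)) * (b + a) <= 0.
    by apply: mulr_le0_ge0; lra.
  move: H; rewrite /line; lra.
Qed.

Lemma biconcave_midpoint (a b h : R) : biconcave (a + h) b + biconcave (a - h) b <= 2 * biconcave a b.
Proof.
wlog b0 : a b h / 0 <= b.
  move=> W; have [|/ltW b0] := leP 0 b; first exact: W.
  have := W (- a) (- b) (- h); rewrite oppr_ge0 => /(_ b0).
  by rewrite -opprD biconcaveNN biconcaveNN -opprD biconcaveNN.
have [L tL] := biconcave_tangent a b0.
have := tL (a + h); have := tL (a - h).
have -> : a + h - a = h by ring.
have -> : a - h - a = - h by ring.
lra.
Qed.

(** Burkholder's function for [p = q + 2], up to a constant: it is nonpositive where
    [`|y| <= (p - 1) `|x|], in particular at the first step of a transform. *)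
Definition burkholder (x y : R) : R :=
  2 * (`|x| + `|y|) `^ (q + 1) * (`|y| - (q + 1) * `|x|).

Lemma burkholderE (x y : R) : burkholder x y = biconcave (x + y) (x - y).
Proof.
have mE : max_abs (x + y) (x - y) = `|x| + `|y|.
  by rewrite /max_abs /Num.max;
    case: ifPn; case: (ger0P (x + y)); case: (ger0P (x - y));
    case: (ger0P x); case: (ger0P y) => *; lra.
rewrite /burkholder /biconcave mE.
set m : R := `|x| + `|y|; have m0 : 0 <= m by rewrite addr_ge0.
have -> : (x + y) * (x - y) = `|x| ^+ 2 - `|y| ^+ 2.
  by rewrite !real_normK ?num_real//; ring.
rewrite (ppow2 m0) (ppow m0) /m; ring.
Qed.

(** A martingale difference [h] and its transform [k = h] or [k = - h] leave one
    of the coordinates [x - y] and [x + y] unchanged. *)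
Lemma burkholder_step (x y h k : R) : k = h \/ k = - h ->
  burkholder (x + h) (y + k) + burkholder (x - h) (y - k) <= 2 * burkholder x y.
Proof.
move=> [] ->; rewrite !burkholderE.
  have -> : x + h + (y + h) = (x + y) + 2 * h by ring.
  have -> : x - h + (y - h) = (x + y) - 2 * h by ring.
  have -> : x + h - (y + h) = x - y by ring.
  have -> : x - h - (y - h) = x - y by ring.
  exact: biconcave_midpoint.
have -> : x + h - (y - h) = (x - y) + 2 * h by ring.
have -> : x - h - (y - - h) = (x - y) - 2 * h by ring.
have -> : x + h + (y - h) = x + y by ring.
have -> : x - h + (y - - h) = x + y by ring.
by rewrite ![biconcave (x + y) _]biconcaveC; exact: biconcave_midpoint.
Qed.

Lemma burkholder_le0 (x y : R) : `|y| = `|x| -> burkholder x y <= 0.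
Proof.
rewrite /burkholder => ->; rewrite mulr_ge0_le0// ?mulr_ge0// ?powR_ge0//.
have : 0 <= q * `|x| by rewrite mulr_ge0// ltW.
lra.
Qed.

Lemma burkholder_bound (x y : R) : `|burkholder x y| <= (2 * (q + 2)) * (`|x| + `|y|) `^ (q + 2).
Proof.
rewrite /burkholder; set m : R := `|x| + `|y|; have m0 : 0 <= m by rewrite addr_ge0.
rewrite normrM normrM (ger0_norm (powR_ge0 _ _)) (@ger0_norm _ 2)// (ppow2 m0).
have -> : 2 * (q + 2) * (m * m `^ (q + 1)) = 2 * m `^ (q + 1) * ((q + 2) * m) by ring.
rewrite ler_wpM2l// ?mulr_ge0 ?powR_ge0//.
have qx : 0 <= q * `|x| by rewrite mulr_ge0// ltW.
have qy : 0 <= q * `|y| by rewrite mulr_ge0// ltW.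
have x0 := normr_ge0 x; have y0 := normr_ge0 y.
rewrite /m ler_norml; apply/andP; split; lra.
Qed.

Definition burkholder_cst : R :=
  2 * (q + 1) * (1 + 2 * (q + 1)) `^ (q + 1) + (2 * (q + 1)) `^ (q + 2).

Lemma burkholder_cst_ge0 : 0 <= burkholder_cst.
Proof.
by rewrite addr_ge0// ?powR_ge0// mulr_ge0 ?powR_ge0// mulr_ge0.
Qed.

(** Where [`|y|] is at least [2 (q + 1) `|x|], the last factor of [burkholder]
    is at least half of [`|y|]; elsewhere all terms are multiples of
    [`|x| `^ (q + 2)]. *)
Lemma burkholder_lower (x y : R) :
  `|y| `^ (q + 2) <= burkholder x y + burkholder_cst * `|x| `^ (q + 2).
Proof.
rewrite /burkholder /burkholder_cst; set K := 2 * (q + 1).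
have K0 : 0 <= K by rewrite /K mulr_ge0.
set X : R := `|x|; set Y : R := `|y|; have X0 : 0 <= X by rewrite /X.
have Y0 : 0 <= Y by rewrite /Y.
have -> : 2 * (X + Y) `^ (q + 1) * (Y - (q + 1) * X) =
          (X + Y) `^ (q + 1) * (2 * Y - K * X) by rewrite /K; ring.
have [h|h] := leP (K * X) Y.
  have h1 : Y `^ (q + 1) <= (X + Y) `^ (q + 1) by apply: pow_le => //; rewrite lerDr.
  have h2 : Y * Y `^ (q + 1) <= (X + Y) `^ (q + 1) * Y by rewrite mulrC ler_wpM2r.
  have h3 : (X + Y) `^ (q + 1) * Y <= (X + Y) `^ (q + 1) * (2 * Y - K * X).
    by rewrite ler_wpM2l ?powR_ge0//; lra.
  have h4 : 0 <= (K * (1 + K) `^ (q + 1) + K `^ (q + 2)) * X `^ (q + 2).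
    by rewrite mulr_ge0 ?powR_ge0// addr_ge0 ?powR_ge0// mulr_ge0 ?powR_ge0.
  rewrite (ppow2 Y0); lra.
have h1 : Y `^ (q + 2) <= K `^ (q + 2) * X `^ (q + 2).
  by rewrite -powRM//; apply: pow_le => //; exact: ltW.
have h2 : (X + Y) `^ (q + 1) <= (1 + K) `^ (q + 1) * X `^ (q + 1).
  rewrite -powRM ?addr_ge0//; apply: pow_le; rewrite ?addr_ge0//; lra.
have h3 : K * X * (X + Y) `^ (q + 1) <= K * X * ((1 + K) `^ (q + 1) * X `^ (q + 1)).
  by rewrite ler_wpM2l// mulr_ge0.
have h4 : 0 <= (X + Y) `^ (q + 1) * Y by rewrite mulr_ge0 ?powR_ge0.
have e : K * X * ((1 + K) `^ (q + 1) * X `^ (q + 1)) = K * (1 + K) `^ (q + 1) * X `^ (q + 2).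
  by rewrite (ppow2 X0); ring.
rewrite e in h3; lra.
Qed.

End burkholder_function.

(** * Unconditional sums, bilinear pairings and perturbed frames *)

Section real_norm.
Variables (R : realType) (k : scalar_kind) (X : normedModType (scalar R k)).
Implicit Types (x y : X) (u : nat -> X).

(** The norm takes its values in the field of scalars, which may be complex;
    this is the same number as a real one. *)
Definition rn x : R := modulus (`|x| : scalar R k).

Lemma normE x : `|x| = scalar_of (rn x) 0 :> scalar R k.
Proof. by rewrite -[LHS]normr_id norm_modulus. Qed.

Lemma rn_ge0 x : 0 <= rn x. Proof. exact: modulus_ge0. Qed.

Lemma rnD x y : rn (x + y) <= rn x + rn y.
Proof. by rewrite -(scalar_of_le (k := k)) scalar_ofD -!normE ler_normD. Qed.

Lemma rnZ (a : scalar R k) x : rn (a *: x) = modulus a * rn x.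
Proof.
by apply: (@scalar_of_inj R k); rewrite scalar_ofM -!normE -norm_modulus normrZ.
Qed.

Lemma rnN x : rn (- x) = rn x.
Proof. by rewrite /rn normrN. Qed.

Lemma rnB x y : rn (x - y) <= rn x + rn y.
Proof. by rewrite -[in leRHS](rnN y) rnD. Qed.

Lemma rnC x y : rn (x - y) = rn (y - x).
Proof. by rewrite -rnN opprB. Qed.

Lemma rn0 : rn 0 = 0.
Proof. by rewrite /rn normr0 modulus0. Qed.

Lemma rn_eq0 x : rn x = 0 -> x = 0.
Proof. by move=> /modulus_eq0/normr0_eq0. Qed.

Lemma rn_sum (I : Type) (s : seq I) (P : pred I) (f : I -> X) :
  rn (\sum_(i <- s | P i) f i) <= \sum_(i <- s | P i) rn (f i).
Proof.
elim/big_rec2: _ => [|i y x _ h]; first by rewrite rn0.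
by apply: le_trans (rnD _ _) _; rewrite lerD2l.
Qed.

Definition rcvg u x := forall e : R, 0 < e ->
  exists N, forall n, (N <= n)%N -> rn (u n - x) <= e.

Lemma rcvg_unique u x y : rcvg u x -> rcvg u y -> x = y.
Proof.
move=> ux uy; apply/eqP; rewrite -subr_eq0; apply/eqP/rn_eq0/le_anti.
rewrite rn_ge0 andbT; apply/ler_addgt0Pr => e e0; rewrite add0r.
have e20 : 0 < e / 2 by rewrite divr_gt0.
have [N1 h1] := ux _ e20; have [N2 h2] := uy _ e20.
have := h1 (maxn N1 N2) (leq_maxl _ _); have := h2 (maxn N1 N2) (leq_maxr _ _).
set w := u _ => hy hx; have -> : x - y = (w - y) - (w - x).
  by rewrite opprB addrCA addrAC subrr add0r addrC.
by apply: le_trans (rnB _ _) _; lra.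
Qed.

Lemma rcvgD u v x y : rcvg u x -> rcvg v y -> rcvg (fun n => u n + v n) (x + y).
Proof.
move=> ux vy e e0; have e20 : 0 < e / 2 by rewrite divr_gt0.
have [N1 h1] := ux _ e20; have [N2 h2] := vy _ e20.
exists (maxn N1 N2) => n; rewrite geq_max => /andP[/h1 hx /h2 hy].
by rewrite opprD addrACA; apply: le_trans (rnD _ _) _; lra.
Qed.

Lemma rcvgN u x : rcvg u x -> rcvg (fun n => - u n) (- x).
Proof.
by move=> ux e /ux[N h]; exists N => n /h; rewrite -opprD rnN.
Qed.

Lemma rcvg_bound u x (M : R) : rcvg u x -> (forall n, rn (u n) <= M) -> rn x <= M.
Proof.
move=> ux uM; apply/ler_addgt0Pr => e e0; have [N h] := ux _ e0.
have -> : x = u N - (u N - x) by rewrite opprB addrCA subrr addr0.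
by apply: le_trans (rnB _ _) _; rewrite lerD// h.
Qed.

Lemma rcvg_cvg u x : rcvg u x -> u @ \oo --> x.
Proof.
move=> ux; apply/cvgrPdist_le => e e0.
have eE : e = scalar_of (modulus e) 0 by rewrite -norm_modulus ger0_norm// ltW.
have m0 : 0 < modulus e.
  by rewrite lt_neqAle modulus_ge0 andbT eq_sym; apply/eqP => /modulus_eq0 h; rewrite h ltxx in e0.
have [N h] := ux _ m0; exists N => // n /= Nn.
by rewrite eE normE scalar_of_le rnC h.
Qed.

(** Completeness by absolutely convergent series, the form in which it is
    obtained for [L_p]. *)
Definition rcomplete := forall u (C : R),
  (forall n, \sum_(i < n) rn (u i) <= C) ->
  exists x, rcvg (fun n => \sum_(i < n) u i) x.

Definition rcauchy u := forall e : R, 0 < e ->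
  exists N, forall m n, (N <= m)%N -> (m <= n)%N -> rn (u n - u m) <= e.

(** Telescoping along indices at which the sequence oscillates by at most
    [2 ^ - j]. *)
Lemma rcauchy_rcvg u : rcomplete -> rcauchy u -> exists x, rcvg u x.
Proof.
move=> cX cu.
have pos n : 0 < (2^-1 : R) ^+ n by rewrite exprn_gt0// invr_gt0.
have /choice[N NP] : forall j, exists N, forall m n, (N <= m)%N -> (m <= n)%N ->
    rn (u n - u m) <= 2^-1 ^+ j := fun j => cu _ (pos j).
pose M n := (\sum_(i < n.+1) (N i).+1)%N.
have NM n : (N n <= M n)%N by rewrite /M big_ord_recr/= (leq_trans (leqnSn _))// leq_addl.
have MS n : (M n < M n.+1)%N by rewrite {2}/M big_ord_recr/= -/(M n) addnS ltnS leq_addr.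
pose v n := if n is n'.+1 then u (M n) - u (M n') else u (M 0%N).
have vs n : \sum_(i < n.+1) v i = u (M n).
  elim: n => [|n IH]; first by rewrite big_ord_recr big_ord0/= add0r.
  by rewrite big_ord_recr IH/= addrC subrK.
have vb n : \sum_(i < n) rn (v i) <= rn (v 0%N) + 2.
  have sb m : \sum_(i < m.+1) rn (v i) <= rn (v 0%N) + (2 - 2 * 2^-1 ^+ m).
    elim: m => [|m IH]; first by rewrite big_ord_recr big_ord0 expr0 /= add0r; lra.
    rewrite big_ord_recr/=; have : rn (u (M m.+1) - u (M m)) <= 2^-1 ^+ m.
      exact: NP (NM m) (ltnW (MS m)).
    by rewrite exprS; lra.
  case: n => [|n]; first by rewrite big_ord0 addr_ge0// rn_ge0.
  by apply: le_trans (sb n) _; rewrite lerD2l gerBl mulr_ge0// ltW.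
have [x ux] := cX _ _ vb; exists x => e e0.
have e20 : 0 < e / 2 by rewrite divr_gt0.
have [N1 h1] := ux _ e20; have [N2 h2] := cu _ e20.
exists N2 => n Nn.
have leM m : (m <= M m)%N.
  elim: m => // m IH; exact: leq_ltn_trans IH (MS m).
pose j := maxn N1 n.
have := h1 j.+1 (leq_trans (leq_maxl _ _) (leqnSn _)); rewrite vs => h3.
have h4 := h2 n (M j) Nn (leq_trans (leq_maxr _ _) (leM j)).
have -> : u n - x = (u (M j) - x) - (u (M j) - u n).
  by rewrite opprB [RHS]addrC addrA subrK.
by apply: le_trans (rnB _ _) _; lra.
Qed.

(** Convergence along the finite sets of indices that contain a given initial
    segment; it implies unconditional convergence of the series. *)
Definition usum u x := forall e : R, 0 < e ->
  exists N, forall n (B : pred nat), (forall i, (i < N)%N -> B i) -> (N <= n)%N ->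
    rn (\sum_(i < n | B i) u i - x) <= e.

Lemma usum_rcvg u x : usum u x -> rcvg (fun n => \sum_(i < n) u i) x.
Proof.
by move=> ux e /ux[N h]; exists N => n Nn; have := h n predT; exact.
Qed.

Lemma usumD u v x y : usum u x -> usum v y -> usum (fun n => u n + v n) (x + y).
Proof.
move=> ux vy e e0; have e20 : 0 < e / 2 by rewrite divr_gt0.
have [N1 h1] := ux _ e20; have [N2 h2] := vy _ e20.
exists (maxn N1 N2) => n B hB; rewrite geq_max => /andP[n1 n2].
rewrite big_split/= opprD addrACA; apply: le_trans (rnD _ _) _.
have {}h1 := h1 n B (fun i iN => hB i (leq_trans iN (leq_maxl _ _))) n1.
have {}h2 := h2 n B (fun i iN => hB i (leq_trans iN (leq_maxr _ _))) n2.
lra.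
Qed.

Lemma usum_ext u v x : (forall i, u i = v i) -> usum u x -> usum v x.
Proof. by move=> /funext ->. Qed.

Lemma usum_series u x : usum u x -> series u @ \oo --> x.
Proof.
have -> : series u = (fun n => \sum_(i < n) u i).
  by apply/funext => n; rewrite /series/= big_mkord.
by move=> /usum_rcvg/rcvg_cvg.
Qed.

(** The terms of a long partial sum of a rearranged series are indexed by a
    finite set that contains a given initial segment. *)
Lemma usum_unconditional u x : usum u x -> unconditionally_convergent u.
Proof.
move=> ux s [s' ss' s's]; apply/cvg_ex; exists x; apply: rcvg_cvg => e /ux[N h].
exists (\max_(i < N) (s' i).+1)%N => n nN.
pose r := map s (iota 0 n).
pose n' := maxn N (\max_(i < n) (s i).+1)%N.
have sinj : injective s := can_inj ss'.
have rE : perm_eq r [seq i <- iota 0 n' | i \in r].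
  apply: uniq_perm; rewrite ?filter_uniq ?iota_uniq//.
    by rewrite map_inj_uniq ?iota_uniq.
  move=> i; rewrite mem_filter; case: (boolP (i \in r)) => //= /mapP[j].
  rewrite mem_iota/= add0n => jn ->; rewrite mem_iota/= add0n /n' leq_max; apply/esym/orP; right.
  exact: (@leq_bigmax _ (fun i : 'I_n => (s i).+1) (Ordinal jn)).
have -> : series (u \o s) n = \sum_(i < n' | (i : nat) \in r) u i.
  rewrite /series/= -[RHS](big_mkord (fun i => i \in r)) /index_iota !subn0.
  by rewrite -[RHS]big_filter -(perm_big _ rE)/= big_map.
apply: h; last exact: leq_maxl.
move=> i iN; apply/mapP; exists (s' i); last by rewrite s's.
rewrite mem_iota/= add0n; apply: leq_trans nN.
exact: (@leq_bigmax _ (fun i : 'I_N => (s' i).+1) (Ordinal iN)).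
Qed.

(** The Cauchy criterion for the net of finite sums. *)
Lemma usum_exists u : rcomplete ->
  (forall e : R, 0 < e -> exists N, forall n (B : pred nat),
    (forall i, B i -> (N <= i)%N) -> rn (\sum_(i < n | B i) u i) <= e) ->
  exists x, usum u x.
Proof.
move=> cX hu.
have diff m n (B : pred nat) : (m <= n)%N -> (forall i, (i < m)%N -> B i) ->
    \sum_(i < n | B i) u i - \sum_(i < m) u i = \sum_(i < n | B i && (m <= i)%N) u i.
  move=> mn hB; rewrite (big_ord_widen _ u mn) [X in X - _]big_mkcond.
  rewrite [X in _ - X]big_mkcond [RHS]big_mkcond/= -sumrB; apply: eq_bigr => i _; case: ltnP => im; last first.
    by rewrite andbT subr0.
  by rewrite hB// subrr.
have : rcauchy (fun n => \sum_(i < n) u i).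
  move=> e /hu[N h]; exists N => m n Nm mn; rewrite (diff m n predT)//.
  by apply: (h n (fun i => predT i && (m <= i)%N)) => i /=; exact: leq_trans.
move=> /(rcauchy_rcvg cX)[x ux]; exists x => e e0.
have e20 : 0 < e / 2 by rewrite divr_gt0.
have [N1 h1] := ux _ e20; have [N2 h2] := hu _ e20.
exists (maxn N1 N2) => n B hB Nn.
have {}h1 := h1 _ (leq_maxl N1 N2).
have {}h2 := h2 n [pred i | B i && (maxn N1 N2 <= i)%N].
have /h2 {}h2 : forall i : nat, [pred i0 | B i0 & (maxn N1 N2 <= i0)%N] i -> (N2 <= i)%N.
  by move=> i /andP[_]; exact/leq_trans/leq_maxr.
rewrite -(subrK (\sum_(i < maxn N1 N2) u i) (\sum_(i < n | B i) u i)) diff// -addrA.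
by apply: le_trans (rnD _ _) _; rewrite /= in h2; lra.
Qed.

(** The iteration [z := g - E z]. *)
Lemma contraction_solve (E : X -> X) (theta : R) (g : X) : rcomplete ->
  0 <= theta -> theta < 1 ->
  (forall x y, rn (E x - E y) <= theta * rn (x - y)) ->
  exists x, x + E x = g.
Proof.
move=> cX th0 th1 lE.
pose z := fix z n := if n is n'.+1 then g - E (z n') else 0.
have zS n : z n.+1 = g - E (z n) by [].
pose M := rn (z 1%N - z 0%N).
have dz n : rn (z n.+1 - z n) <= theta ^+ n * M.
  elim: n => [|n IH]; first by rewrite expr0 mul1r.
  rewrite zS [in X in _ - X]zS opprB addrC addrA subrK rnC.
  by rewrite exprS -mulrA; apply: le_trans (lE _ _) _; rewrite ler_wpM2l.
pose v n := z n.+1 - z n.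
have vb n : \sum_(i < n) rn (v i) <= M / (1 - theta).
  have sb m : (1 - theta) * \sum_(i < m) rn (v i) <= M * (1 - theta ^+ m).
    elim: m => [|m IH]; first by rewrite big_ord0 expr0 subrr !mulr0.
    rewrite big_ord_recr/= mulrDr exprS.
    have : (1 - theta) * rn (v m) <= (1 - theta) * (theta ^+ m * M).
      by rewrite ler_wpM2l ?dz// subr_ge0 ltW.
    lra.
  rewrite ler_pdivlMr ?subr_gt0// mulrC; apply: le_trans (sb n) _.
  by rewrite ler_piMr ?rn_ge0// gerBl exprn_ge0.
have vs n : \sum_(i < n) v i = z n.
  by elim: n => [|n IH]; rewrite ?big_ord0// big_ord_recr IH/= /v addrC subrK.
have [x] := cX _ _ vb; under [X in rcvg X]eq_fun do rewrite vs; move=> zx.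
have zx1 : rcvg (fun n => z n.+1) x.
  by move=> e /zx[N h]; exists N => n Nn; apply/h/leqW.
have zx2 : rcvg (fun n => z n.+1) (g - E x).
  move=> e /zx[N h]; exists N => n /h hn.
  rewrite zS opprB addrC addrA subrK rnC; apply: le_trans (lE _ _) _.
  by apply: le_trans hn; rewrite ler_piMl ?rn_ge0// ltW.
exists x; by rewrite {1}(rcvg_unique zx1 zx2) subrK.
Qed.

End real_norm.
Arguments rcomplete {R k} X.

Section pairing.
Variables (R : realType) (k : scalar_kind).
Local Notation K := (scalar R k).

(** The factor [2] in the bound leaves room for estimating an integral of complex
    values by its real and imaginary parts. *)
Record pairing (Y X : normedModType K) (B : Y -> X -> K) : Prop := Pairing {
  pairDl : forall F G x, B (F + G) x = B F x + B G x ;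
  pairDr : forall F x y, B F (x + y) = B F x + B F y ;
  pairZl : forall a F x, B (a *: F) x = a * B F x ;
  pairZr : forall a F x, B F (a *: x) = a * B F x ;
  pair_le : forall F x, modulus (B F x) <= 2 * rn F * rn x }.

Lemma pairing_flip (Y X : normedModType K) (B : Y -> X -> K) :
  pairing B -> pairing (fun x F => B F x).
Proof.
case=> Dl Dr Zl Zr le; split=> // F x.
by apply: le_trans (le _ _) _; rewrite -!mulrA [rn x * _]mulrC.
Qed.

(** The synthesis operator of [v] is bounded by [S] on [l_2]. *)
Definition upper2 (X : normedModType K) (v : nat -> X) (S : R) :=
  forall n (a : nat -> K), rn (\sum_(i < n) a i *: v i) <=
    S * Num.sqrt (\sum_(i < n) modulus (a i) ^+ 2).

Definition conj_scalar (z : K) : K := scalar_of (scalar_Re z) (- scalar_Im z).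

Lemma mul_conj_scalar z : conj_scalar z * z = scalar_of (modulus z ^+ 2) 0.
Proof.
rewrite /conj_scalar /modulus sqr_sqrtr ?addr_ge0 ?sqr_ge0//.
case: k z => [z|[a b]] /=; first by rewrite expr0n addr0.
by apply/eqP; rewrite eq_complex/=; apply/andP; split; apply/eqP; ring.
Qed.

Lemma modulus_conj z : modulus (conj_scalar z) = modulus z.
Proof. by rewrite /conj_scalar /modulus; case: k z => [z|[a b]] //=; rewrite sqrrN. Qed.

Lemma modulus_scalar_of (a : R) : modulus (scalar_of a 0 : K) = `|a|.
Proof.
by rewrite /modulus; case: k => /=; rewrite expr0n/= addr0 sqrtr_sqr.
Qed.

Section dual_estimate.
Variables (Y X : normedModType K) (B : Y -> X -> K) (pB : pairing B).

Lemma pair0r F : B F 0 = 0.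
Proof. by rewrite -(scale0r 0) pairZr// mul0r. Qed.

Lemma pair_sumr F (I : Type) (s : seq I) (P : pred I) (x : I -> X) :
  B F (\sum_(i <- s | P i) x i) = \sum_(i <- s | P i) B F (x i).
Proof.
by elim/big_rec2: _ => [|i y z _ <-]; rewrite ?pair0r// pairDr.
Qed.

Lemma pairBr F x y : B F (x - y) = B F x - B F y.
Proof. by rewrite -scaleN1r pairDr// pairZr// mulN1r. Qed.

Lemma pair_cont F u x : rcvg u x -> forall e : R, 0 < e ->
  exists N, forall n, (N <= n)%N -> modulus (B F (u n) - B F x) <= e.
Proof.
move=> ux e e0.
have F0 : 0 < 1 + 2 * rn F by rewrite ltr_wpDr// mulr_ge0 ?rn_ge0.
have [N h] := ux _ (divr_gt0 e0 F0); exists N => n /h hn.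
rewrite -pairBr; apply: le_trans (pair_le pB _ _) _.
apply: (@le_trans _ _ ((1 + 2 * rn F) * rn (u n - x))).
  by rewrite ler_wpM2r ?rn_ge0// ler_wpDl.
by rewrite mulrC -ler_pdivlMr.
Qed.

(** The analysis operator is dual to the synthesis operator: test the estimate
    on the coefficients [conj_scalar (B F (v i))]. *)
Lemma dual_upper2 (v : nat -> X) (S : R) : upper2 v S -> 0 <= S ->
  forall F n, \sum_(i < n) modulus (B F (v i)) ^+ 2 <= (2 * S * rn F) ^+ 2.
Proof.
move=> vS S0 F n; set A := \sum_(i < n) _.
have A0 : 0 <= A by apply: sumr_ge0 => i _; exact: sqr_ge0.
have := vS n (fun i => conj_scalar (B F (v i))).
under [X in _ <= _ * Num.sqrt X]eq_bigr do rewrite modulus_conj.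
rewrite -/A => h.
have : modulus (B F (\sum_(i < n) conj_scalar (B F (v i)) *: v i)) = A.
  rewrite pair_sumr; under eq_bigr do rewrite pairZr// mul_conj_scalar.
  rewrite (_ : \sum_(i < n) _ = scalar_of A 0); first by rewrite modulus_scalar_of ger0_norm.
  rewrite /A; elim/big_rec2: _ => [|i y z _ ->]; last by rewrite scalar_ofD.
  by case: (k).
move=> e; have := pair_le pB F (\sum_(i < n) conj_scalar (B F (v i)) *: v i).
rewrite e => /le_trans/(_ (ler_wpM2l _ h)); rewrite mulr_ge0 ?rn_ge0// => /(_ isT).
have [->|An0] := eqVneq A 0; first by rewrite sqr_ge0.
have sA : 0 < Num.sqrt A by rewrite sqrtr_gt0 lt_neqAle eq_sym An0.
rewrite -{1}(sqr_sqrtr A0) expr2 mulrA ler_pM2r// => h2.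
rewrite -[leLHS]sqr_sqrtr// ler_sqr ?nnegrE ?sqrtr_ge0//; last by rewrite !mulr_ge0 ?rn_ge0.
by apply: le_trans h2 _; rewrite -!mulrA [rn F * S]mulrC.
Qed.

End dual_estimate.

Lemma tail_small (a : nat -> R) (C : R) : (forall i, 0 <= a i) ->
  (forall n, \sum_(i < n) a i <= C) -> forall e : R, 0 < e ->
  exists N, forall n (B : pred nat), (forall i, B i -> (N <= i)%N) -> \sum_(i < n | B i) a i <= e.
Proof.
move=> a0 aC e e0.
(* Otherwise the partial sums would grow by [e] infinitely often. *)
have [N hN] : exists N, forall n, \sum_(i < n) a i <= \sum_(i < N) a i + e.
  apply: contrapT => /forallNP h.
  have H N : exists n, \sum_(i < N) a i + e < \sum_(i < n) a i.
    by apply: contrapT => /forallNP h'; apply: (h N) => n; rewrite leNgt; apply/negP/h'.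
  have J j : exists n, j%:R * e <= \sum_(i < n) a i.
    elim: j => [|j [n IH]]; first by exists 0%N; rewrite big_ord0 mul0r.
    have [m hm] := H n; exists m; rewrite -natr1 mulrDl mul1r.
    by apply: le_trans (ltW hm); rewrite lerD2r.
  have [n hn] := J (Num.truncn (C / e)).+1.
  have := le_trans hn (aC n); rewrite leNgt => /negP; apply.
  by rewrite -ltr_pdivrMr// truncnS_gt.
exists N => n B BN.
have [nN|Nn] := leqP n N.
  rewrite big_pred0 ?ltW// => i; apply/negP => /BN; rewrite leqNgt.
  by rewrite (leq_trans (ltn_ord i) nN).
have := hN n; rewrite -(big_mkord predT) (@big_cat_nat _ _ _ N)//=; last exact: ltnW.
rewrite big_mkord lerD2l; apply: le_trans.
rewrite -(big_mkord B) (@big_cat_nat _ _ _ N)//=; last exact: ltnW.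
rewrite big_nat_cond big_pred0 ?add0r.
  by rewrite big_mkcond/=; apply: ler_sum => i _; case: ifP.
move=> i; apply/negP => /andP[/andP[_ iN] /BN]; by rewrite leqNgt iN.
Qed.

(** Analysis by [G] into [l_2], followed by synthesis by [v]; the tails are small
    along all finite sets since those of the square sums are. *)
Lemma operator_of_upper2 (Y X : normedModType K) (B : Y -> X -> K) (v : nat -> X)
    (G : nat -> Y) (S S' : R) : pairing B -> rcomplete X ->
  0 <= S -> 0 <= S' -> upper2 v S -> upper2 G S' ->
  exists E : X -> X, [/\ forall z, usum (fun i => B (G i) z *: v i) (E z),
    forall z w, rn (E z - E w) <= 2 * S' * S * rn (z - w) & E 0 = 0].
Proof.
move=> pB cX S0 S'0 vS GS.
have dual z n : \sum_(i < n) modulus (B (G i) z) ^+ 2 <= (2 * S' * rn z) ^+ 2.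
  exact: (dual_upper2 (pairing_flip pB) GS S'0 z n).
have sub z n (P : pred nat) : rn (\sum_(i < n | P i) B (G i) z *: v i) <=
    S * Num.sqrt (\sum_(i < n | P i) modulus (B (G i) z) ^+ 2).
  rewrite big_mkcond [X in Num.sqrt X]big_mkcond /=.
  have := vS n (fun i => if P i then B (G i) z else 0).
  rewrite (eq_bigr (fun i : 'I_n => if P i then B (G i) z *: v i else 0)); last first.
    by move=> i _; case: ifP => //; rewrite scale0r.
  rewrite [X in _ -> _ <= _ * Num.sqrt X](eq_bigr (fun i : 'I_n => modulus (if P i then B (G i) z else 0) ^+ 2))//.
  by move=> i _; case: ifP => // _; rewrite modulus0 expr0n.
have ex z : exists x, usum (fun i => B (G i) z *: v i) x.
  apply: usum_exists => // e e0.
  have S1 : 0 < 1 + S by rewrite ltr_wpDr.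
  have [||N hN] := @tail_small (fun i => modulus (B (G i) z) ^+ 2) _ _ (dual z) ((e / (1 + S)) ^+ 2).
  - by move=> i; exact: sqr_ge0.
  - by rewrite exprn_gt0// divr_gt0.
  exists N => n P /hN h; apply: le_trans (sub _ _ _) _.
  have e1 : 0 <= e / (1 + S) by rewrite divr_ge0 ?ltW.
  have := ler_wsqrtr (h n); rewrite sqrtr_sqr (ger0_norm e1) => /(ler_wpM2l S0)/le_trans; apply.
  rewrite mulrA ler_pdivrMr// mulrC ler_pM2l//; lra.
have [E hE] := choice ex; exists E; split=> // [z w|]; last first.
  apply: rcvg_unique (usum_rcvg (hE 0)) _ => e e0; exists 0%N => n _.
  rewrite big1 ?subrr ?rn0 ?ltW// => i _.
  by rewrite (pair0r pB) scale0r.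
have zw n : rn (\sum_(i < n) B (G i) (z - w) *: v i) <= 2 * S' * S * rn (z - w).
  apply: le_trans (sub _ _ predT) _.
  have := ler_wsqrtr (dual (z - w) n); rewrite sqrtr_sqr ger0_norm ?mulr_ge0 ?rn_ge0// => /(ler_wpM2l S0)/le_trans; apply.
  by rewrite mulrCA -!mulrA.
apply: rcvg_bound zw; rewrite /=.
under [X in rcvg X]eq_fun.
  move=> n; under eq_bigr do rewrite (pairBr pB) scalerBl.
  rewrite sumrB; over.
exact: rcvgD (usum_rcvg (hE z)) (rcvgN (usum_rcvg (hE w))).
Qed.

Lemma pair_adjoint (Y X : normedModType K) (B : Y -> X -> K) (F G : Y) (x z : X)
    (u : nat -> X) (w : nat -> Y) : pairing B -> rcvg u x -> rcvg w G ->
  (forall n, B F (u n) = B (w n) z) -> B F x = B G z.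
Proof.
move=> pB ux wG uw; apply/eqP; rewrite -subr_eq0; apply/eqP/modulus_eq0/le_anti.
rewrite modulus_ge0 andbT; apply/ler_addgt0Pr => e e0; rewrite add0r.
have e2 : 0 < e / 2 by rewrite divr_gt0.
have [N1 h1] := pair_cont pB F ux e2.
have [N2 h2] := pair_cont (pairing_flip pB) z wG e2.
have := h1 (maxn N1 N2) (leq_maxl _ _); have := h2 (maxn N1 N2) (leq_maxr _ _).
rewrite -uw => h3 h4.
have -> : B F x - B G z = (B F (u (maxn N1 N2)) - B G z) +
    (- 1) * (B F (u (maxn N1 N2)) - B F x) by ring.
apply: le_trans (modulusD _ _) _; rewrite modulusM.
have -> : modulus (-1 : K) = 1.
  by apply: (@scalar_of_inj _ k); rewrite -norm_modulus normrN normr1; case: (k).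
rewrite mul1r; lra.
Qed.

(** The adjoint is given by the same series with [v] and [G] exchanged, so
    that it acts on the space [Y] itself. *)
Lemma op_adjoint (Y X : normedModType K) (B : Y -> X -> K) (v : nat -> X)
    (G : nat -> Y) (S S' : R) : pairing B -> rcomplete X -> rcomplete Y ->
  0 <= S -> 0 <= S' -> upper2 v S -> upper2 G S' ->
  exists (E : X -> X) (E' : Y -> Y),
  [/\ forall z, usum (fun i => B (G i) z *: v i) (E z),
      forall z w, rn (E z - E w) <= 2 * S' * S * rn (z - w),
      forall F H, rn (E' F - E' H) <= 2 * S' * S * rn (F - H),
      E' 0 = 0 &
      forall F z, B (E' F) z = B F (E z) ].
Proof.
move=> pB cX cY S0 S'0 vS GS.
have [E [hE lE _]] := operator_of_upper2 pB cX S0 S'0 vS GS.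
have [E' [hE' lE' E'0]] := operator_of_upper2 (pairing_flip pB) cY S'0 S0 GS vS.
exists E, E'; split=> //.
  by move=> F H; rewrite (_ : 2 * S' * S = 2 * S * S')//; ring.
move=> F z; apply/esym.
apply: (pair_adjoint pB (usum_rcvg (hE z)) (usum_rcvg (hE' F))) => n.
rewrite (pair_sumr pB) (pair_sumr (pairing_flip pB)); apply: eq_bigr => i _.
by rewrite (pairZr pB) (pairZl pB) mulrC.
Qed.

(** The approximate coefficient functionals [F0 i] reproduce [z + E z] from [z].
    With [F' i + E' (F' i) = F0 i] and [z + E z = g], the adjunction gives
    [B (F' i) g = B (F0 i) z], so the [F' i] reproduce [g]. *)
Theorem frame_of_perturbation (Y X : normedModType K) (B : Y -> X -> K)
    (v : nat -> X) (F0 : nat -> Y) (E : X -> X) (E' : Y -> Y) (theta r s : R) :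
  pairing B -> rcomplete X -> rcomplete Y -> 0 <= theta -> theta < 1 ->
  (forall z w, rn (E z - E w) <= theta * rn (z - w)) ->
  (forall F H, rn (E' F - E' H) <= theta * rn (F - H)) -> E' 0 = 0 ->
  (forall F z, B (E' F) z = B F (E z)) ->
  (forall z, usum (fun i => B (F0 i) z *: v i) (z + E z)) ->
  0 < r -> (forall i, r <= rn (F0 i) <= s) ->
  exists F' : nat -> Y, seminormalized F' /\
    forall g, usum (fun i => B (F' i) g *: v i) g.
Proof.
move=> pB cX cY th0 th1 lE lE' E'0 adj hF0 r0 rs.
have /choice[F' hF'] : forall i, exists F, F + E' F = F0 i.
  by move=> i; exact: (contraction_solve (F0 i) cY th0 th1 lE').
exists F'; split.
  have nE' F : rn (E' F) <= theta * rn F by have := lE' F 0; rewrite E'0 !subr0.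
  exists (scalar_of (r / 2) 0), (scalar_of (s / (1 - theta)) 0); split.
    have : scalar_of 0 0 <= scalar_of (r / 2) 0 :> K by rewrite scalar_of_le divr_ge0 ?ltW.
    have -> : scalar_of 0 0 = 0 :> K by case: (k).
    rewrite lt_neqAle => ->; rewrite andbT eq_sym; apply/eqP => h.
    have : modulus (scalar_of (r / 2) 0 : K) = 0 by rewrite h modulus0.
    by rewrite modulus_scalar_of gtr0_norm ?divr_gt0// => h'; have := divr_gt0 r0 (@ltr0Sn R 1); rewrite h' ltxx.
  move=> i; rewrite normE !scalar_of_le; have /andP[h1 h2] := rs i.
  have := nE' (F' i); have := rnD (F' i) (E' (F' i)); rewrite hF' => h3 h4.
  have h5 : theta * rn (F' i) <= rn (F' i) by rewrite ler_piMl ?rn_ge0// ltW.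
  apply/andP; split; first by lra.
  rewrite ler_pdivlMr ?subr_gt0//.
  have : F' i = F0 i - E' (F' i) by rewrite -hF' addrK.
  by move=> h6; have := rnB (F0 i) (E' (F' i)); rewrite -h6; lra.
move=> g; have [z zg] := contraction_solve g cX th0 th1 lE.
rewrite -[X in usum _ X]zg; apply: usum_ext (hF0 z) => i.
by rewrite -zg (pairDr pB) -adj -(pairDl pB) hF'.
Qed.

End pairing.

(** * Frames from blocks *)

Section finite_sums.
Variable R : realType.

(** The Cauchy-Schwarz inequality, from [2 x y <= (Y / X) x^2 + (X / Y) y^2]. *)
Lemma sum_mul_le (n : nat) (x y : nat -> R) (X Y : R) : 0 <= X -> 0 <= Y ->
  \sum_(i < n) x i ^+ 2 <= X ^+ 2 -> \sum_(i < n) y i ^+ 2 <= Y ^+ 2 ->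
  \sum_(i < n) x i * y i <= X * Y.
Proof.
have zero (u w : nat -> R) (U : R) : U = 0 -> \sum_(i < n) u i ^+ 2 <= U ^+ 2 ->
    \sum_(i < n) u i * w i = 0.
  move=> ->; rewrite expr0n /= => h; apply: big1 => i _.
  have : \sum_(i < n) u i ^+ 2 = 0.
    by apply/le_anti; rewrite h/= sumr_ge0// => j _; exact: sqr_ge0.
  move/eqP; rewrite psumr_eq0; last by move=> j _; exact: sqr_ge0.
  by move=> /allP/(_ i (mem_index_enum _)) /=; rewrite sqrf_eq0 => /eqP ->; rewrite mul0r.
move=> X0 Y0 hX hY.
have [XE|Xn0] := eqVneq X 0; first by rewrite (zero _ _ _ XE hX) mulr_ge0.
have [YE|Yn0] := eqVneq Y 0.
  by under eq_bigr do rewrite mulrC; rewrite (zero _ _ _ YE hY) mulr_ge0.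
have Xp : 0 < X by rewrite lt_neqAle eq_sym Xn0.
have Yp : 0 < Y by rewrite lt_neqAle eq_sym Yn0.
have amgm i : x i * y i <= (Y / X * x i ^+ 2 + X / Y * y i ^+ 2) / 2.
  have : 0 <= (Y * x i - X * y i) ^+ 2 / (X * Y) by rewrite divr_ge0 ?sqr_ge0// mulr_ge0.
  have -> : (Y * x i - X * y i) ^+ 2 / (X * Y) =
     Y / X * x i ^+ 2 + X / Y * y i ^+ 2 - 2 * (x i * y i).
    by field; rewrite Xn0 Yn0.
  lra.
apply: le_trans (ler_sum _ (fun (i : 'I_n) _ => amgm i)) _.
rewrite -mulr_suml big_split/= -!mulr_sumr.
have h1 : Y / X * \sum_(i < n) x i ^+ 2 <= Y / X * X ^+ 2 by rewrite ler_wpM2l ?divr_ge0.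
have h2 : X / Y * \sum_(i < n) y i ^+ 2 <= X / Y * Y ^+ 2 by rewrite ler_wpM2l ?divr_ge0.
have e1 : Y / X * X ^+ 2 = X * Y by field.
have e2 : X / Y * Y ^+ 2 = X * Y by field.
lra.
Qed.

(** For [p >= 2] the norm of [l_p] is at most the norm of [l_2]. *)
Lemma sum_pow_le (p : R) (n : nat) (x : nat -> R) (A : R) : 2 <= p -> 0 <= A ->
  (forall i, 0 <= x i) -> \sum_(i < n) x i ^+ 2 <= A ^+ 2 ->
  \sum_(i < n) x i `^ p <= A `^ p.
Proof.
move=> p2 A0 x0 h.
have pe (y : R) : 0 <= y -> y `^ p = y ^+ 2 * y `^ (p - 2).
  move=> y0; rewrite -powR_mulrn// -powRD; first by congr powR; ring.
  by apply/implyP; rewrite (_ : 2%:R + (p - 2) = p); [move/eqP => p0; exfalso; move: p2; rewrite p0; lra|ring].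
have xA i : (i < n)%N -> x i <= A.
  move=> iN; rewrite -(ler_sqr (x0 _) A0); apply: le_trans h.
  rewrite (bigD1 (Ordinal iN))//= lerDl sumr_ge0// => j _; exact: sqr_ge0.
rewrite (pe A A0); apply: (@le_trans _ _ (\sum_(i < n) x i ^+ 2 * A `^ (p - 2))).
  apply: ler_sum => i _; rewrite pe// ler_wpM2l ?sqr_ge0//.
  by apply: ge0_ler_powR; rewrite ?nnegrE ?subr_ge0// xA.
by rewrite -mulr_suml ler_wpM2r ?powR_ge0.
Qed.

Lemma sum_blocks (V : nmodType) (b : nat -> nat) (n J : nat) (P : pred nat)
    (f : nat -> V) : (forall i, (i < n)%N -> P i -> (b i < J)%N) ->
  \sum_(i < n | P i) f i = \sum_(j < J) \sum_(i < n | P i && (b i == j)) f i.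
Proof.
move=> bJ; under [RHS]eq_bigr do rewrite big_mkcond.
rewrite exchange_big/= [LHS]big_mkcond/=; apply: eq_bigr => i _.
case: ifPn => [Pi|_]; last by rewrite big1.
rewrite -big_mkcond/= (big_pred1 (Ordinal (bJ i (ltn_ord i) Pi)))//.
Qed.

End finite_sums.

Section frame_from_blocks.
Variables (R : realType) (k : scalar_kind).
Local Notation K := (scalar R k).
Local Notation sc a := (scalar_of a 0 : K).

Lemma sc0 : sc 0 = 0. Proof. by case: (k). Qed.
Lemma sc1 : sc 1 = 1. Proof. by case: (k). Qed.

Lemma sc_sum (I : Type) (s : seq I) (P : pred I) (f : I -> R) :
  sc (\sum_(i <- s | P i) f i) = \sum_(i <- s | P i) sc (f i).
Proof. by elim/big_rec2: _ => [|i y z _ <-]; rewrite ?sc0// scalar_ofD. Qed.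

Lemma upper2_abs (X : normedModType K) (v : nat -> X) (s : nat -> R) (S : R) :
  0 <= S -> (forall i, rn (v i) <= s i) ->
  (forall n, \sum_(i < n) s i ^+ 2 <= S ^+ 2) -> upper2 v S.
Proof.
move=> S0 vs sS n a; apply: le_trans (rn_sum _ _ _) _.
apply: (@le_trans _ _ (\sum_(i < n) s i * modulus (a i))).
  by apply: ler_sum => i _; rewrite rnZ mulrC ler_wpM2r ?modulus_ge0.
apply: (@sum_mul_le _ n s (fun i => modulus (a i))); rewrite ?sqrtr_ge0//.
by rewrite sqr_sqrtr// sumr_ge0// => i _; exact: sqr_ge0.
Qed.

Variables (Y X : normedModType K) (B : Y -> X -> K).
Hypotheses (pB : pairing B) (cX : rcomplete X) (cY : rcomplete Y).
Variables (p delta : R) (e v r : nat -> X) (es h : nat -> Y).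
Variables (b N M : nat -> nat) (c kappa : nat -> R).
Hypotheses (p2 : 2 < p) (deltaE : delta = 100^-1).
Hypotheses (e1 : forall j, rn (e j) <= 1) (es1 : forall j, rn (es j) <= 1).
Hypothesis multipliers : forall z (eps : R), 0 < eps -> exists J, forall n (t : nat -> R),
  (forall j, 0 <= t j <= 1) -> (forall j, (j < J)%N -> t j = 1) -> (J <= n)%N ->
  rn (\sum_(j < n) (sc (t j) * B (es j) z) *: e j - z) <= eps.
Hypotheses (b_le : forall i, (b i <= i)%N) (bM : forall i, (i < M (b i))%N).
Hypothesis block_card : forall j, \sum_(i < M j | b i == j) 1%N = N j.
Hypothesis N_gt0 : forall j, (0 < N j)%N.
Hypothesis vE : forall i, v i = sc (c (b i)) *: e (b i) + r i.
Hypothesis r_upper : forall n (a : nat -> K) (A : R), 0 <= A ->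
  \sum_(i < n) modulus (a i) `^ p <= A `^ p -> rn (\sum_(i < n) a i *: r i) <= delta * A.
Hypotheses (h_upper : upper2 h 1) (h_ge1 : forall i, 1 <= rn (h i)).
Hypothesis c_gt0 : forall j, 0 < c j.
Hypothesis kappa1 : forall j, (N j)%:R `^ p^-1 / ((N j)%:R * c j) <= kappa j.
Hypothesis kappa2 : forall j, (N j)%:R * c j ^+ 2 <= kappa j.
Hypothesis kappa_sum : forall n, \sum_(j < n) kappa j <= delta.

(** The weight that turns the [N j] copies of [c j *: e j] in the block [j] into
    an average of [N j] copies of [e j]. *)
Let beta j : R := ((N j)%:R * c j)^-1.

Let delta_gt0 : 0 < delta. Proof. by rewrite deltaE invr_gt0. Qed.
Let delta_ge0 : 0 <= delta. Proof. exact: ltW. Qed.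
Let p_gt0 : 0 < p. Proof. by apply: lt_trans p2. Qed.
Let p_neq0 : p != 0. Proof. by rewrite gt_eqF. Qed.
Let Nr_gt0 j : 0 < (N j)%:R :> R. Proof. by rewrite ltr0n. Qed.
Let beta_gt0 j : 0 < beta j. Proof. by rewrite invr_gt0 mulr_gt0. Qed.
Let kappa_gt0 j : 0 < kappa j.
Proof. by apply: lt_le_trans (kappa2 j); rewrite mulr_gt0// exprn_gt0. Qed.

Let kappa_le_delta j : kappa j <= delta.
Proof.
apply: le_trans (kappa_sum j.+1); rewrite big_ord_recr/= lerDr.
by rewrite sumr_ge0// => i _; rewrite ltW.
Qed.

Let beta_le_kappa j : beta j <= kappa j.
Proof.
apply: le_trans (kappa1 j); rewrite mulrC ler_peMr ?(ltW (beta_gt0 j))//.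
by rewrite -[leLHS](powRr0 (N j)%:R) ler_powR ?invr_ge0 ?(ltW p_gt0)// ler1n.
Qed.

(** Restricted to any set of indices, a block has at most [N j] elements. *)
Let count_le n j (P : pred nat) : (\sum_(i < n | P i && (b i == j)) 1 <= N j)%N.
Proof.
rewrite -block_card; have [nM|Mn] := leqP n (M j).
  rewrite (big_ord_widen_cond _ (fun i => P i && (b i == j)) (fun _ => 1%N) nM).
  rewrite big_mkcond [leqRHS]big_mkcond/=; apply: leq_sum => i _.
  by case: ifPn => // /andP[/andP[_ ->]].
rewrite (big_ord_widen_cond _ (fun i => b i == j) (fun _ => 1%N) (ltnW Mn)).
rewrite big_mkcond [leqRHS]big_mkcond/=; apply: leq_sum => i _.
by case: ifPn => // /andP[_ /eqP bj]; rewrite bj eqxx -bj bM.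
Qed.

Let sum_block_const n (f : nat -> R) : (forall j, 0 <= f j) ->
  \sum_(i < n) f (b i) <= \sum_(j < n) (N j)%:R * f j.
Proof.
move=> f0.
have -> : \sum_(i < n) f (b i) = \sum_(j < n) \sum_(i < n | b i == j) f (b i).
  apply: (@sum_blocks _ b n n predT (fun i => f (b i))) => i iN _.
  exact: leq_ltn_trans (b_le i) iN.
apply: ler_sum => j _; rewrite (eq_bigr (fun=> 1%:R * f j)); last first.
  by move=> i /= /eqP ->; rewrite mul1r.
rewrite -mulr_suml ler_wpM2r// -natr_sum ler_nat.
exact: (count_le n j predT).
Qed.

(** The main parts are estimated absolutely: a block contributes
    [N j * c j ^+ 2] to the square sum.  The errors satisfy a [p]-estimate,
    which is stronger than a [2]-estimate. *)
Let v_upper : upper2 v (Num.sqrt delta + delta).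
Proof.
move=> n a; set A := Num.sqrt (\sum_(i < n) modulus (a i) ^+ 2); have A0 : 0 <= A by exact: sqrtr_ge0.
have AE : A ^+ 2 = \sum_(i < n) modulus (a i) ^+ 2.
  by rewrite sqr_sqrtr// sumr_ge0// => i _; exact: sqr_ge0.
under eq_bigr do rewrite vE scalerDr.
rewrite big_split/= mulrDl; apply: le_trans (rnD _ _) (lerD _ _).
  apply: (@upper2_abs _ (fun i => sc (c (b i)) *: e (b i)) (fun i => c (b i))).
  - exact: sqrtr_ge0.
  - move=> i; rewrite rnZ modulus_scalar_of gtr0_norm//.
    by rewrite ler_piMr// ltW.
  - move=> m; rewrite sqr_sqrtr//; apply: le_trans (kappa_sum m).
    apply: le_trans (@sum_block_const m (fun j => c j ^+ 2) _) _.
      by move=> j; exact: sqr_ge0.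
    exact: ler_sum.
apply: r_upper => //; apply: (@sum_pow_le _ p n (fun i => modulus (a i))) => //.
- exact: ltW.
- by move=> i; exact: modulus_ge0.
- by rewrite AE.
Qed.

(** All the errors of the block [j] occur with the same coefficient, since the
    functionals of that block agree up to the [h i]. *)
Let w j := sc (beta j) *: \sum_(i < M j | b i == j) r i.

Let powV (j : nat) : ((N j)%:R `^ p^-1) `^ p = (N j)%:R :> R.
Proof. by rewrite -powRrM mulVf// powRr1. Qed.

Let w_le j : rn (w j) <= delta * kappa j.
Proof.
rewrite /w scaler_sumr big_mkcond/=.
rewrite (eq_bigr (fun i : 'I_(M j) => (if b i == j then sc (beta j) else 0) *: r i)); last first.
  by move=> i _; case: ifP; rewrite ?scale0r.
apply: (@le_trans _ _ (delta * ((N j)%:R `^ p^-1 / ((N j)%:R * c j)))); last first.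
  by rewrite ler_wpM2l.
apply: (@r_upper (M j) (fun i => if b i == j then sc (beta j) else 0)).
  by rewrite divr_ge0 ?powR_ge0// mulr_ge0 ?ltW.
rewrite (eq_bigr (fun i : 'I_(M j) => if b i == j then beta j `^ p else 0)); last first.
  move=> i _; case: ifP => _; last by rewrite modulus0 powR0.
  by rewrite modulus_scalar_of gtr0_norm.
rewrite -big_mkcond/= (eq_bigr (fun=> 1%:R * beta j `^ p)); last by move=> i _; rewrite mul1r.
rewrite -mulr_suml -natr_sum block_card powRM ?powR_ge0 ?(ltW (beta_gt0 j))//.
by rewrite powV.
Qed.

(** The norms of the [w j] are summable.  To produce the adjoint as well, the
    size [kappa j] is distributed evenly over [w j] and [es j] as a square
    [s j ^+ 2], which makes both sequences have upper [2]-estimates. *)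
Lemma block_operator : exists (E : X -> X) (E' : Y -> Y),
  [/\ forall z, usum (fun j => B (es j) z *: w j) (E z),
      forall z y, rn (E z - E y) <= 2 * delta ^+ 2 * rn (z - y),
      forall F G, rn (E' F - E' G) <= 2 * delta ^+ 2 * rn (F - G),
      E' 0 = 0 &
      forall F z, B (E' F) z = B F (E z) ].
Proof.
pose s j := Num.sqrt (kappa j).
have s0 j : 0 < s j by rewrite sqrtr_gt0.
have s2 j : s j ^+ 2 = kappa j by rewrite sqr_sqrtr// ltW.
have su n : \sum_(i < n) s i ^+ 2 <= Num.sqrt delta ^+ 2.
  by under eq_bigr do rewrite s2; rewrite sqr_sqrtr.
have u1 : upper2 (fun j => sc (s j)^-1 *: w j) (delta * Num.sqrt delta).
  apply: (@upper2_abs _ _ (fun j => delta * s j)).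
  - by rewrite mulr_ge0// sqrtr_ge0.
  - move=> j; rewrite rnZ modulus_scalar_of gtr0_norm ?invr_gt0//.
    rewrite mulrC ler_pdivrMr//; apply: le_trans (w_le j) _.
    by rewrite -mulrA -expr2 s2.
  - by move=> n; under eq_bigr do rewrite exprMn; rewrite -mulr_sumr exprMn ler_wpM2l// sqr_ge0.
have u2 : upper2 (fun j => sc (s j) *: es j) (Num.sqrt delta).
  apply: (@upper2_abs _ _ s) => //.
  by move=> j; rewrite rnZ modulus_scalar_of gtr0_norm// ler_piMr// ltW.
have := op_adjoint pB cX cY _ _ u1 u2.
rewrite mulr_ge0 ?sqrtr_ge0// => /(_ isT isT)[E [E' [hE lE lE' E'0 adj]]].
have cE : 2 * Num.sqrt delta * (delta * Num.sqrt delta) = 2 * delta ^+ 2.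
  by rewrite -[X in _ * X ^+ 2](sqr_sqrtr delta_ge0) -[X in _ * (X * _)](sqr_sqrtr delta_ge0); ring.
rewrite cE in lE lE'; exists E, E'; split=> // z.
apply: usum_ext (hE z) => j; rewrite (pairZl pB) scalerA mulrAC -scalar_ofM.
by rewrite divff ?gt_eqF// sc1 mul1r.
Qed.

(** A sum over a finite set of indices gives the [j]-th term with the weight
    [t j], the proportion of the block [j] contained in the set; this is [1]
    for the blocks that lie in a long initial segment. *)
Let main_parts_reproduce z : usum (fun i => (sc (N (b i))%:R^-1 * B (es (b i)) z) *: e (b i)) z.
Proof.
move=> eps eps0; have [J hJ] := multipliers z eps0.
exists (maxn J (\max_(j < J) M j)) => n P hP; rewrite geq_max => /andP[Jn Mn].
pose t j : R := (\sum_(i < n | P i && (b i == j)) 1)%N%:R / (N j)%:R.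
have -> : \sum_(i < n | P i) (sc (N (b i))%:R^-1 * B (es (b i)) z) *: e (b i) =
    \sum_(j < n) (sc (t j) * B (es j) z) *: e j.
  rewrite (@sum_blocks _ b n n P (fun i => (sc (N (b i))%:R^-1 * B (es (b i)) z) *: e (b i))); last first.
    by move=> i iN _; exact: leq_ltn_trans (b_le i) iN.
  apply: eq_bigr => j _.
  rewrite (eq_bigr (fun=> (sc (1%:R * (N j)%:R^-1) * B (es j) z) *: e j)); last first.
    by move=> i /andP[_ /eqP ->]; rewrite mul1r.
  by rewrite -scaler_suml -mulr_suml -sc_sum -mulr_suml -natr_sum.
apply: hJ => // j.
  rewrite /t divr_ge0//= ler_pdivrMr// mul1r ler_nat; exact: count_le.
move=> jJ; have jM : (M j <= \max_(j < J) M j)%N.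
  exact: (@leq_bigmax _ (fun j : 'I_J => M j) (Ordinal jJ)).
rewrite /t -[X in _ / X%:R](block_card j).
rewrite (big_ord_widen_cond _ (fun i => b i == j) (fun _ => 1%N) (leq_trans jM Mn)).
have -> : (\sum_(i < n | (b i == j) && (i < M j)) 1 = \sum_(i < n | P i && (b i == j)) 1)%N.
  apply: eq_bigl => i; case: (eqVneq (b i) j) => [bj|]; rewrite ?andbF//= andbT.
  have iM : (i < M j)%N by rewrite -bj bM.
  by rewrite iM hP// (leq_trans iM)// (leq_trans jM)// leq_maxr.
rewrite divff// pnatr_eq0.
have : (N j <= \sum_(i < n | P i && (b i == j)) 1)%N.
  rewrite -(block_card j) (big_ord_widen_cond _ (fun i => b i == j) (fun _ => 1%N) (leq_trans jM Mn)).
  rewrite big_mkcond [leqRHS]big_mkcond/=; apply: leq_sum => i _.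
  case: ifPn => // /andP[/eqP bj iM]; rewrite bj eqxx andbT hP//.
  by rewrite (leq_trans iM)// (leq_trans jM)// leq_maxr.
by move=> h0; rewrite -lt0n (leq_trans (N_gt0 j)).
Qed.

(** The [p]-estimate makes the sum over the indices unconditional; its value is
    found along unions of blocks. *)
Let errors_sum z (x : X) : usum (fun j => B (es j) z *: w j) x ->
  usum (fun i => (sc (beta (b i)) * B (es (b i)) z) *: r i) x.
Proof.
move=> hx; pose a i := sc (beta (b i)) * B (es (b i)) z.
have a_le i : modulus (a i) `^ p <= beta (b i) `^ p * (2 * rn z) `^ p.
  have b0 := ltW (beta_gt0 (b i)).
  rewrite -powRM ?mulr_ge0 ?rn_ge0//.
  apply: ge0_ler_powR; rewrite ?nnegrE ?modulus_ge0 ?mulr_ge0 ?rn_ge0 ?(ltW p_gt0)//.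
  rewrite modulusM modulus_scalar_of gtr0_norm// ler_wpM2l//.
  by apply: le_trans (pair_le pB _ _) _; rewrite ler_wpM2r ?rn_ge0// -[leRHS]mulr1 ler_wpM2l.
have a_sum n : \sum_(i < n) modulus (a i) `^ p <= delta * (2 * rn z) `^ p.
  apply: le_trans (ler_sum _ (fun (i : 'I_n) _ => a_le i)) _.
  rewrite -mulr_suml ler_wpM2r ?powR_ge0//; apply: le_trans (kappa_sum n).
  apply: le_trans (@sum_block_const n (fun j => beta j `^ p) _) _.
    by move=> j; exact: powR_ge0.
  have b0 := beta_gt0; apply: ler_sum => j _; rewrite -(powV j) -powRM ?powR_ge0 ?(ltW (b0 j))//.
  apply: (@le_trans _ _ (kappa j `^ p)).
    by apply: ge0_ler_powR; rewrite ?nnegrE ?mulr_ge0 ?powR_ge0 ?(ltW p_gt0) ?(ltW (b0 j)) ?(ltW (kappa_gt0 j)).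
  have k1 : kappa j <= 1 by apply: le_trans (kappa_le_delta j) _; rewrite deltaE; lra.
  by rewrite ge1r_powR ?kappa_gt0//; move: p2; lra.
have tail (eps : R) : 0 < eps -> exists N0, forall n (P : pred nat),
    (forall i, P i -> (N0 <= i)%N) -> rn (\sum_(i < n | P i) a i *: r i) <= eps.
  move=> eps0; have ep0 : 0 < (eps / delta) `^ p by rewrite powR_gt0// divr_gt0.
  have [|N0 hN] := @tail_small R (fun i => modulus (a i) `^ p) _ _ a_sum _ ep0.
    by move=> i; exact: powR_ge0.
  exists N0 => n P P0; have hP := hN n P P0; rewrite big_mkcond/=.
  rewrite (eq_bigr (fun i : 'I_n => (if P i then a i else 0) *: r i)); last first.
    by move=> i _; case: ifP; rewrite ?scale0r.
  have -> : eps = delta * (eps / delta) by rewrite mulrC divfK// gt_eqF.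
  apply: (@r_upper n (fun i => if P i then a i else 0)); first by rewrite divr_ge0 ?ltW.
  apply: le_trans hP; rewrite [leRHS]big_mkcond/=; apply: ler_sum => i _.
  by case: ifP => // _; rewrite modulus0 powR0.
have [y hy] := @usum_exists _ _ _ (fun i => a i *: r i) cX tail; suff -> : x = y by [].
apply: rcvg_unique (usum_rcvg hx) _ => eps eps0.
have [N0 hN0] := hy _ eps0; exists N0 => J NJ.
pose n := maxn N0 (\max_(j < J) M j).
have := hN0 n [pred i | (b i < J)%N]; rewrite leq_maxl.
have hb i : (i < N0)%N -> [pred i | (b i < J)%N] i.
  by move=> iN /=; apply: leq_ltn_trans (b_le i) _; exact: leq_trans NJ.
move=> /(_ hb isT); congr (rn (_ - _) <= _).
have -> := @sum_blocks _ b n J [pred i | (b i < J)%N] (fun i => a i *: r i) (fun i _ iJ => iJ).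
apply: eq_bigr => j _; rewrite /a.
have jM : (M j <= n)%N.
  by rewrite leq_max; apply/orP; right; exact: (@leq_bigmax _ (fun j : 'I_J => M j) j).
rewrite /w scalerA scaler_sumr (big_ord_widen_cond _ (fun i => b i == j) (fun i => (B (es j) z * sc (beta j)) *: r i) jM).
rewrite (eq_bigl (fun i : 'I_n => (b i == j) && (i < M j)%N)); last first.
  move=> i /=; case: (eqVneq (b i) j) => [bj|]; rewrite ?andbF// andbT.
  by have := bM i; rewrite bj => ->; rewrite ltn_ord.
by apply: eq_bigr => i /andP[/eqP -> _]; rewrite mulrC.
Qed.

(** The approximate functionals are [beta (b i) *: es (b i) + h i].  Against the
    vectors [v i = c (b i) *: e (b i) + r i] the first summand gives the
    identity on the main parts and the operator of [block_operator] on the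
    errors; the second gives an operator that is small by [v_upper].  Their
    norms stay between constants because [h i] has norm [1] and the first
    summand is small. *)
Theorem frame_from_blocks : exists F' : nat -> Y, seminormalized F' /\
  forall g, usum (fun i => B (F' i) g *: v i) g.
Proof.
have [E1 [E1' [hE1 lE1 lE1' E10 adj1]]] := block_operator.
have S0 : 0 <= Num.sqrt delta + delta by rewrite addr_ge0 ?sqrtr_ge0.
have [E2 [E2' [hE2 lE2 lE2' E20 adj2]]] := op_adjoint pB cX cY S0 ler01 v_upper h_upper.
(* With [delta = 1/100] the perturbation has Lipschitz constant at most
   [2 delta^2 + 2 (sqrt delta + delta) <= 1/2]. *)
have sd : Num.sqrt delta = 10^-1.
  by rewrite deltaE (_ : 100^-1 = 10^-1 ^+ 2) ?sqrtr_sqr ?gtr0_norm ?invr_gt0//; field.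
have lip (Z : normedModType K) (A C : Z -> Z) :
    (forall z y, rn (A z - A y) <= 2 * delta ^+ 2 * rn (z - y)) ->
    (forall z y, rn (C z - C y) <= 2 * 1 * (Num.sqrt delta + delta) * rn (z - y)) ->
    forall z y, rn ((A z + C z) - (A y + C y)) <= 2^-1 * rn (z - y).
  move=> lA lC z y; rewrite opprD addrACA; apply: le_trans (rnD _ _) _.
  have := lA z y; have := lC z y; rewrite sd deltaE; have := rn_ge0 (z - y); lra.
pose F0 i := sc (beta (b i)) *: es (b i) + h i.
have hup i : rn (h i) <= 1.
  have := h_upper i.+1 (fun j => if j == i then 1 else 0).
  rewrite !big_ord_recr/= [X in rn (X + _)]big1; last by move=> j _; rewrite ltn_eqF// scale0r.
  rewrite [X in Num.sqrt (X + _)]big1; last by move=> j _; rewrite ltn_eqF// modulus0 expr0n.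
  by rewrite eqxx scale1r !add0r mul1r -sc1 modulus_scalar_of sqrtr_sqr !normr1.
apply: (@frame_of_perturbation _ _ Y X B v F0 (fun z => E1 z + E2 z) (fun F => E1' F + E2' F) 2^-1 2^-1 2) => //.
- by rewrite invf_lt1 ?ltr1n.
- exact: lip.
- exact: lip.
- by rewrite E10 E20 addr0.
- by move=> F z; rewrite (pairDl pB) (pairDr pB) adj1 adj2.
- move=> z; have := usumD (usumD (main_parts_reproduce z) (errors_sum (hE1 z))) (hE2 z).
  rewrite -addrA; apply: usum_ext => i.
  rewrite /F0 (pairDl pB) (pairZl pB) [RHS]scalerDl; congr (_ + _).
  rewrite [in RHS]vE scalerDr; congr (_ + _); rewrite scalerA mulrAC -scalar_ofM.
  by rewrite /beta invfM divfK// gt_eqF.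
- move=> i; have hb : rn (sc (beta (b i)) *: es (b i)) <= delta.
    rewrite rnZ modulus_scalar_of gtr0_norm//.
    apply: le_trans (le_trans (beta_le_kappa (b i)) (kappa_le_delta (b i))).
    by rewrite ler_piMr// ltW.
  have h1 := h_ge1 i; have h2 := hup i; have h3 := rnD (sc (beta (b i)) *: es (b i)) (h i).
  have h4 := rnB (F0 i) (sc (beta (b i)) *: es (b i)).
  rewrite {1}/F0 addrAC subrr add0r in h4; rewrite -/(F0 i) in h3.
  rewrite deltaE in hb; apply/andP; split; lra.
Qed.

End frame_from_blocks.

(** * Completeness, disjointness and duality in [L_p] *)

Section Lp_basics.
Context d (T : measurableType d) (R : realType) (k : scalar_kind).
Variables (mu : {measure set T -> \bar R}) (p : R) (p1 : (1 <= p%:E)%E).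
Local Notation K := (scalar R k).
Local Notation LF := (LpFun k mu p1).
Local Notation X := (Lp k mu p1).
Local Open Scope quotient_scope.

Lemma exponent_gt0 : 0 < p.
Proof. by move: p1; rewrite lee_fin; exact: lt_le_trans. Qed.

Let p0 := exponent_gt0.
Let pn0 : p != 0. Proof. by rewrite gt_eqF. Qed.

Lemma LpFun_measurable (f : LF) : scalar_measurable f.
Proof. by have /scalar_LfunP[] := LpFun_prop f. Qed.

Lemma measurable_modulus_pow (f : T -> K) : scalar_measurable f ->
  measurable_fun [set: T] (fun x => (modulus (f x) `^ p)%:E).
Proof.
move=> mf; apply/measurable_EFinP.
apply: (@measurableT_comp _ _ _ _ _ _ (@powR R ^~ p)) => //.
exact: measurable_modulus.
Qed.

Lemma rn_pi (f : LF) : rn (\pi_X f) = fine (scalar_Lnorm mu p%:E f).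
Proof.
rewrite /rn [X in modulus X]Lp_norm_pi modulus_scalar_of ger0_norm// fine_ge0//.
exact: scalar_Lnorm_ge0.
Qed.

Lemma rn_piE (f : LF) : (rn (\pi_X f))%:E = scalar_Lnorm mu p%:E f.
Proof. by rewrite rn_pi scalar_Lnorm_fine//; exact: LpFun_prop. Qed.

Lemma scalar_Lnorm_pow (f : T -> K) :
  (scalar_Lnorm mu p%:E f `^ p)%E = (\int[mu]_x (modulus (f x) `^ p)%:E)%E.
Proof.
rewrite /scalar_Lnorm poweR_Lnorm; last exact: pn0.
apply: eq_integral => x _ /=.
by rewrite ger0_norm// modulus_ge0.
Qed.

Lemma rn_pow (f : LF) :
  (rn (\pi_X f) `^ p)%:E = (\int[mu]_x (modulus (f x) `^ p)%:E)%E.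
Proof. by rewrite -scalar_Lnorm_pow -rn_piE. Qed.

Lemma scalar_Lnorm_le (f : T -> K) (M : R) : 0 <= M ->
  (\int[mu]_x (modulus (f x) `^ p)%:E <= (M `^ p)%:E)%E ->
  (scalar_Lnorm mu p%:E f <= M%:E)%E.
Proof.
move=> M0; rewrite -scalar_Lnorm_pow => h.
have := gt0_ler_poweR (r := p^-1).
rewrite invr_ge0 ltW// => /(_ isT (scalar_Lnorm mu p%:E f `^ p)%E (M `^ p)%:E).
rewrite !in_itv/= !leey !andbT poweR_ge0 lee_fin powR_ge0 => /(_ isT isT h).
rewrite -!poweRrM divff// poweRe1; last exact: scalar_Lnorm_ge0.
by rewrite -powRrM divff// powRr1.
Qed.

Lemma rn_le (f : LF) (M : R) : 0 <= M ->
  (\int[mu]_x (modulus (f x) `^ p)%:E <= (M `^ p)%:E)%E -> rn (\pi_X f) <= M.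
Proof. by move=> M0 h; rewrite -lee_fin rn_piE; exact: scalar_Lnorm_le. Qed.

Lemma LpFunP (f : T -> K) : scalar_measurable f ->
  (\int[mu]_x (modulus (f x) `^ p)%:E < +oo)%E -> f \in scalar_Lfun mu p1.
Proof.
move=> mf; rewrite -scalar_Lnorm_pow => h; apply/scalar_LfunP; split=> //.
exact: lty_poweRy h.
Qed.

Lemma pi_repr (u : X) : \pi_X (repr u) = u. Proof. exact: reprK. Qed.

Lemma LpFun_sumE (I : Type) (s : seq I) (P : pred I) (f : I -> LF) x :
  (\sum_(i <- s | P i) f i) x = \sum_(i <- s | P i) f i x.
Proof. by elim/big_rec2: _ => // i y z _ <-. Qed.

Lemma pi_sum (I : Type) (s : seq I) (P : pred I) (f : I -> LF) :
  \pi_X (\sum_(i <- s | P i) f i) = \sum_(i <- s | P i) \pi_X (f i).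
Proof. exact: raddf_sum. Qed.

Lemma LpFunBE (f g : LF) x : (f - g) x = f x - g x. Proof. by []. Qed.

Lemma pi_B (f g : LF) : \pi_X (f - g) = \pi_X f - \pi_X g.
Proof. exact: raddfB. Qed.

Lemma scalar_ReB (z w : K) : scalar_Re (z - w) = scalar_Re z - scalar_Re w.
Proof. by case: (k) z w => //= -[? ?] [? ?]. Qed.

Lemma scalar_ImB (z w : K) : scalar_Im (z - w) = scalar_Im z - scalar_Im w.
Proof. by case: (k) z w => //= [? ?|[? ?] [? ?]] //=; rewrite subrr. Qed.

Lemma scalar_Re0 : scalar_Re (0 : K) = 0. Proof. by case: (k). Qed.
Lemma scalar_Im0 : scalar_Im (0 : K) = 0. Proof. by case: (k). Qed.

Lemma scalar_Re_sum (I : Type) (s : seq I) (P : pred I) (f : I -> K) :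
  scalar_Re (\sum_(i <- s | P i) f i) = \sum_(i <- s | P i) scalar_Re (f i).
Proof. by elim/big_rec2: _ => [|i y z _ <-]; rewrite ?scalar_Re0// scalar_ReD. Qed.

Lemma scalar_Im_sum (I : Type) (s : seq I) (P : pred I) (f : I -> K) :
  scalar_Im (\sum_(i <- s | P i) f i) = \sum_(i <- s | P i) scalar_Im (f i).
Proof. by elim/big_rec2: _ => [|i y z _ <-]; rewrite ?scalar_Im0// scalar_ImD. Qed.

Lemma abs_Re_le (z : K) : `|scalar_Re z| <= modulus z.
Proof. by rewrite -sqrtr_sqr ler_wsqrtr// lerDl sqr_ge0. Qed.

Lemma abs_Im_le (z : K) : `|scalar_Im z| <= modulus z.
Proof. by rewrite -sqrtr_sqr ler_wsqrtr// lerDr sqr_ge0. Qed.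

Lemma modulus_le_ReIm (z : K) : modulus z <= `|scalar_Re z| + `|scalar_Im z|.
Proof.
rewrite -[leRHS]ger0_norm ?addr_ge0// -sqrtr_sqr ler_wsqrtr//.
rewrite sqrrD !real_normK ?num_real// -addrA lerD2l lerDr.
by rewrite mulrn_wge0// mulr_ge0.
Qed.

Lemma scalar_Re_of (a b : R) : scalar_Re (scalar_of a b : K) = a. Proof. by case: (k). Qed.

Lemma modulus_cvg (f : nat -> K) (z : K) :
  scalar_Re (f n) @[n --> \oo] --> scalar_Re z ->
  scalar_Im (f n) @[n --> \oo] --> scalar_Im z ->
  modulus (f n) @[n --> \oo] --> modulus z.
Proof.
move=> hr hi; rewrite /modulus.
apply: (@cvg_comp _ _ _ (fun n => scalar_Re (f n) ^+ 2 + scalar_Im (f n) ^+ 2) Num.sqrt _ _ _ _ (@sqrt_continuous R _)).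
have sq (u : nat -> R) (l : R) : u @ \oo --> l -> u n ^+ 2 @[n --> \oo] --> l ^+ 2.
  by move=> ul; under eq_fun do rewrite expr2; rewrite expr2; exact: cvgM.
by apply: cvgD; exact: sq.
Qed.

Lemma scalar_measurable_of (a b : T -> R) : measurable_fun [set: T] a ->
  measurable_fun [set: T] b -> scalar_measurable (fun x => scalar_of (a x) (b x) : K).
Proof.
by rewrite /scalar_measurable; case: (k) => ma mb; split=> //=; exact: measurable_cst.
Qed.

Lemma cvg_powR (r : R) (h : nat -> R) (l : R) : 0 < r -> (forall n, 0 <= h n) ->
  h @ \oo --> l -> h n `^ r @[n --> \oo] --> l `^ r.
Proof.
move=> r0 h0 hl.
have : 0 <= l.
  by rewrite -(cvg_lim (@Rhausdorff R) hl); apply: limr_ge; [exact: cvgP hl|exact: nearW].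
rewrite le_eqVlt => /orP[/eqP l0|l0]; last first.
  apply: (@cvg_comp _ _ _ h (fun x => x `^ r) _ _ _ hl).
  have : {for l, continuous (fun x : R => x `^ r)}.
    apply/differentiable_continuous/derivable1_diffP.
    by apply: derivable_powR; rewrite in_itv/= l0.
  exact.
rewrite -l0 powR0 ?gt_eqF//; apply/cvgrPdist_le => e e0.
have e1 : 0 < e `^ r^-1 by rewrite powR_gt0.
move/cvgrPdist_le : hl => /(_ _ e1); apply: filterS => n.
rewrite -l0 !sub0r !normrN !ger0_norm ?powR_ge0// => hn.
have -> : e = (e `^ r^-1) `^ r by rewrite -powRrM mulVf ?gt_eqF// powRr1// ltW.
by apply: ge0_ler_powR; rewrite ?nnegrE ?powR_ge0 ?(ltW r0).
Qed.

Section complete.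
Variables (u : nat -> X) (C : R).
Hypothesis uC : forall n, \sum_(i < n) rn (u i) <= C.

Let f i : LF := repr (u i).
Let G n x : R := \sum_(i < n) modulus (f i x).
Let S n : LF := \sum_(i < n) f i.

Let C0 : 0 <= C.
Proof. by apply: le_trans (uC 0); rewrite big_ord0. Qed.

Let mG n : measurable_fun [set: T] (G n).
Proof.
rewrite /G; under eq_fun do rewrite -(big_mkord predT (fun i => modulus (f i _))).
by apply: measurable_sum => i; apply: measurable_modulus; exact: LpFun_measurable.
Qed.

Let G_ge0 n x : 0 <= G n x.
Proof. by apply: sumr_ge0 => i _; exact: modulus_ge0. Qed.

(** Minkowski's inequality. *)
Let nG n : ('N[mu]_(p%:E)[EFin \o G n] <= (\sum_(i < n) rn (u i))%:E)%E.
Proof.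
elim: n => [|n IH].
  rewrite big_ord0 (_ : G 0%N = cst 0) ?Lnorm0//; first by apply/funext => x; rewrite /G big_ord0.
have -> : G n.+1 = (G n \+ (modulus \o f n))%R.
  by apply/funext => x; rewrite /G big_ord_recr.
have mf := measurable_modulus (LpFun_measurable (f n)).
rewrite big_ord_recr/= EFinD; apply: le_trans (eminkowski mu (mG n) mf p1) _.
by rewrite leeD// -[X in (_ <= (rn X)%:E)%E](pi_repr (u n)) rn_piE.
Qed.

Let g x := limn (fun n => (G n x `^ p)%:E).

Let ndG x : nondecreasing_seq (fun n => (G n x `^ p)%:E).
Proof.
move=> m n mn; rewrite lee_fin; apply: ge0_ler_powR; rewrite ?nnegrE ?(ltW p0)//.
rewrite /G (big_ord_widen n (fun i => modulus (f i x)) mn) [leRHS](bigID (fun i : 'I_n => (i < m)%N))/=.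
by rewrite lerDl sumr_ge0// => i _; exact: modulus_ge0.
Qed.

Let mGp n : measurable_fun [set: T] (fun x => (G n x `^ p)%:E).
Proof.
apply/measurable_EFinP.
exact: (@measurableT_comp _ _ _ _ _ _ (@powR R ^~ p)).
Qed.

Let mg : measurable_fun [set: T] g.
Proof.
apply: (emeasurable_fun_cvg (fun n x => (G n x `^ p)%:E)) => // x _.
exact: ereal_nondecreasing_is_cvgn.
Qed.

(** Monotone convergence for the sums of the moduli. *)
Let int_g : mu.-integrable setT g.
Proof.
have g0 x : (0 <= g x)%E.
  apply: lime_ge; first exact: ereal_nondecreasing_is_cvgn.
  by apply: nearW => n; rewrite lee_fin powR_ge0.
apply/integrableP; split => //.
under eq_integral do rewrite gee0_abs//.
rewrite monotone_convergence//; last by move=> n x _; rewrite lee_fin powR_ge0.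
apply: (@le_lt_trans _ _ (C `^ p)%:E); last by rewrite ltry.
apply: lime_le.
  apply: ereal_nondecreasing_is_cvgn => m n mn; apply: ge0_le_integral => //.
  - by move=> x _; rewrite lee_fin powR_ge0.
  - by move=> x _; exact: ndG.
apply: nearW => n.
have := nG n; set N := ('N[mu]_(p%:E)[EFin \o G n])%E => hN.
have -> : (\int[mu]_x (G n x `^ p)%:E = N `^ p)%E.
  rewrite /N poweR_Lnorm; last exact: pn0.
  apply: eq_integral => x _ /=.
  by rewrite ger0_norm// G_ge0.
have N0 : (0 <= N)%E by exact: Lnorm_ge0.
rewrite -poweR_EFin; apply: gt0_ler_poweR; rewrite ?in_itv/= ?leey ?andbT ?lee_fin ?(ltW p0)//.
by apply: le_trans hN _; rewrite lee_fin.
Qed.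

Let good x := cvgn (fun n => scalar_Re (S n x)) /\ cvgn (fun n => scalar_Im (S n x)).

Let SE n x : S n x = \sum_(i < n) f i x.
Proof. by rewrite /S LpFun_sumE. Qed.

(** The increasing sums of the moduli have a limit that is integrable to the power
    [p], hence finite almost everywhere, so the series converges absolutely
    there. *)
Let ae_good : \forall x \ae mu, good x.
Proof.
have := integrable_ae measurableT int_g; apply: filterS => x /(_ I) gx.
have Gb n : G n x <= 1 + fine (g x).
  have h : ((G n x `^ p)%:E <= g x)%E.
    apply: lime_ge; first exact: ereal_nondecreasing_is_cvgn.
    by exists n => // m /= nm; exact: ndG.
  rewrite -(fineK gx) lee_fin in h.
  have [G1|G1] := leP (G n x) 1.
    by apply: le_trans G1 _; rewrite lerDl (le_trans _ h)// powR_ge0.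
  have : G n x <= G n x `^ p.
    by apply: le1r_powR; [exact: ltW|move: p1; rewrite lee_fin].
  by lra.
have cv (h : K -> R) : (forall z, `|h z| <= modulus z) ->
    cvgn (series (fun i => h (f i x))).
  move=> hm; apply: normed_cvg; apply: nondecreasing_is_cvgn.
    by apply: nondecreasing_series => i _ _ /=.
  exists (1 + fine (g x)) => _ [n _ <-]; apply: le_trans (Gb n).
  have -> : [normed series (fun i => h (f i x))] n = \sum_(0 <= i < n) `|h (f i x)| by [].
  by rewrite big_mkord; apply: ler_sum.
split.
  rewrite (_ : (fun n => _) = series (fun i => scalar_Re (f i x))); first exact: cv abs_Re_le.
  by apply/funext => n; rewrite SE scalar_Re_sum /series/= big_mkord.
rewrite (_ : (fun n => _) = series (fun i => scalar_Im (f i x))); first exact: cv abs_Im_le.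
by apply/funext => n; rewrite SE scalar_Im_sum /series/= big_mkord.
Qed.

(** The limit of the partial sums where it exists.  The upper limit makes it
    total and measurable. *)
Let L (h : K -> R) x : R := fine (limn_esup (fun n => (h (S n x))%:E)).
Let V x : K := scalar_of (L scalar_Re x) (L scalar_Im x).

Let L_lim (h : K -> R) x : cvgn (fun n => h (S n x)) -> h (S n x) @[n --> \oo] --> L h x.
Proof.
move=> hc; rewrite /L.
have e : (h (S n x))%:E @[n --> \oo] --> (limn (fun n => h (S n x)))%:E.
  by apply: cvg_EFin; [exact: nearW|exact: hc].
rewrite is_cvg_limn_esupE; last by apply/cvg_ex; eexists; exact: e.
by move/cvg_lim : e => ->.
Qed.

Let mV : scalar_measurable V.
Proof.
have mL (h : K -> R) : (forall n, measurable_fun [set: T] (h \o S n)) -> measurable_fun [set: T] (L h).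
  move=> mh; apply: (@measurableT_comp _ _ _ _ _ _ fine) => //.
  by apply: measurable_fun_limn_esup => n; apply/measurable_EFinP; exact: mh.
have hr := mL scalar_Re (fun n => (LpFun_measurable (S n)).1).
have hi := mL scalar_Im (fun n => (LpFun_measurable (S n)).2).
exact: scalar_measurable_of.
Qed.

Let V_cvg x : good x -> forall n,
  modulus (S (n + m)%N x - S n x) `^ p @[m --> \oo] --> modulus (V x - S n x) `^ p.
Proof.
move=> [cr ci] n.
have sh (h : nat -> R) (l : R) : h @ \oo --> l -> h (n + m)%N @[m --> \oo] --> l.
  by move=> hl; have := hl; rewrite -(cvg_shiftn n); under [X in X @ _ --> _]eq_fun do rewrite addnC.
have hr : scalar_Re (S m x) @[m --> \oo] --> scalar_Re (V x).
  by rewrite /V scalar_Re_of; exact: L_lim.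
have hi : scalar_Im (S m x) @[m --> \oo] --> scalar_Im (V x).
  have -> : scalar_Im (V x) = L scalar_Im x.
    rewrite /V /L; move: (S) ci; case: (k) => //= S' _.
    rewrite (_ : (fun _ => _) = cst 0%:E)//.
    have h0 : (cst 0%:E : nat -> \bar R) @ \oo --> (0%:E : \bar R) by exact: cvg_cst.
    by rewrite (is_cvg_limn_esupE (cvgP _ h0)) (cvg_lim _ h0).
  exact: L_lim.
have hm : modulus (S (n + m)%N x - S n x) @[m --> \oo] --> modulus (V x - S n x).
  apply: modulus_cvg.
    rewrite scalar_ReB; under eq_fun do rewrite scalar_ReB.
    by apply: cvgB; [exact: (sh (fun m => scalar_Re (S m x)))|exact: cvg_cst].
  rewrite scalar_ImB; under eq_fun do rewrite scalar_ImB.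
  by apply: cvgB; [exact: (sh (fun m => scalar_Im (S m x)))|exact: cvg_cst].
by apply: cvg_powR => // m; exact: modulus_ge0.
Qed.

(** Fatou's lemma applied to [S (n + m) - S n] as [m] grows. *)
Let V_close n (M : R) : 0 <= M ->
  (forall m, rn (\pi_X (S (n + m)%N - S n)) <= M) ->
  (\int[mu]_x (modulus (V x - S n x) `^ p)%:E <= (M `^ p)%:E)%E.
Proof.
move=> M0 hM.
pose F m x := (modulus (S (n + m)%N x - S n x) `^ p)%:E.
have mF m : measurable_fun [set: T] (F m).
  exact: (measurable_modulus_pow (LpFun_measurable (S (n + m)%N - S n))).
have mVS : scalar_measurable (fun x => V x - S n x).
  have -> : (fun x => V x - S n x) = V + (-1) *: (S n : T -> K).
    by apply/funext => x; rewrite -[RHS]/(V x + (-1) * S n x) mulN1r.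
  by apply: scalar_measurableD => //; apply: scalar_measurableZ; exact: LpFun_measurable.
have -> : (\int[mu]_x (modulus (V x - S n x) `^ p)%:E =
           \int[mu]_x limn_einf (F ^~ x))%E.
  apply: ge0_ae_eq_integral => //.
  - exact: (measurable_modulus_pow mVS).
  - rewrite /limn_einf; apply: measurableT_comp => //.
    by apply: measurable_fun_limn_esup => m; exact: measurableT_comp.
  - by move=> x _; rewrite lee_fin powR_ge0.
  - move=> x _; rewrite limn_einf_lim; apply: lime_ge; first exact: is_cvg_einfs.
    by apply: nearW => m; apply: le_ereal_inf_tmp => _ [i _ <-]; rewrite lee_fin powR_ge0.
  - apply: filterS ae_good => x gx _.
    have e : F m x @[m --> \oo] --> (modulus (V x - S n x) `^ p)%:E.
      by apply: cvg_EFin; [exact: nearW|exact: V_cvg].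
    rewrite is_cvg_limn_einfE; last by apply/cvg_ex; eexists; exact: e.
    by apply/esym/cvg_lim.
apply: le_trans (fatou mu measurableT mF _) _; first by move=> m x _; rewrite lee_fin powR_ge0.
rewrite limn_einf_lim; apply: lime_le; first exact: is_cvg_einfs.
apply: nearW => m; apply: (@le_trans _ _ (\int[mu]_x F m x)%E).
  by apply: ereal_inf_lbound; exists m => //=.
rewrite /F -(rn_pow (S (n + m)%N - S n)) lee_fin.
by apply: ge0_ler_powR; rewrite ?nnegrE ?rn_ge0 ?(ltW p0).
Qed.

Lemma Lp_series_complete : exists x, rcvg (fun n => \sum_(i < n) u i) x.
Proof.
have piS n : \pi_X (S n) = \sum_(i < n) u i.
  by rewrite pi_sum; apply: eq_bigr => i _; exact: pi_repr.
have tailS n m : \pi_X (S (n + m)%N - S n) = \sum_(i < m) u (n + i)%N.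
  have e : \sum_(i < n + m) u i = \sum_(i < n) u i + \sum_(i < m) u (n + i)%N.
    by rewrite big_split_ord.
  by rewrite pi_B !piS e addrC addKr.
have VL : V \in scalar_Lfun mu p1.
  apply: LpFunP => //.
  have h : (\int[mu]_x (modulus (V x - S 0%N x) `^ p)%:E <= (C `^ p)%:E)%E.
    apply: V_close => // m; rewrite tailS; apply: le_trans (rn_sum _ _ _) _.
    exact: uC.
  apply: le_lt_trans (ltry (C `^ p)); apply: le_trans h.
  under [leRHS]eq_integral do rewrite SE big_ord0 subr0.
  exact: lexx.
exists (\pi_X (MkLpFun VL)) => e e0.
have [|N hN] := @tail_small R (fun i => rn (u i)) C _ uC e e0; first by move=> i; exact: rn_ge0.
exists N => n Nn; rewrite rnC -piS -pi_B.
apply: rn_le (ltW e0) _; apply: V_close (ltW e0) _ => m.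
rewrite tailS; apply: le_trans (rn_sum _ _ _) _.
have := hN (n + m)%N (fun i => n <= i)%N (fun i ni => leq_trans Nn ni).
apply: le_trans; rewrite big_split_ord/= [X in _ <= X + _]big_pred0; last first.
  by move=> i; rewrite leqNgt ltn_ord.
by rewrite add0r; under [leRHS]eq_bigl do rewrite leq_addr.
Qed.

End complete.

Lemma Lp_complete : rcomplete X.
Proof. by move=> u C uC; exact: Lp_series_complete uC. Qed.

Definition Lp_disjoint (u v : X) :=
  \forall x \ae mu, repr u x = 0 \/ repr v x = 0.

Lemma repr_addE (u v : X) : \forall x \ae mu, repr (u + v) x = repr u x + repr v x.
Proof.
have := Lp_repr_ae (repr u + repr v); rewrite Lp_piD !pi_repr.
by apply: filterS => x ->.
Qed.

Lemma repr_scaleE (a : K) (u : X) : \forall x \ae mu, repr (a *: u) x = a * repr u x.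
Proof.
have := Lp_repr_ae (a *: repr u); rewrite -[\pi_X (a *: repr u)]/(a *: u : X).
by apply: filterS => x ->.
Qed.

Lemma repr_0E : \forall x \ae mu, repr (0 : X) x = 0.
Proof.
have := Lp_repr_ae (0 : LF); rewrite (raddf0 \pi_X).
by apply: filterS => x ->.
Qed.

Lemma Lp_disjoint0 u : Lp_disjoint u 0.
Proof. by apply: filterS repr_0E => x ->; right. Qed.

Lemma Lp_disjointD u v w : Lp_disjoint u v -> Lp_disjoint u w -> Lp_disjoint u (v + w).
Proof.
move=> uv uw; apply: filterS3 uv uw (repr_addE v w) => x h1 h2 ->.
by case: h1 => [->|->]; [left|case: h2 => [->|->]; [left|right; rewrite addr0]].
Qed.

Lemma Lp_disjointZ (a b : K) u v : Lp_disjoint u v -> Lp_disjoint (a *: u) (b *: v).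
Proof.
move=> uv; apply: filterS3 uv (repr_scaleE a u) (repr_scaleE b v) => x h -> ->.
by case: h => ->; rewrite mulr0; [left|right].
Qed.

Lemma rn_powE (u : X) : (rn u `^ p)%:E = (\int[mu]_x (modulus (repr u x) `^ p)%:E)%E.
Proof. by rewrite -rn_pow pi_repr. Qed.

(** Almost everywhere at most one of the two values is nonzero. *)
Lemma rn_powD (u v : X) : Lp_disjoint u v -> rn (u + v) `^ p = rn u `^ p + rn v `^ p.
Proof.
move=> uv; apply: EFin_inj; rewrite EFinD !rn_powE.
have pos (w : X) x : (0 <= (modulus (repr w x) `^ p)%:E)%E by rewrite lee_fin powR_ge0.
have mw (w : X) : measurable_fun [set: T] (fun x => (modulus (repr w x) `^ p)%:E).
  exact: (measurable_modulus_pow (LpFun_measurable _)).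
transitivity (\int[mu]_x ((modulus (repr u x) `^ p)%:E + (modulus (repr v x) `^ p)%:E))%E.
  apply: ge0_ae_eq_integral => //.
  - exact: emeasurable_funD.
  - by move=> x _; exact: adde_ge0.
  apply: filterS2 uv (repr_addE u v) => x h -> _.
  by case: h => ->; rewrite ?addr0 ?add0r modulus0 powR0// ?add0e ?adde0.
by apply: ge0_integralD.
Qed.

Lemma rn_pow_sum (I : eqType) (s : seq I) (w : I -> X) : uniq s ->
  {in s &, forall i j, i != j -> Lp_disjoint (w i) (w j)} ->
  rn (\sum_(i <- s) w i) `^ p = \sum_(i <- s) rn (w i) `^ p.
Proof.
elim: s => [|i s IH] /=; first by rewrite !big_nil rn0 powR0.
move=> /andP[is_ us] dis; rewrite !big_cons rn_powD.
  by rewrite IH// => a b as_ bs; apply: dis; rewrite inE ?as_ ?bs orbT.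
rewrite big_seq; apply: big_ind => [||j js].
- exact: Lp_disjoint0.
- by move=> a b; exact: Lp_disjointD.
apply: dis; rewrite ?inE ?eqxx ?js ?orbT//.
by apply: contraNneq is_ => ->.
Qed.

Lemma rn_pow_sum_fin (I : finType) (P : pred I) (w : I -> X) :
  (forall i j, P i -> P j -> i != j -> Lp_disjoint (w i) (w j)) ->
  rn (\sum_(i | P i) w i) `^ p = \sum_(i | P i) rn (w i) `^ p.
Proof.
move=> dis; rewrite -big_filter -[RHS]big_filter; apply: rn_pow_sum.
  by rewrite filter_uniq// index_enum_uniq.
by move=> i j; rewrite !mem_filter => /andP[Pi _] /andP[Pj _]; exact: dis.
Qed.

End Lp_basics.

Section Lp_pairing.
Context d (T : measurableType d) (R : realType) (k : scalar_kind).
Variables (mu : {measure set T -> \bar R}) (p q : R).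
Variables (p1 : (1 <= p%:E)%E) (q1 : (1 <= q%:E)%E) (pq : p^-1 + q^-1 = 1).
Local Notation K := (scalar R k).
Local Notation X := (Lp k mu p1).
Local Notation Y := (Lp k mu q1).
Local Open Scope quotient_scope.

Lemma measurable_mul_scalar (f g : T -> K) : scalar_measurable f -> scalar_measurable g ->
  scalar_measurable (fun x => f x * g x).
Proof.
move=> [fr fi] [gr gi]; split.
  rewrite (_ : _ \o _ = ((scalar_Re \o f) \* (scalar_Re \o g)) \-
                        ((scalar_Im \o f) \* (scalar_Im \o g))).
    by apply: measurable_funB; exact: measurable_funM.
  by apply/funext => x /=; rewrite -scalar_ReM.
rewrite (_ : _ \o _ = ((scalar_Re \o f) \* (scalar_Im \o g)) \+
                      ((scalar_Im \o f) \* (scalar_Re \o g))).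
  by apply: measurable_funD; exact: measurable_funM.
by apply/funext => x /=; rewrite -scalar_ImM.
Qed.

Lemma hoelder_modulus (F : LpFun k mu q1) (u : LpFun k mu p1) :
  (\int[mu]_x (modulus (F x * u x))%:E <= (rn (\pi_Y F) * rn (\pi_X u))%:E)%E.
Proof.
have mF := measurable_modulus (LpFun_measurable F).
have mu_ := measurable_modulus (LpFun_measurable u).
have qp : q^-1 + p^-1 = 1 by rewrite addrC.
have := hoelder mu mF mu_ (exponent_gt0 q1) (exponent_gt0 p1) qp.
rewrite Lnorm1 -[X in (_ <= X * _)%E]rn_piE -[X in (_ <= _ * X)%E]rn_piE -EFinM.
rewrite (@eq_integral _ _ _ mu setT (fun x => (modulus (F x * u x))%:E))// => x _ /=.
by rewrite ger0_norm ?mulr_ge0 ?modulus_ge0// modulusM.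
Qed.

Lemma integrable_mul (F : LpFun k mu q1) (u : LpFun k mu p1) (h : K -> R) :
  (forall z, `|h z| <= modulus z) ->
  measurable_fun [set: T] (fun x => h (F x * u x)) ->
  mu.-integrable [set: T] (EFin \o (fun x => h (F x * u x))).
Proof.
move=> hm mh; apply/integrableP; split; first exact/measurable_EFinP.
apply: le_lt_trans (ltry (rn (\pi_Y F) * rn (\pi_X u))).
apply: le_trans (hoelder_modulus F u); apply: ge0_le_integral => //.
- by apply/measurable_EFinP; exact: measurableT_comp.
- by apply/measurable_EFinP; apply: (measurable_modulus (measurable_mul_scalar (LpFun_measurable F) (LpFun_measurable u))).
- by move=> x _; rewrite /= lee_fin.
Qed.

Lemma integrable_Re (F : LpFun k mu q1) (u : LpFun k mu p1) :
  mu.-integrable [set: T] (EFin \o (fun x => scalar_Re (F x * u x))).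
Proof.
apply: (integrable_mul (h := scalar_Re)); first exact: abs_Re_le.
exact: (measurable_mul_scalar (LpFun_measurable F) (LpFun_measurable u)).1.
Qed.

Lemma integrable_Im (F : LpFun k mu q1) (u : LpFun k mu p1) :
  mu.-integrable [set: T] (EFin \o (fun x => scalar_Im (F x * u x))).
Proof.
apply: (integrable_mul (h := scalar_Im)); first exact: abs_Im_le.
exact: (measurable_mul_scalar (LpFun_measurable F) (LpFun_measurable u)).2.
Qed.

Lemma scalar_integralD (f g : T -> K) :
  mu.-integrable [set: T] (EFin \o (fun x => scalar_Re (f x))) ->
  mu.-integrable [set: T] (EFin \o (fun x => scalar_Im (f x))) ->
  mu.-integrable [set: T] (EFin \o (fun x => scalar_Re (g x))) ->
  mu.-integrable [set: T] (EFin \o (fun x => scalar_Im (g x))) ->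
  scalar_integral mu (fun x => f x + g x) = scalar_integral mu f + scalar_integral mu g.
Proof.
move=> fr fi gr gi; rewrite /scalar_integral.
rewrite (_ : (\int[mu]_x scalar_Re (f x + g x))%R =
   (\int[mu]_x scalar_Re (f x))%R + (\int[mu]_x scalar_Re (g x))%R); last first.
  by rewrite -RintegralD//; apply: eq_Rintegral => x _; rewrite scalar_ReD.
rewrite (_ : (\int[mu]_x scalar_Im (f x + g x))%R =
   (\int[mu]_x scalar_Im (f x))%R + (\int[mu]_x scalar_Im (g x))%R); last first.
  by rewrite -RintegralD//; apply: eq_Rintegral => x _; rewrite scalar_ImD.
move: (\int[mu]_x _) (\int[mu]_x _) (\int[mu]_x _) (\int[mu]_x _).
by case: (k).
Qed.

Lemma scalar_integralZ (a : K) (f : T -> K) :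
  mu.-integrable [set: T] (EFin \o (fun x => scalar_Re (f x))) ->
  mu.-integrable [set: T] (EFin \o (fun x => scalar_Im (f x))) ->
  scalar_integral mu (fun x => a * f x) = a * scalar_integral mu f.
Proof.
move=> fr fi; rewrite /scalar_integral.
have iZ (c : R) (h : T -> R) : mu.-integrable [set: T] (EFin \o h) ->
    mu.-integrable [set: T] (EFin \o (fun x => c * h x)).
  by move=> ih; apply: (integrableZl measurableT c ih).
rewrite (_ : (\int[mu]_x scalar_Re (a * f x))%R = scalar_Re a * (\int[mu]_x scalar_Re (f x))%R -
   scalar_Im a * (\int[mu]_x scalar_Im (f x))%R); last first.
  rewrite -!RintegralZl// -RintegralB; [|by []|exact: iZ|exact: iZ].
  by apply: eq_Rintegral => x _; rewrite scalar_ReM.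
rewrite (_ : (\int[mu]_x scalar_Im (a * f x))%R = scalar_Re a * (\int[mu]_x scalar_Im (f x))%R +
   scalar_Im a * (\int[mu]_x scalar_Re (f x))%R); last first.
  rewrite -!RintegralZl// -RintegralD; [|by []|exact: iZ|exact: iZ].
  by apply: eq_Rintegral => x _; rewrite scalar_ImM.
move: (\int[mu]_x _) (\int[mu]_x _) => u v.
case: (k) a u v => //= [a u v|[a b] u v]; first by rewrite mul0r subr0.
by [].
Qed.

Lemma Lp_pairing : pairing (@Lp_dual _ T R k mu p%:E q%:E p1 q1).
Proof.
split.
- elim/Lp_ind => F; elim/Lp_ind => G; elim/Lp_ind => u.
  rewrite -Lp_piD !Lp_dual_pi -scalar_integralD;
    [|exact: integrable_Re|exact: integrable_Im|exact: integrable_Re|exact: integrable_Im].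
  by congr scalar_integral; apply/funext => x; rewrite -mulrDl.
- elim/Lp_ind => F; elim/Lp_ind => u; elim/Lp_ind => v.
  rewrite -Lp_piD !Lp_dual_pi -scalar_integralD;
    [|exact: integrable_Re|exact: integrable_Im|exact: integrable_Re|exact: integrable_Im].
  by congr scalar_integral; apply/funext => x; rewrite -mulrDr.
- move=> a; elim/Lp_ind => F; elim/Lp_ind => u.
  rewrite [a *: _]Lp_piZ !Lp_dual_pi -scalar_integralZ; [|exact: integrable_Re|exact: integrable_Im].
  by congr scalar_integral; apply/funext => x; rewrite mulrA.
- move=> a; elim/Lp_ind => F; elim/Lp_ind => u.
  rewrite [a *: _]Lp_piZ !Lp_dual_pi -scalar_integralZ; [|exact: integrable_Re|exact: integrable_Im].
  by congr scalar_integral; apply/funext => x; rewrite mulrCA.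
- elim/Lp_ind => F; elim/Lp_ind => u; rewrite Lp_dual_pi.
  have b (h : K -> R) : (forall z, `|h z| <= modulus z) ->
      mu.-integrable [set: T] (EFin \o (fun x => h (F x * u x))) ->
      `|(\int[mu]_x h (F x * u x))%R| <= rn (\pi_Y F) * rn (\pi_X u).
    move=> hm ih; apply: le_trans (le_normr_Rintegral measurableT ih) _.
    rewrite -lee_fin /Rintegral fineK.
      apply: le_trans (hoelder_modulus F u); apply: ge0_le_integral => //.
      - by apply: (@measurableT_comp _ _ _ _ _ _ abse _ (EFin \o (fun x => h (F x * u x)))) => //; exact: (measurable_int mu ih).
      - by apply/measurable_EFinP; apply: (measurable_modulus (measurable_mul_scalar (LpFun_measurable F) (LpFun_measurable u))).
      - by move=> x _; rewrite /= lee_fin.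
    by have /integrableP[_] := ih; rewrite ge0_fin_numE// integral_ge0.
  apply: le_trans (modulus_le_ReIm _) _.
  have hr := b _ (@abs_Re_le R k) (integrable_Re F u).
  have hi := b _ (@abs_Im_le R k) (integrable_Im F u).
  have hi0 (a c : R) : `|scalar_Im (scalar_of a c : K)| <= `|c| by case: (k) => //=; rewrite normr0.
  rewrite /scalar_integral scalar_Re_of -mulrA mulr2n mulrDl mul1r lerD//.
  exact: le_trans (hi0 _ _) hi.
Qed.

End Lp_pairing.

(** * A function whose translates imitate a given sequence *)

Section translation_facts.
Context (R : realType) (k : scalar_kind) (n : nat) (p : R) (p1 : (1 <= p%:E)%E).
Local Notation K := (scalar R k).
Local Notation mu := (lebesgue_rV R n).
Local Notation X := (Lp k mu p1).
Local Open Scope quotient_scope.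
Implicit Types (l : 'rV[R]_n) (u v : X).

Lemma Lp_translateD l u v : Lp_translate l (u + v) = Lp_translate l u + Lp_translate l v.
Proof.
elim/Lp_ind: u => f; elim/Lp_ind: v => g; rewrite -Lp_piD !Lp_translate_pi -Lp_piD.
by congr \pi; apply/val_inj.
Qed.

Lemma Lp_translateZ l (a : K) u : Lp_translate l (a *: u) = a *: Lp_translate l u.
Proof.
elim/Lp_ind: u => f; rewrite [a *: \pi_X f]Lp_piZ !Lp_translate_pi [RHS]Lp_piZ.
by congr \pi; apply/val_inj.
Qed.

Lemma Lp_translate0 u : Lp_translate 0 u = u.
Proof.
elim/Lp_ind: u => f; rewrite Lp_translate_pi; congr \pi; apply/val_inj/funext => x /=.
by rewrite /translate subr0.
Qed.

Lemma Lp_translateA l m u : Lp_translate l (Lp_translate m u) = Lp_translate (l + m) u.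
Proof.
elim/Lp_ind: u => f; rewrite !Lp_translate_pi; congr \pi; apply/val_inj/funext => x /=.
by rewrite /translate opprD addrA.
Qed.

Lemma rn_translate l u : rn (Lp_translate l u) = rn u.
Proof.
elim/Lp_ind: u => f; rewrite Lp_translate_pi !rn_pi.
congr fine; apply: scalar_Lnorm_translate => //; exact: LpFun_measurable.
Qed.

Lemma Lp_translate_0 l : Lp_translate l (0 : X) = 0.
Proof. by apply: rn_eq0; rewrite rn_translate rn0. Qed.

Lemma Lp_translate_sum l (I : Type) (s : seq I) (P : pred I) (w : I -> X) :
  Lp_translate l (\sum_(i <- s | P i) w i) = \sum_(i <- s | P i) Lp_translate l (w i).
Proof.
by elim/big_rec2: _ => [|i y z _ <-]; rewrite ?Lp_translate_0// Lp_translateD.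
Qed.

Lemma Lp_translateB l u v : Lp_translate l (u - v) = Lp_translate l u - Lp_translate l v.
Proof. by rewrite -scaleN1r Lp_translateD Lp_translateZ scaleN1r. Qed.

Definition Lp_supported u (A : set 'rV[R]_n) := \forall x \ae mu, ~ A x -> repr u x = 0.

Lemma Lp_supported_translate l u A : Lp_supported u A ->
  Lp_supported (Lp_translate l u) [set x | A (x - l)].
Proof.
elim/Lp_ind: u => f; rewrite Lp_translate_pi /Lp_supported => fA.
have fA' : \forall x \ae mu, ~ A x -> f x = 0.
  by apply: filterS2 fA (Lp_repr_ae f) => x h <-.
have := ae_preserving (measurable_rV_shift (- l)) (lebesgue_rV_shift (- l)) fA'.
apply: filterS2 (Lp_repr_ae (LpFun_translate l f)) => x -> /=.
by [].
Qed.

Lemma Lp_supported_disjoint u v A B : Lp_supported u A -> Lp_supported v B ->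
  (forall x, A x -> B x -> False) -> Lp_disjoint u v.
Proof.
rewrite /Lp_supported /Lp_disjoint => uA vB AB; apply: filterS2 uA vB => x hA hB.
by have [Ax|nA] := pselect (A x); [right; apply: hB => /(AB _ Ax)|left; exact: hA].
Qed.

Lemma rcvg_translate l (w : nat -> X) u : rcvg w u ->
  rcvg (fun i => Lp_translate l (w i)) (Lp_translate l u).
Proof.
by move=> wu e /wu[N h]; exists N => i /h; rewrite -Lp_translateB rn_translate.
Qed.

End translation_facts.

Section spread_function.
Context (R : realType) (k : scalar_kind) (d : nat) (p : R) (p1 : (1 <= p%:E)%E).
Local Notation K := (scalar R k).
Local Notation mu := (lebesgue_rV R d).
Local Notation X := (Lp k mu p1).
Local Notation sc a := (scalar_of a 0 : K).
Variables (e : nat -> X) (q lam : nat -> 'rV[R]_d) (b N M : nat -> nat).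
Variables (c kappa : nat -> R) (delta : R).
Hypothesis e1 : forall j, rn (e j) <= 1.
Hypothesis e_supp : forall j, Lp_supported (e j) [set x | `|x - q j| <= 1].
Hypothesis b_le : forall i, (b i <= i)%N.
Hypothesis block_card : forall j, \sum_(i < M j | b i == j) 1%N = N j.
Hypothesis c_gt0 : forall j, 0 < c j.
Hypothesis kappa3 : forall j, c j * (N j)%:R `^ p^-1 <= kappa j.
Hypothesis kappa_sum : forall n, \sum_(j < n) kappa j <= delta.
Hypothesis sep : forall i i' l l', i != i' -> l != l' -> (i, i') != (l, l') ->
  2 < `|(q (b i') + (lam i - lam i')) - (q (b l') + (lam l - lam l'))|.
Hypothesis sep0 : forall i l, i != l ->
  2 < `|(q (b i) - lam i) - (q (b l) - lam l)|.

Let p0 : 0 < p := exponent_gt0 p1.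

(** The supports are balls of radius [1]. *)
Let disj (x y : 'rV[R]_d) i j : 2 < `|(q i + x) - (q j + y)| ->
  Lp_disjoint (Lp_translate x (e i)) (Lp_translate y (e j)).
Proof.
move=> h; apply: Lp_supported_disjoint (Lp_supported_translate x (@e_supp i))
  (Lp_supported_translate y (@e_supp j)) _ => z /= h1 h2.
move: h; rewrite ltNge => /negP; apply.
have -> : q i + x - (q j + y) = (z - y - q j) - (z - x - q i).
  by apply/matrixP => a a'; rewrite !mxE; ring.
apply: le_trans (ler_normB _ _) _.
have -> : (2 : R) = 1 + 1 by [].
exact: lerD.
Qed.

(** The part of the function that belongs to the block [j]. *)
Let g j : X := sc (c j) *: \sum_(i < M j | b i == j) Lp_translate (- lam i) (e j).

Let Ninv_pow j : ((N j)%:R `^ p^-1) `^ p = (N j)%:R :> R.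
Proof. by rewrite -powRrM mulVf ?gt_eqF// powRr1. Qed.

Let pow_inv (x : R) : 0 <= x -> (x `^ p) `^ p^-1 = x.
Proof. by move=> x0; rewrite -powRrM divff ?gt_eqF// powRr1. Qed.

Let le_of_pow (x y : R) : 0 <= x -> 0 <= y -> x `^ p <= y `^ p -> x <= y.
Proof.
move=> x0 y0 xy; rewrite -(pow_inv x0) -(pow_inv y0).
by apply: ge0_ler_powR; rewrite ?nnegrE ?powR_ge0 ?invr_ge0 ?(ltW p0).
Qed.

Let pow_e_le1 j : rn (e j) `^ p <= 1.
Proof.
have e1p : (1 : R) `^ p = 1 by rewrite powR1.
rewrite -[leRHS]e1p; apply: ge0_ler_powR; rewrite ?nnegrE ?rn_ge0 ?(ltW p0)//.
Qed.

Let rn_g j : rn (g j) <= kappa j.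
Proof.
apply: le_trans (kappa3 j); rewrite /g rnZ modulus_scalar_of gtr0_norm// ler_pM2l//.
apply: le_of_pow; rewrite ?rn_ge0 ?powR_ge0// Ninv_pow rn_pow_sum_fin.
  rewrite -block_card natr_sum; apply: ler_sum => i _.
  by rewrite rn_translate pow_e_le1.
move=> i l /eqP bi /eqP bl il; apply: disj.
by rewrite -[in X in q X + _]bi -[in X in _ - (q X + _)]bl; apply: sep0.
Qed.

Let exists_f : exists f, rcvg (fun J => \sum_(j < J) g j) f.
Proof.
apply: (@Lp_complete _ _ _ _ _ _ p1 g delta) => J.
by apply: le_trans (kappa_sum J); apply: ler_sum => j _; exact: rn_g.
Qed.

Let rest i J := \sum_(j < J) sc (c j) *:
  \sum_(i' < M j | (b i' == j) && (i' != i :> nat)) Lp_translate (lam i - lam i') (e j).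

Hypothesis bM : forall i, (i < M (b i))%N.

Let translate_g i j : Lp_translate (lam i) (g j) =
  (if b i == j then sc (c j) *: e j else 0) +
  sc (c j) *: \sum_(i' < M j | (b i' == j) && (i' != i :> nat)) Lp_translate (lam i - lam i') (e j).
Proof.
rewrite /g Lp_translateZ Lp_translate_sum.
under eq_bigr do rewrite Lp_translateA.
case: eqVneq => [bi|bi].
  have iM : (i < M j)%N by rewrite -bi.
  rewrite (bigD1 (Ordinal iM)) ?bi//= subrr Lp_translate0 scalerDr; congr (_ + _ *: _).
rewrite add0r; congr (_ *: _); apply: eq_bigl => i'.
by case: (eqVneq (b i') j) => //= bi'; apply/esym/eqP => ii; rewrite -ii bi' eqxx in bi.
Qed.

Let translate_f f i : rcvg (fun J => \sum_(j < J) g j) f ->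
  rcvg (rest i) (Lp_translate (lam i) f - sc (c (b i)) *: e (b i)).
Proof.
move=> hf; have h := rcvg_translate (lam i) hf.
move=> eps eps0; have [J0 hJ] := h _ eps0.
exists (maxn J0 (b i).+1) => J; rewrite geq_max => /andP[/hJ {}hJ bJ].
move: hJ; congr (rn _ <= _).
rewrite Lp_translate_sum; under eq_bigr do rewrite translate_g.
rewrite big_split/= -big_mkcond/= (big_pred1 (Ordinal bJ)); last first.
  by move=> j; rewrite /= -val_eqE/= eq_sym.
by rewrite /= -/(rest i J) opprB addrA; congr (_ - _); exact: addrC.
Qed.

(** The copies that belong to one block [j] are disjoint for all [i] at once;
    each coefficient [a i] occurs at most [N j] times, which gives the factor
    [N j `^ p^-1]. *)
Lemma rest_le n J (a : nat -> K) (A : R) : 0 <= A ->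
  \sum_(i < n) modulus (a i) `^ p <= A `^ p -> rn (\sum_(i < n) a i *: rest i J) <= delta * A.
Proof.
move=> A0 hA.
have -> : \sum_(i < n) a i *: rest i J = \sum_(j < J) sc (c j) *:
  \sum_(x : 'I_n * 'I_(M j) | (b x.2 == j) && (x.2 != x.1 :> nat))
     a x.1 *: Lp_translate (lam x.1 - lam x.2) (e j).
  under eq_bigr do rewrite /rest scaler_sumr.
  rewrite exchange_big/=; apply: eq_bigr => j _.
  under eq_bigr do rewrite scalerA mulrC -scalerA.
  rewrite -scaler_sumr; congr (_ *: _).
  transitivity (\sum_(i < n) \sum_(i' < M j | (b i' == j) && (i' != i :> nat))
      a i *: Lp_translate (lam i - lam i') (e j)).
    by apply: eq_bigr => i _; rewrite scaler_sumr.
  by rewrite pair_big_dep.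
apply: le_trans (rn_sum _ _ _) _.
apply: (@le_trans _ _ (\sum_(j < J) kappa j * A)); last by rewrite -mulr_suml ler_wpM2r.
apply: ler_sum => j _; rewrite rnZ modulus_scalar_of gtr0_norm//.
apply: (@le_trans _ _ (c j * ((N j)%:R `^ p^-1 * A))); last by rewrite mulrA ler_wpM2r.
rewrite ler_pM2l//; apply: le_of_pow; rewrite ?rn_ge0 ?mulr_ge0 ?powR_ge0//.
rewrite rn_pow_sum_fin; last first.
  move=> [i i'] [l l'] /= /andP[/eqP bi ii] /andP[/eqP bl ll] ne.
  apply: Lp_disjointZ; apply: disj.
  rewrite -{1}bi -[in X in _ - (q X + _)]bl; apply: sep; [by rewrite eq_sym|by rewrite eq_sym|].
  by apply: contra ne => /eqP[/val_inj -> /val_inj ->].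
rewrite powRM ?powR_ge0// Ninv_pow mulrC.
apply: (@le_trans _ _ (\sum_(x : 'I_n * 'I_(M j) | b x.2 == j) modulus (a x.1) `^ p)).
  rewrite big_mkcond [leRHS]big_mkcond/=; apply: ler_sum => -[i i'] _ /=.
  case: (b i' == j) => //=; case: ifP => _; last exact: powR_ge0.
  by rewrite rnZ powRM ?modulus_ge0 ?rn_ge0// rn_translate ler_piMr ?powR_ge0.
have -> : \sum_(x : 'I_n * 'I_(M j) | b x.2 == j) modulus (a x.1) `^ p =
    \sum_(i < n) \sum_(i' < M j | b i' == j) modulus (a i) `^ p by rewrite pair_big_dep.
rewrite (eq_bigr (fun i : 'I_n => modulus (a i) `^ p * (N j)%:R)); last first.
  by move=> i _; rewrite -block_card natr_sum mulr_sumr; apply: eq_bigr => i' _; rewrite mulr1.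
by rewrite -mulr_suml ler_wpM2r.
Qed.

(** The function is the sum of the [g j].  Translation by [lam i] brings the
    [i]-th copy of [e (b i)] back to its place, and [rest i] collects the
    other copies.  For different pairs of indices these are supported in disjoint
    balls, so the [p]-th powers of norms add up. *)
Theorem spread_function : exists f : X, forall n (a : nat -> K) (A : R), 0 <= A ->
  \sum_(i < n) modulus (a i) `^ p <= A `^ p ->
  rn (\sum_(i < n) a i *: (Lp_translate (lam i) f - sc (c (b i)) *: e (b i))) <= delta * A.
Proof.
have [f hf] := exists_f; exists f => n a A A0 hA.
apply: (@rcvg_bound _ _ _ (fun J => \sum_(i < n) a i *: rest i J)); last first.
  by move=> J; exact: rest_le.
elim: n {A A0 hA} => [|n IH].
  by under [X in rcvg X]eq_fun do rewrite big_ord0; rewrite big_ord0 => eps eps0; exists 0%N => m _; rewrite subrr rn0 ltW.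
rewrite big_ord_recr/=; under [X in rcvg X]eq_fun do rewrite big_ord_recr/=.
apply: rcvgD => // eps eps0.
have m0 : 0 < 1 + modulus (a n) by rewrite ltr_wpDr ?modulus_ge0.
have [J0 h] := translate_f n hf (divr_gt0 eps0 m0); exists J0 => J /h hJ.
rewrite -scalerBr rnZ; apply: (@le_trans _ _ ((1 + modulus (a n)) * (eps / (1 + modulus (a n))))).
  by apply: ler_pM; rewrite ?modulus_ge0 ?rn_ge0// lerDr.
by rewrite mulrC divfK// gt_eqF.
Qed.

End spread_function.

(** * Dyadic cells and the exchange of their halves *)

Section dyadic_cells.
Context (R : realType) (d' : nat).
Local Notation D := d'.+1.
Local Notation V := 'rV[R]_D.
Local Notation mu := (lebesgue_rV R D).
Implicit Types (x : V) (n : nat) (i : 'I_D).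

Definition dfloor (q : nat) (t : R) : int := Num.floor (2 ^+ q * t).

Lemma dfloor_half q t : dfloor q t = (dfloor q.+1 t %/ 2)%Z.
Proof.
rewrite /dfloor; apply: floor_def; set z := Num.floor _.
have /andP[z1 z2] : z%:~R <= 2 ^+ q.+1 * t < (z + 1)%:~R by exact: floor_itv.
have h1 : ((z %/ 2)%Z * 2 <= z)%R by lia.
have h2 : (z + 1 <= (z %/ 2)%Z * 2 + 2)%R by lia.
move: h1 h2; rewrite -!(ler_int R) !intrD !intrM => h1 h2.
rewrite exprS -mulrA in z1 z2; rewrite intrD in z2.
have e2 : (2 : int)%:~R = 2 :> R by [].
rewrite e2 in h1 h2; apply/andP; split; rewrite ?intrD; lra.
Qed.

Lemma dfloor_coarser q r t s : (q <= r)%N -> dfloor r t = dfloor r s -> dfloor q t = dfloor q s.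
Proof.
move=> qr; rewrite -(subnK qr); elim: (r - q)%N => // m IH h.
by apply: IH; rewrite !(dfloor_half (m + q)); congr (_ %/ _)%Z; rewrite -addSn.
Qed.

Lemma dfloor_shift q t (s : int) : dfloor q (t + s%:~R * 2^-1 ^+ q) = dfloor q t + s.
Proof.
rewrite /dfloor mulrDr mulrCA -exprMn divff// expr1n mulr1.
by rewrite floorDrz ?intrKfloor ?intr_int.
Qed.

(** The cells of level [n] are halved in this one coordinate to obtain those of
    level [n + 1], so that every cell has two children. *)
Definition split_coord n : 'I_D := Ordinal (ltn_pmod n (ltn0Sn d')).

(** The number of times that the coordinate [i] has been halved to obtain the cells
    of level [n]. *)
Definition precision n i : nat := \sum_(m < n) (split_coord m == i).

Lemma precisionS n i : precision n.+1 i = (precision n i + (split_coord n == i))%N.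
Proof. by rewrite /precision big_ord_recr. Qed.

Lemma precision_le m n i : (m <= n)%N -> (precision m i <= precision n i)%N.
Proof.
move=> mn; rewrite -(subnK mn); elim: (n - m)%N => // r IH.
by rewrite addSn precisionS (leq_trans IH)// leq_addr.
Qed.

Lemma precision_unbounded i q : exists n, (q <= precision n i)%N.
Proof.
elim: q => [|q [n IH]]; first by exists 0%N.
pose m := (n * D + i)%N; exists m.+1; rewrite precisionS.
have nm : (n <= m)%N by rewrite /m (leq_trans _ (leq_addr _ _))// leq_pmulr.
have -> : split_coord m = i by apply/val_inj; rewrite /= /m modnMDl modn_small.
by rewrite eqxx addn1 ltnS (leq_trans IH)// precision_le.
Qed.

(** The label of the cell of level [n] that contains [x]. *)
Definition cellv n x : 'rV[int]_D := \row_i dfloor (precision n i) (x ord0 i).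

Lemma cellvP n x y : cellv n x = cellv n y <->
  forall i, dfloor (precision n i) (x ord0 i) = dfloor (precision n i) (y ord0 i).
Proof.
split=> [/rowP h i|h]; first by have := h i; rewrite !mxE.
by apply/rowP => i; rewrite !mxE.
Qed.

Lemma cellv_coarser m n x y : (m <= n)%N -> cellv n x = cellv n y -> cellv m x = cellv m y.
Proof.
move=> mn /cellvP h; apply/cellvP => i; apply: dfloor_coarser (h i).
exact: precision_le.
Qed.

(** The half of its cell of level [n] that contains [x]. *)
Definition bit n x : bool := (dfloor (precision n.+1 (split_coord n)) (x ord0 (split_coord n)) %% 2)%Z == 1.

Lemma bit_cellv m n x y : (m < n)%N -> cellv n x = cellv n y -> bit m x = bit m y.
Proof.
by move=> mn /(cellv_coarser mn)/cellvP/(_ (split_coord m)); rewrite /bit => ->.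
Qed.

Definition sgn_bit n x : R := if bit n x then -1 else 1.

Definition step n : V := \row_i (if split_coord n == i then 2^-1 ^+ precision n.+1 i else 0).

Lemma dfloor_step n x (s : int) i :
  dfloor (precision n.+1 i) ((x + s%:~R *: step n) ord0 i) =
  dfloor (precision n.+1 i) (x ord0 i) + (if split_coord n == i then s else 0).
Proof.
rewrite !mxE; case: eqP => [_|_]; last by rewrite mulr0 !addr0.
exact: dfloor_shift.
Qed.

Lemma bit_step n x (s : int) : s = 1 \/ s = -1 -> bit n (x + s%:~R *: step n) = ~~ bit n x.
Proof.
move=> hs; rewrite /bit dfloor_step eqxx; case: hs => ->; lia.
Qed.

(** The exchange of the two halves of all the cells of level [n]: a translation
    by half a cell, upwards in the lower half and downwards in the upper one. *)
Definition flip n x : V := x + (if bit n x then -1 else 1)%:~R *: step n.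

Lemma bit_flip n x : bit n (flip n x) = ~~ bit n x.
Proof. by rewrite /flip bit_step//; case: ifP; [right|left]. Qed.

Lemma sgn_bit_flip n x : sgn_bit n (flip n x) = - sgn_bit n x.
Proof. by rewrite /sgn_bit bit_flip; case: (bit n x); rewrite /= ?opprK. Qed.

Lemma cellv_flip n x : cellv n (flip n x) = cellv n x.
Proof.
apply/cellvP => i; have := dfloor_step n x (if bit n x then -1 else 1) i.
rewrite -/(flip n x) precisionS; case: eqP => [<-|ne]; last by rewrite addn0 addr0.
rewrite addn1 => h; rewrite dfloor_half h [RHS]dfloor_half.
move: h => _; rewrite /bit precisionS eqxx addn1; case: ifP; lia.
Qed.

Lemma cellv_flip_le m n x : (m <= n)%N -> cellv m (flip n x) = cellv m x.
Proof. by move=> mn; apply: cellv_coarser mn _; exact: cellv_flip. Qed.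

Lemma sgn_bit_flip_lt m n x : (m < n)%N -> sgn_bit m (flip n x) = sgn_bit m x.
Proof.
by move=> mn; rewrite /sgn_bit (bit_cellv (y := x) (leqnn m.+1))//; exact: cellv_flip_le.
Qed.

Lemma measurable_dfloor q i (z : int) : measurable [set x : V | dfloor q (x ord0 i) = z].
Proof.
have -> : [set x : V | dfloor q (x ord0 i) = z] =
    (fun x : V => x ord0 i) @^-1` `[z%:~R / 2 ^+ q, (z + 1)%:~R / 2 ^+ q[.
  apply/seteqP; split=> x /=; rewrite in_itv/= /dfloor; set t := x ord0 i.
    move=> <-; have /andP[h1 h2] := floor_itv (2 ^+ q * t).
    by rewrite ler_pdivrMr ?exprn_gt0// ltr_pdivlMr ?exprn_gt0// [t * _]mulrC h1 h2.
  rewrite ler_pdivrMr ?exprn_gt0// ltr_pdivlMr ?exprn_gt0// [t * _]mulrC => h.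
  exact: floor_def.
rewrite -[X in measurable X]setTI; apply: measurable_coord => //.
Qed.

Lemma measurable_cell n v : measurable [set x | cellv n x = v].
Proof.
have -> : [set x | cellv n x = v] =
    \bigcap_(i in [set: 'I_D]) [set x : V | dfloor (precision n i) (x ord0 i) = v ord0 i].
  apply/seteqP; split=> x /=; first by move=> <- i _; rewrite mxE.
  by move=> h; apply/rowP => i; rewrite mxE h.
by apply: fin_bigcap_measurable => // i _; exact: measurable_dfloor.
Qed.

Lemma measurable_bit n : measurable [set x | bit n x].
Proof.
pose F (z : int) : set V := if (z %% 2)%Z == 1 then
  [set x : V | dfloor (precision n.+1 (split_coord n)) (x ord0 (split_coord n)) = z] else set0.
have -> : [set x | bit n x] = \bigcup_z F z.
  apply/seteqP; split=> x /=.
    by move=> h; exists (dfloor (precision n.+1 (split_coord n)) (x ord0 (split_coord n))) => //; rewrite /F; move: h; rewrite /bit => ->.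
  by move=> [z _]; rewrite /F; case: ifP => // hz; rewrite /bit /= => ->.
apply: countable_bigcupT_measurable; first exact: countableP.
by move=> z; rewrite /F; case: ifP => _; [exact: measurable_dfloor|exact: measurable0].
Qed.

Lemma measurable_sgn_bit n : measurable_fun [set: V] (sgn_bit n).
Proof.
have -> : sgn_bit n = (fun x => 1 - 2 * \1_[set x | bit n x] x).
  apply/funext => x; rewrite /sgn_bit indicE; case: (boolP (bit n x)) => b.
    by rewrite mem_set//= mulr1; ring.
  by rewrite memNset/=; [rewrite mulr0 subr0|exact/negP].
apply: measurable_funB => //; apply: measurable_funM => //.
by apply/measurable_indicP; exact: measurable_bit.
Qed.

Lemma measurable_flip n : measurable_fun [set: V] (flip n).
Proof.
have -> : flip n = (fun x => x + sgn_bit n x *: step n).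
  by apply/funext => x; rewrite /flip /sgn_bit; case: ifP.
apply/measurable_fun_rVP => i; under eq_fun do rewrite !mxE.
apply: measurable_funD; first exact: measurable_coord.
by apply: measurable_funM => //; exact: measurable_sgn_bit.
Qed.

Lemma bit_step1 n x : bit n (x + 1 *: step n) = ~~ bit n x.
Proof. by have := @bit_step n x 1 (or_introl erefl). Qed.

Lemma bit_stepN1 n x : bit n (x + (-1) *: step n) = ~~ bit n x.
Proof. by have := @bit_step n x (-1) (or_intror erefl). Qed.

Lemma flipE n x : flip n x = if bit n x then x + (-1) *: step n else x + 1 *: step n.
Proof. by rewrite /flip; case: (bit n x). Qed.

(** The preimage of [A] is the disjoint union of two translates of the parts of
    [A] in the upper and the lower halves. *)
Lemma flip_preserving n (A : set V) : measurable A -> pushforward mu (flip n) A = mu A.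
Proof.
move=> mA; pose B := [set x | bit n x]; have mB : measurable B := measurable_bit n.
have mBC : measurable (~` B) by exact: measurableC.
pose S (s : R) (C : set V) : set V := (fun x => x + s *: step n) @^-1` C.
have e (s : R) (C : set V) : measurable C -> mu (S s C) = mu C.
  by move=> mC; exact: (lebesgue_rV_shift (s *: step n) mC).
have m1 : measurable (A `&` B) by exact: measurableI.
have m2 : measurable (A `&` ~` B) by exact: measurableI.
rewrite [RHS](measureDI mu mA mB) [RHS]addeC setDE.
have ms (s : R) (C : set V) : measurable C -> measurable (S s C).
  by move=> mC; rewrite -[X in measurable X]setTI; exact: (measurable_rV_shift (s *: step n)).
apply: etrans _ (congr2 adde (e 1 _ m1) (e (-1) _ m2)).
have dis : S 1 (A `&` B) `&` S (-1) (A `&` ~` B) = set0.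
  apply/seteqP; split=> x // [[_ h1] [_ h2]]; move: h1 h2.
  by rewrite /B /mkset /setC /mkset bit_step1 bit_stepN1; case: bit.
apply: etrans _ (measureU mu (ms 1 _ m1) (ms (-1) _ m2) dis).
congr (mu _); apply/seteqP; split=> x.
  rewrite /preimage /mkset flipE; case: ifP => h Ax; [right|left]; split => //.
    by rewrite /B /setC /mkset bit_stepN1 h.
  by rewrite /B /mkset bit_step1 h.
rewrite /preimage /mkset flipE => -[|] [Ax]; rewrite /B /setC /mkset.
  by rewrite bit_step1 => /negbTE ->.
by rewrite bit_stepN1 => /negP; rewrite negbK => ->.
Qed.

Lemma precision0 i : precision 0 i = 0%N. Proof. by rewrite /precision big_ord0. Qed.

Lemma measure_unit_cell v : mu [set x | cellv 0 x = v] = 1%E.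
Proof.
have -> : [set x | cellv 0 x = v] =
    [set x : V | forall i, `[(v ord0 i)%:~R, (v ord0 i + 1)%:~R[%classic (x ord0 i)].
  apply/seteqP; split=> x /=.
    move=> <- i; rewrite mxE /= in_itv/= precision0 /dfloor expr0 mul1r; exact: floor_itv.
  move=> h; apply/rowP => i; rewrite mxE precision0 /dfloor expr0 mul1r; apply: floor_def.
  by have := h i; rewrite /= in_itv.
rewrite (@lebesgue_rV_box R D (fun i => `[(v ord0 i)%:~R, (v ord0 i + 1)%:~R[%classic))// big1// => i _.
by rewrite lebesgue_measure_itv/= lte_fin ltr_int ltzD1 lexx -EFinB -intrB addrAC subrr add0r.
Qed.

Lemma measure_cell_le1 n v : (mu [set x | cellv n x = v] <= 1)%E.
Proof.
have [[x0 hx0]|none] := pselect (exists x, cellv n x = v); last first.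
  rewrite (_ : [set _ | _] = set0) ?measure0//.
  by apply/seteqP; split=> x //= hx; apply: none; exists x.
rewrite -(measure_unit_cell (cellv 0 x0)).
apply: le_measure; rewrite ?inE; [exact: measurable_cell|exact: measurable_cell|].
by move=> x /= hx; apply: (@cellv_coarser 0 n) => //; rewrite hx hx0.
Qed.

Lemma unit_cell_norm v x : cellv 0 x = v -> `|x - \row_i (v ord0 i)%:~R| <= 1.
Proof.
move=> <-; rewrite -[X in X <= _]/(mx_norm _) mx_normrE; apply/bigmax_leP; split=> //= -[i0 i] _ /=.
rewrite !mxE ord1 precision0 /dfloor expr0 mul1r.
have /andP[h1 h2] := floor_itv (x ord0 i); rewrite intrD in h2.
rewrite ger0_norm ?subr_ge0// lerBlDr; lra.
Qed.

End dyadic_cells.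

(** * Martingale transforms and the Haar system *)

Section pow_integrable.
Context d (T : measurableType d) (R : realType).
Variables (mu : {measure set T -> \bar R}) (r : R).
Hypothesis r0 : 0 < r.

Definition pow_integrable (f : T -> R) :=
  measurable_fun [set: T] f /\
  mu.-integrable [set: T] (EFin \o (fun x => `|f x| `^ r)).

Lemma measurable_abs_powR (f : T -> R) s : measurable_fun [set: T] f ->
  measurable_fun [set: T] (fun x => `|f x| `^ s).
Proof.
move=> mf; apply: (@measurableT_comp _ _ _ _ _ _ (@powR R ^~ s)).
  exact: measurable_powR.
exact: measurableT_comp.
Qed.

Lemma measurable_abs_pow (f : T -> R) : measurable_fun [set: T] f ->
  measurable_fun [set: T] (fun x => (`|f x| `^ r)%:E).
Proof. by move=> mf; apply/measurable_EFinP; exact: measurable_abs_powR. Qed.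

(** The sum is at most twice the larger number. *)
Lemma powR_addr_le (a b : R) : 0 <= a -> 0 <= b ->
  (a + b) `^ r <= 2 `^ r * (a `^ r + b `^ r).
Proof.
move=> a0 b0; have h c : 0 <= c -> a + b <= 2 * c -> (a + b) `^ r <= 2 `^ r * c `^ r.
  move=> c0 h; rewrite -powRM//; apply: ge0_ler_powR => //; first exact: ltW.
  - by rewrite nnegrE addr_ge0.
  - by rewrite nnegrE mulr_ge0.
have [ab|/ltW ab] := leP a b.
  apply: le_trans (h b b0 _) _; first by rewrite mulr_natl mulr2n lerD2r.
  by rewrite ler_wpM2l ?powR_ge0// lerDr powR_ge0.
apply: le_trans (h a a0 _) _; first by rewrite mulr_natl mulr2n lerD2l.
by rewrite ler_wpM2l ?powR_ge0// lerDl powR_ge0.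
Qed.

Lemma pow_integrable_sum2 (C : R) (f g : T -> R) :
  pow_integrable f -> pow_integrable g ->
  mu.-integrable [set: T] (EFin \o (fun x => C * (`|f x| + `|g x|) `^ r)).
Proof.
move=> [mf If] [mg Ig].
have I := integrableZl measurableT (`|C| * 2 `^ r) (integrableD measurableT If Ig).
apply: le_integrable I => //.
  apply/measurable_EFinP; apply: measurable_funM => //.
  apply: (@measurableT_comp _ _ _ _ _ _ (@powR R ^~ r)); first exact: measurable_powR.
  by apply: measurable_funD; exact: measurableT_comp.
move=> x _ /=; rewrite lee_fin !normrM normr_id -mulrA ler_wpM2l//.
rewrite (ger0_norm (powR_ge0 _ _)) (ger0_norm (powR_ge0 _ _)).
by rewrite [X in _ <= _ * X]ger0_norm ?addr_ge0 ?powR_ge0//; exact: powR_addr_le.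
Qed.

Lemma pow_integral_le_add (f g h : T -> R) :
  pow_integrable f -> pow_integrable g -> pow_integrable h ->
  (forall x, `|h x| <= `|f x| + `|g x|) ->
  (\int[mu]_x (`|h x| `^ r)%:E <=
   (2 `^ r)%:E * (\int[mu]_x (`|f x| `^ r)%:E + \int[mu]_x (`|g x| `^ r)%:E))%E.
Proof.
move=> [mf _] [mg _] [mh _] hle; rewrite -ge0_integralD//; last 2 first.
- exact: measurable_abs_pow.
- exact: measurable_abs_pow.
rewrite -ge0_integralZl//; last 2 first.
- by apply: emeasurable_funD; exact: measurable_abs_pow.
- by move=> x _; rewrite adde_ge0// lee_fin powR_ge0.
apply: ge0_le_integral => //.
- exact: measurable_abs_pow.
- by apply: measurable_funeM; apply: emeasurable_funD; exact: measurable_abs_pow.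
move=> x _; rewrite -EFinD -EFinM lee_fin.
apply: le_trans (powR_addr_le (normr_ge0 _) (normr_ge0 _)).
apply: ge0_ler_powR (hle x); first exact: ltW.
- by rewrite nnegrE.
- by rewrite nnegrE addr_ge0.
Qed.

Lemma pow_integrable0 : pow_integrable (fun=> 0).
Proof.
split=> //; have -> : EFin \o (fun x : T => `|0 : R| `^ r) = cst 0%E.
  by apply/funext => x /=; rewrite normr0 powR0 ?gt_eqF.
exact: integrable0.
Qed.

Lemma pow_integrableD (f g : T -> R) :
  pow_integrable f -> pow_integrable g -> pow_integrable (fun x => f x + g x).
Proof.
move=> hf hg; have I := pow_integrable_sum2 1 hf hg.
have mfg := measurable_funD hf.1 hg.1; split=> //.
apply: le_integrable I => //.
  exact: measurable_abs_pow.
move=> x _ /=; rewrite lee_fin mul1r !(ger0_norm (powR_ge0 _ _)).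
apply: ge0_ler_powR (ler_normD _ _); first exact: ltW.
- by rewrite nnegrE.
- by rewrite nnegrE addr_ge0.
Qed.

Lemma pow_integrableZ (a : R) (f : T -> R) :
  pow_integrable f -> pow_integrable (fun x => a * f x).
Proof.
move=> [mf If]; split; first exact: measurable_funM.
apply: eq_integrable (integrableZl measurableT (`|a| `^ r) If) => // x _ /=.
by rewrite normrM powRM.
Qed.

Lemma pow_integrable_sum (I : Type) (s : seq I) (P : pred I) (f : I -> T -> R) :
  (forall i, pow_integrable (f i)) ->
  pow_integrable (fun x => \sum_(i <- s | P i) f i x).
Proof.
move=> hf; elim: s => [|i s IH].
  by under eq_fun do rewrite big_nil; exact: pow_integrable0.
under eq_fun do rewrite big_cons; case: (P i) => //.
exact: pow_integrableD.
Qed.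

End pow_integrable.

Section martingale_transform.
Context d (T : measurableType d) (R : realType).
Variables (mu : {measure set T -> \bar R}) (q : R).
Hypothesis q0 : 0 < q.
Let q20 : 0 < q + 2. Proof. by rewrite addr_gt0. Qed.
Local Notation pint := (pow_integrable mu (q + 2)).

Lemma measurable_burkholder (f g : T -> R) : measurable_fun [set: T] f ->
  measurable_fun [set: T] g -> measurable_fun [set: T] (fun x => burkholder q (f x) (g x)).
Proof.
move=> mf mg.
have mf' : measurable_fun [set: T] (fun x => `|f x|) by exact: measurableT_comp.
have mg' : measurable_fun [set: T] (fun x => `|g x|) by exact: measurableT_comp.
apply: measurable_funM; last by apply: measurable_funB => //; exact: measurable_funM.
apply: measurable_funM => //.
apply: (@measurableT_comp _ _ _ _ _ _ (@powR R ^~ (q + 1))); first exact: measurable_powR.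
exact: measurable_funD.
Qed.

Lemma integrable_burkholder (f g : T -> R) : pint f -> pint g ->
  mu.-integrable [set: T] (EFin \o (fun x => burkholder q (f x) (g x))).
Proof.
move=> hf hg.
have I := pow_integrable_sum2 q20 (2 * (q + 2)) hf hg.
apply: le_integrable I => //.
  by apply/measurable_EFinP; apply: measurable_burkholder; [exact: hf.1|exact: hg.1].
move=> x _ /=; rewrite lee_fin; apply: le_trans (burkholder_bound q0 _ _) _.
exact: ler_norm.
Qed.

Lemma integral_preserving (phi : T -> T) (f : T -> R) :
  measurable_fun [set: T] phi ->
  (forall A, measurable A -> pushforward mu phi A = mu A) ->
  mu.-integrable [set: T] (EFin \o f) ->
  mu.-integrable [set: T] (EFin \o (f \o phi)) ->
  (\int[mu]_x (f (phi x))%:E = \int[mu]_x (f x)%:E)%E.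
Proof.
move=> mphi pres If Ifphi.
rewrite [RHS](eq_measure_integral (pushforward mu phi)); last first.
  by move=> A mA _; rewrite /= pres.
apply/esym; apply: (integral_pushforward mphi (f := EFin \o f) _ _ measurableT).
- by have /integrableP[] := If.
- by rewrite preimage_setT.
Qed.

Lemma integral_nonpositive (f : T -> R) : (forall x, f x <= 0) ->
  (\int[mu]_x (f x)%:E <= 0)%E.
Proof.
move=> f0; have -> : (\int[mu]_x (f x)%:E = - \int[mu]_x (- f x)%:E)%E.
  rewrite -integral_ge0N; first by apply: eq_integral => x _; rewrite EFinN oppeK.
  by move=> x _; rewrite lee_fin oppr_ge0.
by rewrite oppe_le0 integral_ge0// => x _; rewrite lee_fin oppr_ge0.
Qed.

Variables (D D' : nat -> T -> R) (phi : nat -> T -> T).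
Hypothesis pD : forall l, pint (D l).
Hypothesis pD' : forall l, pint (D' l).
Hypothesis DD' : forall l x, D' l x = D l x \/ D' l x = - D l x.
Hypothesis mphi : forall l, measurable_fun [set: T] (phi l).
Hypothesis phi_pres : forall l A, measurable A -> pushforward mu (phi l) A = mu A.
Hypothesis phiD : forall l x, D l.+1 (phi l x) = - D l.+1 x.
Hypothesis phiD' : forall l x, D' l.+1 (phi l x) = - D' l.+1 x.
Hypothesis phiD_lt : forall m l x, (m <= l)%N -> D m (phi l x) = D m x.
Hypothesis phiD'_lt : forall m l x, (m <= l)%N -> D' m (phi l x) = D' m x.

Let S n x := \sum_(l < n) D l x.
Let S' n x := \sum_(l < n) D' l x.

Let pS n : pint (S n). Proof. exact: pow_integrable_sum. Qed.
Let pS' n : pint (S' n). Proof. exact: pow_integrable_sum. Qed.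

(** Invariance of the integral under [phi n] replaces the last difference by
    its mean over both signs, to which [burkholder_step] applies.  The first
    difference has no symmetry, but [burkholder] is nonpositive at the first
    step since there the two arguments have the same modulus. *)
Lemma burkholder_integral_le0 n : (\int[mu]_x (burkholder q (S n x) (S' n x))%:E <= 0)%E.
Proof.
elim: n => [|[_|n IH]].
- apply: integral_nonpositive => x; apply: burkholder_le0 => //.
  by rewrite /S /S' !big_ord0.
- apply: integral_nonpositive => x; apply: burkholder_le0 => //.
  by rewrite /S /S' !big_ord1; case: (DD' 0 x) => ->; rewrite ?normrN.
have I := integrable_burkholder (pS n.+2) (pS' n.+2).
have I1 := integrable_burkholder (pS n.+1) (pS' n.+1).
pose g x := burkholder q (S n.+2 x) (S' n.+2 x).
have gphi x : g (phi n x) = burkholder q (S n.+1 x - D n.+1 x) (S' n.+1 x - D' n.+1 x).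
  rewrite /g /S /S' (big_ord_recr n.+1) [in X in burkholder q _ X](big_ord_recr n.+1) /= phiD phiD'.
  congr burkholder; congr (_ - _); apply: eq_bigr => l _.
    by apply: phiD_lt; rewrite -ltnS.
  by apply: phiD'_lt; rewrite -ltnS.
have N1 : pint (fun x => -1 * D n.+1 x) by exact: pow_integrableZ.
have N2 : pint (fun x => -1 * D' n.+1 x) by exact: pow_integrableZ.
have Iphi : mu.-integrable [set: T] (EFin \o (g \o phi n)).
  have := integrable_burkholder (pow_integrableD q20 (pS n.+1) N1) (pow_integrableD q20 (pS' n.+1) N2).
  by apply: eq_integrable => // x _ /=; rewrite gphi !mulN1r.
have e := integral_preserving (mphi n) (@phi_pres n) I Iphi.
have h : (\int[mu]_x (g x)%:E + \int[mu]_x (g (phi n x))%:E <=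
          2%:E * \int[mu]_x (burkholder q (S n.+1 x) (S' n.+1 x))%:E)%E.
  rewrite -(integralD measurableT I Iphi) -(integralZl measurableT I1).
  apply: le_integral => //.
  - exact: integrableD.
  - exact: integrableZl.
  move=> x _ /=; rewrite -EFinD -EFinM lee_fin gphi /g /S /S'.
  rewrite [in X in burkholder _ X _ + _](big_ord_recr n.+1) [in X in burkholder _ _ X + _](big_ord_recr n.+1) /=.
  exact: burkholder_step.
rewrite e -/g in h.
have fin : (\int[mu]_x (g x)%:E)%E \is a fin_num by exact: integrable_fin_num.
move: h; rewrite -(fineK fin) => h.
have {h} : ((fine (\int[mu]_x (g x)%:E) + fine (\int[mu]_x (g x)%:E))%:E <= 0)%E.
  by rewrite EFinD; apply: le_trans h _; rewrite mule_ge0_le0.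
rewrite !lee_fin; lra.
Qed.

(** [D l] are the martingale differences and [D' l] their transforms by signs.
    The map [phi l] plays the role of a conditional expectation: it fixes the
    differences up to [l] and changes the sign of the next one. *)
Lemma martingale_transform n :
  (\int[mu]_x (`|S' n x| `^ (q + 2))%:E <=
   (burkholder_cst q)%:E * \int[mu]_x (`|S n x| `^ (q + 2))%:E)%E.
Proof.
have I := integrable_burkholder (pS n) (pS' n).
have IS := integrableZl measurableT (burkholder_cst q) (pS n).2.
apply: (@le_trans _ _ (\int[mu]_x ((burkholder q (S n x) (S' n x))%:E +
    (burkholder_cst q)%:E * (`|S n x| `^ (q + 2))%:E))%E).
  apply: le_integral => //.
  - exact: (pS' n).2.
  - exact: (integrableD measurableT I IS).
  - by move=> x _; rewrite -EFinM -EFinD lee_fin; exact: burkholder_lower.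
rewrite (integralD measurableT I IS) (integralZl measurableT (pS n).2).
rewrite -[leRHS]add0e leeD//; exact: burkholder_integral_le0.
Qed.

End martingale_transform.

Section haar.
Context (R : realType) (d' : nat).
Local Notation D := d'.+1.
Local Notation V := 'rV[R]_D.
Local Notation mu := (lebesgue_rV R D).
Implicit Types (x : V).

(** The node [(0, v)] carries the indicator of the unit cell [v]; the node
    [(l.+1, v)] the difference of the indicators of the two halves of the
    cell [v] of level [l]. *)
Definition haar_node (n : nat * 'rV[int]_D) x : R :=
  (cellv n.1.-1 x == n.2)%:R * (if n.1 is l.+1 then sgn_bit l x else 1).

(** [pickle_inv] numbers each node exactly once; the remaining indices carry
    the function [0]. *)
Definition haar (j : nat) x : R :=
  if (pickle_inv j : option (nat * 'rV[int]_D)) is Some n then haar_node n x else 0.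

Definition haar_level (j : nat) : nat :=
  if (pickle_inv j : option (nat * 'rV[int]_D)) is Some n then n.1 else 0.

Definition haar_cell (j : nat) : set V :=
  if (pickle_inv j : option (nat * 'rV[int]_D)) is Some n
  then [set x | cellv n.1.-1 x = n.2] else set0.

Lemma haar_pickle n x : haar (pickle n) x = haar_node n x.
Proof. by rewrite /haar pickleK_inv. Qed.

Lemma in_set_eq (U W : eqType) (f : U -> W) (w : W) (u : U) :
  (u \in [set z | f z = w]) = (f u == w).
Proof. by apply/idP/eqP => [|h]; rewrite inE. Qed.

Lemma sgn_bitP l x : sgn_bit l x = 1 \/ sgn_bit l x = -1.
Proof. by rewrite /sgn_bit; case: bit; [right|left]. Qed.

Lemma abs_haar j x : `|haar j x| = \1_(haar_cell j) x.
Proof.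
rewrite /haar /haar_cell; case: pickle_inv => [[l v]|]; last first.
  by rewrite normr0 indicE in_set0.
rewrite /haar_node /= normrM indicE.
have -> : `|if l is l0.+1 then sgn_bit l0 x else 1 : R| = 1.
  case: l => [|l]; first by rewrite normr1.
  by case: (sgn_bitP l x) => ->; rewrite ?normrN normr1.
rewrite mulr1 normr_nat; by rewrite in_set_eq.
Qed.

Lemma measurable_haar_cell j : measurable (haar_cell j).
Proof.
rewrite /haar_cell; case: pickle_inv => [n|]; last exact: measurable0.
exact: measurable_cell.
Qed.

Lemma haar_cell_le1 j : (mu (haar_cell j) <= 1)%E.
Proof.
rewrite /haar_cell; case: pickle_inv => [n|]; last by rewrite measure0.
exact: measure_cell_le1.
Qed.

Lemma measurable_haar j : measurable_fun [set: V] (haar j).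
Proof.
rewrite /haar; case: pickle_inv => [[l v]|]; last exact: measurable_cst.
apply: measurable_funM => /=.
  have -> : (fun x => (cellv l.-1 x == v)%:R : R) = \1_[set x | cellv l.-1 x = v].
    apply/funext => x; rewrite indicE; by rewrite in_set_eq.
  by apply/measurable_indicP; exact: measurable_cell.
by case: l => [|l]; [exact: measurable_cst|exact: measurable_sgn_bit].
Qed.

Lemma integral_haar_pow (r : R) j : 0 < r ->
  (\int[mu]_x (`|haar j x| `^ r)%:E = mu (haar_cell j))%E.
Proof.
move=> r0; transitivity (\int[mu]_x (\1_(haar_cell j) x)%:E)%E; last first.
  by rewrite integral_indic// ?setIT//; exact: measurable_haar_cell.
apply: eq_integral => x _; rewrite abs_haar indicE; case: (_ \in _) => //=.
  by rewrite powR1.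
by rewrite powR0// gt_eqF.
Qed.

Lemma pow_integrable_haar (r : R) j : 0 < r -> pow_integrable mu r (haar j).
Proof.
move=> r0; split; first exact: measurable_haar.
apply/integrableP; split.
  by apply/measurable_EFinP; apply: measurable_abs_powR; exact: measurable_haar.
rewrite (_ : (fun x => `|_|%E) = (fun x => (`|haar j x| `^ r)%:E)); last first.
  by apply/funext => x /=; rewrite ger0_norm// powR_ge0.
by rewrite integral_haar_pow// (le_lt_trans (haar_cell_le1 j))// ltry.
Qed.

Lemma haar_flip j l x : haar_level j = l.+1 -> haar j (flip l x) = - haar j x.
Proof.
rewrite /haar_level /haar; case: pickle_inv => [[m v]|] //= ->.
by rewrite /haar_node /= cellv_flip sgn_bit_flip mulrN.
Qed.

Lemma haar_flip_lt j l x : (haar_level j <= l)%N -> haar j (flip l x) = haar j x.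
Proof.
rewrite /haar_level /haar; case: pickle_inv => [[m v]|] //= ml.
rewrite /haar_node /= cellv_flip_le; last exact: leq_trans (leq_pred _) ml.
by case: m ml => // m ml; rewrite sgn_bit_flip_lt.
Qed.

(** At a given point and level only one Haar function is nonzero, so a change
    of signs multiplies the whole martingale difference by a sign. *)
Lemma haar_level_sign (eps a : nat -> R) n l x :
  (forall j, eps j = 1 \/ eps j = -1) ->
  let s := \sum_(j < n | haar_level j == l) a j * haar j x in
  let s' := \sum_(j < n | haar_level j == l) eps j * a j * haar j x in
  s' = s \/ s' = - s.
Proof.
move=> he s s'.
pose j0 := pickle (l, cellv l.-1 x).
have h j : haar_level j == l -> eps j * a j * haar j x = eps j0 * (a j * haar j x).
  move=> /eqP; rewrite /haar_level /haar; case E: pickle_inv => [[m v]|]; last first.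
    by rewrite !mulr0.
  move=> /= ml; rewrite /haar_node /= ml; case: eqP => [cv|]; last by rewrite mul0r !mulr0.
  have -> : j = j0 by rewrite /j0 cv -ml; have := @pickle_invK (nat * 'rV[int]_D)%type j; rewrite E.
  by rewrite !mulrA.
have -> : s' = eps j0 * s by rewrite /s' /s mulr_sumr; apply: eq_bigr => j; exact: h.
by case: (he j0) => ->; [left; rewrite mul1r|right; rewrite mulN1r].
Qed.

Lemma haar_sum_levels (a : nat -> R) n x :
  \sum_(j < n) a j * haar j x =
  \sum_(l < (\max_(j < n) haar_level j).+1) \sum_(j < n | haar_level j == l) a j * haar j x.
Proof.
rewrite (partition_big (fun j : 'I_n => inord (haar_level j) : 'I_(\max_(j < n) haar_level j).+1) predT)//=.
apply: eq_bigr => l _; apply: eq_bigl => j; rewrite -val_eqE /= inordK//.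
by rewrite ltnS (leq_bigmax j).
Qed.

(** Grouped by levels, the sum is a martingale that starts at the unit cells,
    and the exchange of halves [flip] provides the symmetries. *)
Lemma haar_unconditional (q : R) (eps a : nat -> R) n : 0 < q ->
  (forall j, eps j = 1 \/ eps j = -1) ->
  (\int[mu]_x (`|\sum_(j < n) eps j * a j * haar j x| `^ (q + 2))%:E <=
   (burkholder_cst q)%:E * \int[mu]_x (`|\sum_(j < n) a j * haar j x| `^ (q + 2))%:E)%E.
Proof.
move=> q0 he.
pose Df (b : nat -> R) l x := \sum_(j < n | haar_level j == l) b j * haar j x.
pose ea j := eps j * a j.
have pint b l : pow_integrable mu (q + 2) (Df b l).
  apply: pow_integrable_sum => [|j]; first by rewrite addr_gt0.
  by apply: pow_integrableZ => //; apply: pow_integrable_haar; rewrite addr_gt0.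
have phi1 b l x : Df b l.+1 (flip l x) = - Df b l.+1 x.
  by rewrite -sumrN; apply: eq_bigr => j /eqP jl; rewrite haar_flip// mulrN.
have phi2 b m l x : (m <= l)%N -> Df b m (flip l x) = Df b m x.
  by move=> ml; apply: eq_bigr => j /eqP jl; rewrite haar_flip_lt// jl.
have := @martingale_transform _ V R mu q q0 (Df a) (Df ea) (fun l => flip l)
  (pint a) (pint ea) (fun l x => haar_level_sign a n l x he) (@measurable_flip R d')
  (@flip_preserving R d') (phi1 a) (phi1 ea) (phi2 a) (phi2 ea)
  (\max_(j < n) haar_level j).+1.
under eq_integral do rewrite -(haar_sum_levels ea).
by under [X in (_ <= _ * X)%E -> _]eq_integral do rewrite -(haar_sum_levels a).
Qed.

End haar.

(** * The Haar functions span a dense subspace *)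

Section cells_generate.
Context (R : realType) (d' : nat).
Local Notation D := d'.+1.
Local Notation V := 'rV[R]_D.
Implicit Types (x : V).

Definition cell n (v : 'rV[int]_D) : set V := [set x | cellv n x = v].

(** The empty set is included to make the family closed under intersection. *)
Definition cells : set (set V) := [set A | A = set0 \/ exists n v, A = cell n v].

(** Two cells are disjoint, or one contains the other. *)
Lemma cells_setI_closed : setI_closed cells.
Proof.
have sub m n v w : (m <= n)%N -> cells (cell m v `&` cell n w).
  move=> mn; have [[x0 [h1 h2]]|none] := pselect (exists x, cell m v x /\ cell n w x).
    right; exists n, w; apply/seteqP; split=> [x []//|x xw]; split => //.
    rewrite /cell/= -h1; apply: cellv_coarser mn _.
    by rewrite (xw : cellv n x = w) (h2 : cellv n x0 = w).
  by left; apply/seteqP; split=> x // [h1 h2]; apply: none; exists x.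
move=> A B [->|[m [v ->]]]; first by rewrite set0I; left.
move=> [->|[n [w ->]]]; first by rewrite setI0; left.
have [mn|/ltnW nm] := leqP m n; first exact: sub.
by rewrite setIC; exact: sub.
Qed.

(** The half-space of the points whose [i]-th coordinate is less than [c] is the
    union of the cells that it contains, of which there are countably many. *)
Lemma measurable_cells : @measurable _ V = <<s cells >>.
Proof.
apply/seteqP; split=> [A mA|]; last first.
  apply: smallest_sub; first exact: sigma_algebra_measurable.
  by move=> _ [->|[n [v ->]]]; [exact: measurable0|exact: measurable_cell].
have mid : measurable_fun [set: g_sigma_algebraType cells] (id : g_sigma_algebraType cells -> V).
  apply/measurable_fun_rVP => i.
  apply: (measurability _ (RGenInftyO.measurableE R)) => //.
  move=> _ [_ [c ->] <-]; rewrite setTI.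
  pose F (nv : nat * 'rV[int]_D) : set V :=
    if (nv.2 ord0 i + 1)%:~R <= 2 ^+ precision nv.1 i * c then cell nv.1 nv.2 else set0.
  have -> : (fun x : V => x ord0 i) @^-1` `]-oo, c[%classic = \bigcup_nv F nv.
    apply/seteqP; split=> x /=; rewrite in_itv/=.
      move=> xc; have cx : 0 < c - x ord0 i by rewrite subr_gt0.
      have [m hm] : exists m : nat, (c - x ord0 i)^-1 <= 2 ^+ m.
        (* Cells this fine around [x] have width less than [c - x ord0 i]. *)
        exists (Num.bound (c - x ord0 i)^-1).
        apply: le_trans (ltW (archi_boundP _)) _; first by rewrite invr_ge0 ltW.
        by rewrite -natrX ler_nat ltnW// ltn_expl.
      have [n hn] := precision_unbounded i m.
      exists (n, cellv n x) => //; rewrite /F /= ifT// mxE.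
      have := floor_itv (2 ^+ precision n i * x ord0 i); rewrite /dfloor => /andP[h _].
      rewrite intrD; apply: le_trans (lerD h (lexx _)) _.
      rewrite -lerBrDl -mulrBr -ler_pdivrMr//.
      rewrite mul1r; apply: le_trans hm _; apply: ler_weXn2l => //; exact: ler1n.
    move=> [[n v] _]; rewrite /F /=; case: ifP => // hc; rewrite /cell /= => cx; move: hc; rewrite -cx.
    rewrite mxE => hc.
    have := floor_itv (2 ^+ precision n i * x ord0 i) => /andP[_ h].
    by have := lt_le_trans h hc; rewrite ltr_pM2l// exprn_gt0.
  apply: countable_bigcupT_measurable; first exact: countableP.
  move=> nv; rewrite /F; case: ifP => _; last exact: measurable0.
  by apply: sub_sigma_algebra; right; exists nv.1, nv.2.
by have := mid measurableT A mA; rewrite setTI.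
Qed.

End cells_generate.

Section haar_span.
Context (R : realType) (d' : nat) (r : R).
Hypothesis r0 : 0 < r.
Local Notation D := d'.+1.
Local Notation V := 'rV[R]_D.
Local Notation mu := (lebesgue_rV R D).
Local Notation pint := (pow_integrable mu r).
Local Notation N f := (\int[mu]_x (`|f x| `^ r)%:E)%E.
Implicit Types (f g : V -> R).

Definition haar_sum n (a : nat -> R) (x : V) : R := \sum_(j < n) a j * haar j x.

(** The closed span of the Haar functions for convergence in the mean of order
    [r]. *)
Definition spanned f := pint f /\ forall eps : R, 0 < eps ->
  exists n a, (N (fun x => f x - haar_sum n a x)%R <= eps%:E)%E.

Lemma pow_integrable_haar_sum n a : pint (haar_sum n a).
Proof.
by apply: pow_integrable_sum => // j; apply: pow_integrableZ => //; exact: pow_integrable_haar.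
Qed.

Lemma pow_integrableB f g : pint f -> pint g -> pint (fun x => f x - g x).
Proof.
move=> hf hg; have := pow_integrableD r0 hf (pow_integrableZ (-1) hg).
by under eq_fun do rewrite mulN1r.
Qed.

Lemma haar_sum_widen n m a : (n <= m)%N ->
  haar_sum n a = haar_sum m (fun j => if (j < n)%N then a j else 0).
Proof.
move=> nm; apply/funext => x; rewrite /haar_sum.
rewrite (big_ord_widen m (fun j => a j * haar j x) nm) big_mkcond.
by apply: eq_bigr => j _; case: ifP => //; rewrite mul0r.
Qed.

Lemma spanned_lim f (h : nat -> V -> R) : pint f -> (forall n, spanned (h n)) ->
  (forall eps : R, 0 < eps -> exists n, (N (fun x => f x - h n x)%R <= eps%:E)%E) ->
  spanned f.
Proof.
move=> pf hs hlim; split=> // eps e0.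
have c0 : 0 < 2 `^ r * 2 :> R by rewrite mulr_gt0// powR_gt0.
have e1 : 0 < eps / (2 `^ r * 2) by rewrite divr_gt0.
have [n hn] := hlim _ e1; have [ph /(_ _ e1)[m [a ha]]] := hs n.
exists m, a; apply: le_trans (pow_integral_le_add r0 (f := fun x => f x - h n x)
  (g := fun x => h n x - haar_sum m a x) _ _ _ _) _.
- exact: pow_integrableB.
- by apply: pow_integrableB => //; exact: pow_integrable_haar_sum.
- by apply: pow_integrableB => //; exact: pow_integrable_haar_sum.
- by move=> x; apply: le_trans (ler_normD _ _); rewrite addrA subrK.
apply: le_trans (lee_wpmul2l _ (leeD hn ha)) _; first by rewrite lee_fin powR_ge0.
rewrite -EFinD -EFinM lee_fin le_eqVlt; apply/orP; left; apply/eqP.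
by field; rewrite gt_eqF// powR_gt0.
Qed.

Lemma spannedD f g : spanned f -> spanned g -> spanned (fun x => f x + g x).
Proof.
move=> [pf hf] [pg hg]; split; first exact: pow_integrableD.
move=> eps e0.
have c0 : 0 < 2 `^ r * 2 :> R by rewrite mulr_gt0// powR_gt0.
have e1 : 0 < eps / (2 `^ r * 2) by rewrite divr_gt0.
have [n [a ha]] := hf _ e1; have [m [b hb]] := hg _ e1.
pose t c n j : R := if (j < n)%N then c j else 0.
exists (maxn n m), (fun j => t a n j + t b m j).
have e x : haar_sum (maxn n m) (fun j => t a n j + t b m j) x = haar_sum n a x + haar_sum m b x.
  rewrite (haar_sum_widen a (leq_maxl n m)) (haar_sum_widen b (leq_maxr n m)) /haar_sum -big_split.
  by apply: eq_bigr => j _; rewrite /= mulrDl.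
apply: le_trans (pow_integral_le_add r0 (f := fun x => f x - haar_sum n a x)
  (g := fun x => g x - haar_sum m b x) _ _ _ _) _.
- by apply: pow_integrableB => //; exact: pow_integrable_haar_sum.
- by apply: pow_integrableB => //; exact: pow_integrable_haar_sum.
- by apply: pow_integrableB; [exact: pow_integrableD|exact: pow_integrable_haar_sum].
- move=> x; apply: le_trans (ler_normD _ _); rewrite e le_eqVlt; apply/orP; left.
  by apply/eqP; congr `| _ |; ring.
apply: le_trans (lee_wpmul2l _ (leeD ha hb)) _; first by rewrite lee_fin powR_ge0.
rewrite -EFinD -EFinM lee_fin le_eqVlt; apply/orP; left; apply/eqP.
by field; rewrite gt_eqF// powR_gt0.
Qed.

Lemma spanned_haar_sum n a : spanned (haar_sum n a).
Proof.
split; first exact: pow_integrable_haar_sum.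
move=> eps e0; exists n, a; rewrite integral0_eq ?lee_fin ?ltW// => x _.
by rewrite subrr normr0 powR0// gt_eqF.
Qed.

Lemma spanned_haar j : spanned (haar j).
Proof.
have -> : haar j = haar_sum j.+1 (fun i => (i == j)%:R); last exact: spanned_haar_sum.
apply/funext => x; rewrite /haar_sum big_ord_recr/= eqxx mul1r big1 ?add0r// => i _.
by rewrite ltn_eqF// mul0r.
Qed.

Lemma spanned0 : spanned (fun=> 0).
Proof.
have -> : (fun=> 0) = haar_sum 0 (fun=> 0); last exact: spanned_haar_sum.
by apply/funext => x; rewrite /haar_sum big_ord0.
Qed.

Lemma spannedZ c f : spanned f -> spanned (fun x => c * f x).
Proof.
move=> [pf hf]; split; first exact: pow_integrableZ.
move=> eps e0; have c0 : 0 < `|c| `^ r + 1 by rewrite ltr_pwDr// powR_ge0.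
have [n [a ha]] := hf _ (divr_gt0 e0 c0); exists n, (fun j => c * a j).
have -> : (N (fun x => c * f x - haar_sum n (fun j => c * a j)%R x)%R =
   (`|c| `^ r)%:E * N (fun x => f x - haar_sum n a x)%R)%E.
  rewrite -ge0_integralZl//; last first.
    apply: measurable_abs_pow; apply: (proj1 (pow_integrableB pf _)); exact: pow_integrable_haar_sum.
  apply: eq_integral => x _; rewrite -EFinM -powRM// -normrM mulrBr; congr (`|_ - _| `^ r)%:E.
  by rewrite /haar_sum mulr_sumr; apply: eq_bigr => j _; rewrite mulrA.
apply: le_trans (lee_wpmul2l _ ha) _; first by rewrite lee_fin powR_ge0.
rewrite -EFinM lee_fin mulrA ler_pdivrMr// mulrC ler_wpM2l ?(ltW e0)// lerDl//.
Qed.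

Lemma spanned_sum (I : Type) (s : seq I) (h : I -> V -> R) :
  (forall i, spanned (h i)) -> spanned (fun x => \sum_(i <- s) h i x).
Proof.
move=> hh; elim: s => [|i s IH].
  by under eq_fun do rewrite big_nil; exact: spanned0.
have -> : (fun x => \sum_(i <- i :: s) h i x) = (fun x => h i x + \sum_(i <- s) h i x).
  by apply/funext => x; rewrite big_cons.
exact: (@spannedD (h i) (fun x => \sum_(i <- s) h i x) (hh i) IH).
Qed.

(** Dominated convergence in the mean of order [r]. *)
Lemma spanned_dominated f g (h : nat -> V -> R) : (forall n, spanned (h n)) ->
  measurable_fun [set: V] f -> pint g ->
  (forall x, h n x @[n --> \oo] --> f x) -> (forall n x, `|h n x| <= `|g x|) ->
  spanned f.
Proof.
move=> hs mf pg hf hg.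
have fg x : `|f x| <= `|g x|.
  have : `|h n x| @[n --> \oo] --> `|f x| by apply: cvg_norm; exact: hf.
  by move=> /cvg_lim <-//; apply: limr_le; [apply: is_cvg_norm; apply/cvg_ex; exists (f x)|
    apply: nearW => n; exact: hg].
have pow_le (u v : R) : `|u| <= `|v| -> `|u| `^ r <= `|v| `^ r.
  by move=> uv; apply: ge0_ler_powR uv; [exact: ltW|rewrite nnegrE|rewrite nnegrE].
have pf : pint f.
  split=> //; apply: le_integrable pg.2 => //.
    by apply/measurable_EFinP; exact: measurable_abs_powR.
  by move=> x _ /=; rewrite lee_fin !(ger0_norm (powR_ge0 _ _)) pow_le.
apply: (spanned_lim pf hs) => eps e0.
have mfh n : pint (fun x => f x - h n x) by apply: pow_integrableB => //; exact: (hs n).1.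
have dc := @dominated_convergence _ V R mu setT measurableT
  (fun n x => (`|f x - h n x| `^ r)%:E) (cst 0%E) (fun x => (`|2 * g x| `^ r)%:E)
  (fun n => measurable_abs_pow r (mfh n).1) (measurable_cst _).
have : (N (fun x => f x - h n x)%R) @[n --> \oo] --> (0 : \bar R).
  rewrite -(integral0 mu setT); case: (fun H1 H2 => dc H1 (pow_integrableZ 2 pg).2 H2) => //.
  - apply: aeW => x _.
    have -> : (cst 0 x : \bar R) = (0 `^ r : R)%:E by rewrite /= powR0// gt_eqF.
    apply: cvg_EFin; first exact: nearW.
    apply: cvg_powR => //.
    rewrite -(normr0 R) -(subrr (f x)); apply: cvg_norm; apply: cvgB => //; exact: cvg_cst.
  - apply: aeW => x n _; rewrite gee0_abs ?lee_fin ?powR_ge0//.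
    apply: pow_le; rewrite normrM ger0_norm// mulr_natl mulr2n.
    by apply: le_trans (ler_normB _ _) _; rewrite lerD.
move=> /fine_cvgP[fin /cvgrPdist_le/(_ eps e0)[m _ hm]].
have [m' _ hm'] := fin.
exists (maxn m m'); have := hm _ (leq_maxl m m'); rewrite /= sub0r normrN => h1.
rewrite -(fineK (hm' _ (leq_maxr m m'))) lee_fin; exact: le_trans (ler_norm _) h1.
Qed.

Lemma haar_halves n (x v : V) : cellv n x = cellv n v ->
  (cellv n.+1 x == cellv n.+1 v) = (bit n x == bit n v).
Proof.
move=> h; apply/eqP/eqP => [e|e]; first exact: bit_cellv e.
apply/cellvP => i; have /cellvP/(_ i) := h; rewrite precisionS; case: eqP => [ci|_]; last by rewrite addn0.
have e1 : precision n.+1 i = (precision n i).+1 by rewrite precisionS ci eqxx addn1.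
move: e; rewrite /bit ci e1 addn1 => e.
rewrite !(dfloor_half (precision n i)) => e2.
have := divz_eq (dfloor (precision n i).+1 (x ord0 i)) 2.
have := divz_eq (dfloor (precision n i).+1 (v ord0 i)) 2.
by move: e e2; lia.
Qed.

(** Each half of a cell is half the sum, or half the difference, of the cell and
    its Haar function. *)
Lemma spanned_cell n v : spanned \1_(@cell R d' n v).
Proof.
elim: n v => [|n IH] v.
  have -> : \1_(cell 0 v) = haar (pickle (0%N, v)) :> (V -> R); last exact: spanned_haar.
  by apply/funext => x; rewrite haar_pickle /haar_node /= mulr1 indicE in_set_eq.
have [[x0 hx0]|none] := pselect (exists x : V, cellv n.+1 x = v); last first.
  have -> : cell n.+1 v = set0 :> set V; last first.
    by rewrite indic0; exact: spanned0.
  by apply/seteqP; split=> x // xv; apply: none; exists x.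
have -> : \1_(cell n.+1 v) = (fun x => 2^-1 * (\1_(cell n (cellv n x0)) x +
    sgn_bit n x0 * haar (pickle (n.+1, cellv n x0)) x)).
  apply/funext => x; rewrite haar_pickle /haar_node /= !indicE !in_set_eq -hx0.
  have [e|ne] := eqVneq (cellv n x) (cellv n x0).
    rewrite haar_halves// mul1r /sgn_bit.
    by case: (bit n x); case: (bit n x0) => /=; rewrite ?mulr0 ?mulr1 ?mulrN1 ?opprK ?subrr ?mulr0//;
      rewrite -[1 + 1]/(2 : R) mulVf.
  rewrite mul0r mulr0 addr0 mulr0; case: eqP => // e.
  by move: ne; rewrite (cellv_coarser (leqnSn n) e) eqxx.
by apply: spannedZ; apply: spannedD => //; apply: spannedZ; exact: spanned_haar.
Qed.

(** Dynkin's lemma within a unit cell, which has finite measure. *)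
Lemma spanned_indic (A : set V) v : measurable A -> spanned \1_(A `&` cell 0 v).
Proof.
rewrite measurable_cells; pose P (A : set V) := spanned \1_(A `&` cell 0 v).
have mQ : measurable (cell 0 v : set V) by exact: measurable_cell.
apply: (dynkin_induction (P := P) (@measurable_cells R d') (@cells_setI_closed R d')).
- by rewrite /P setTI; exact: spanned_cell.
- move=> B hB; have /(_ B (cell 0 v) hB) : setI_closed (@cells R d') by exact: cells_setI_closed.
  case; first by right; exists 0%N, v.
  + by rewrite /P => ->; rewrite indic0; exact: spanned0.
  + by rewrite /P => -[n [w ->]]; exact: spanned_cell.
- move=> B mB hB; rewrite /P.
  have -> : \1_(~` B `&` cell 0 v) =
      (fun x => \1_(cell 0 v) x + (-1) * \1_(B `&` cell 0 v) x) :> (V -> R).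
    apply/funext => x; rewrite !indicE !in_setI in_setC.
    by case: (x \in B); case: (x \in cell 0 v) => /=; rewrite ?mulr0 ?mulr1 ?addr0 ?subrr.
  by apply: spannedD; [exact: spanned_cell|exact: spannedZ].
move=> F mF tF hF; rewrite /P.
pose S n x : R := \sum_(i < n) \1_(F i `&` cell 0 v) x.
have S1 i x n : (F i `&` cell 0 v) x -> S n x = (i < n)%N%:R.
  move=> Fx; have h j : j != i -> \1_(F j `&` cell 0 v) x = 0 :> R.
    move=> ji; rewrite indicE memNset// => -[Fj _]; move/eqP: ji; apply.
    by apply: (tF j i I I); exists x; split=> //; case: Fx.
  rewrite /S; elim: n => [|n IH]; first by rewrite big_ord0.
  rewrite big_ord_recr /= IH [in RHS]ltnS [in RHS]leq_eqVlt.
  have [e|ne] := eqVneq i n; first by rewrite -e ltnn indicE (mem_set Fx) add0r.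
  by rewrite h 1?eq_sym// addr0.
have S0 x n : ~ (exists i, (F i `&` cell 0 v) x) -> S n x = 0.
  by move=> none; rewrite /S big1// => i _; rewrite indicE memNset// => h; apply: none; exists i.
apply: (@spanned_dominated _ \1_(cell 0 v) S).
- move=> n; exact: (@spanned_sum _ (index_enum 'I_n) (fun i => \1_(F i `&` cell 0 v)) (fun i => hF i)).
- by apply/measurable_indicP/measurableI => //; exact: bigcupT_measurable.
- exact: (spanned_cell 0 v).1.
- move=> x; have [[i Fx]|none] := pselect (exists i, (F i `&` cell 0 v) x).
    apply: cvg_near_cst; exists i.+1 => // n /= ni.
    by rewrite (S1 i)// ni indicE mem_set//; case: Fx => Fi xv; split=> //; exists i.
  apply: cvg_near_cst; apply: nearW => n; rewrite S0// indicE memNset//.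
  by move=> [[i _ Fi] xQ]; apply: none; exists i.
- move=> n x; have [[i Fx]|none] := pselect (exists i, (F i `&` cell 0 v) x).
    by rewrite (S1 i)// indicE mem_set ?normr_nat ?normr1 ?lern1 ?leq_b1//; case: Fx.
  by rewrite S0// normr0.
Qed.

Import HBNNSimple.

Lemma spanned_nnsfun (g : {nnsfun V >-> R}) v :
  spanned (fun x => g x * \1_(cell 0 v) x).
Proof.
have -> : (fun x => g x * \1_(cell 0 v) x) = (fun x =>
    \sum_(y <- finmap.enum_fset (fset_set (range g))) y * \1_(g @^-1` [set y] `&` cell 0 v) x) :> (V -> R).
  apply/funext => x; rewrite fimfunE fsbig_finite//= mulr_suml.
  by apply: eq_bigr => y _; rewrite indicI -mulrA.
apply: spanned_sum => y; apply: spannedZ; apply: spanned_indic.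
by rewrite -[X in measurable X]setTI; exact: measurable_funPT.
Qed.

Definition unit_cell i : set V :=
  if (pickle_inv i : option 'rV[int]_D) is Some v then cell 0 v else set0.

Lemma sum_unit_cells n x :
  \sum_(i < n) \1_(unit_cell i) x = (pickle (cellv 0 x) < n)%N%:R :> R.
Proof.
have h i : i != pickle (cellv 0 x) -> \1_(unit_cell i) x = 0 :> R.
  rewrite /unit_cell; have := @pickle_invK 'rV[int]_D i.
  case: pickle_inv => [v /= <-|_ _]; last by rewrite indicE in_set0.
  by rewrite indicE in_set_eq => h; rewrite (_ : _ == v = false)//; apply/eqP => e; rewrite e eqxx in h.
have h0 : \1_(unit_cell (pickle (cellv 0 x))) x = 1 :> R.
  by rewrite /unit_cell pickleK_inv indicE in_set_eq eqxx.
elim: n => [|n IH]; first by rewrite big_ord0.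
rewrite big_ord_recr /= IH [in RHS]ltnS [in RHS]leq_eqVlt [in RHS]eq_sym.
have [->|ne] := eqVneq n (pickle (cellv 0 x)); first by rewrite ltnn h0 add0r.
by rewrite h// addr0.
Qed.

(** Approximate by simple functions from below, and cut off outside of finitely
    many unit cells. *)
Lemma spanned_nonneg f : pint f -> (forall x, 0 <= f x) -> spanned f.
Proof.
move=> pf f0.
have mf : measurable_fun [set: V] (EFin \o f) by apply/measurable_EFinP; exact: pf.1.
pose g n := nnsfun_approx measurableT mf n.
have gf x : g n x @[n --> \oo] --> f x.
  have : EFin \o (fun n => g n x) @ \oo --> (EFin \o f) x.
    by apply: (cvg_nnsfun_approx measurableT mf) => // y _; rewrite /= lee_fin.
  by move/fine_cvgP => [].
have gle n x : g n x <= f x.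
  rewrite -lee_fin /g nnsfun_approxE; apply: (@le_approx _ _ _ setT (EFin \o f)) => //.
  by move=> y _; rewrite /= lee_fin.
apply: (@spanned_dominated f f (fun n x => \sum_(i < n) g n x * \1_(unit_cell i) x)).
- move=> n; apply: (@spanned_sum _ (index_enum 'I_n)) => i.
  rewrite /unit_cell; case: pickle_inv => [v|]; first exact: spanned_nnsfun.
  have -> : (fun x => g n x * \1_(set0 : set V) x) = (fun=> 0).
    by apply/funext => x; rewrite indic0 mulr0.
  exact: spanned0.
- exact: pf.1.
- exact: pf.
- move=> x; apply: cvg_trans (gf x); apply: near_eq_cvg.
  exists (pickle (cellv 0 x)).+1 => // n /= hn.
  by rewrite -mulr_sumr sum_unit_cells hn mulr1.
- move=> n x; rewrite -mulr_sumr sum_unit_cells normrM normr_nat !ger0_norm//.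
  by case: (_ < _)%N; rewrite ?mulr1 ?mulr0.
Qed.

(** A function is the difference of its positive and negative parts, to which
    [spanned_nonneg] applies. *)
Lemma haar_dense f : pint f -> spanned f.
Proof.
move=> pf; have h (s : R) : `|s| = 1 -> spanned (fun x => Num.max (s * f x) 0).
  move=> s1; apply: spanned_nonneg; last by move=> x; rewrite le_max lexx orbT.
  have m : measurable_fun [set: V] (fun x => Num.max (s * f x) 0).
    by apply: measurable_maxr => //; apply: measurable_funM => //; exact: pf.1.
  split=> //; apply: le_integrable pf.2 => //.
    by apply/measurable_EFinP; exact: measurable_abs_powR.
  move=> x _ /=; rewrite lee_fin !(ger0_norm (powR_ge0 _ _)).
  have le : `|Num.max (s * f x) 0| <= `|f x|.
    rewrite ger0_norm; last by rewrite le_max lexx orbT.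
    by rewrite ge_max normr_ge0 andbT -[leRHS]mul1r -s1 -normrM ler_norm.
  by apply: ge0_ler_powR le; [exact: ltW|rewrite nnegrE|rewrite nnegrE].
have -> : f = (fun x => Num.max (1 * f x) 0 + (-1) * Num.max (-1 * f x) 0).
  apply/funext => x; rewrite mul1r !mulN1r.
  by case/orP: (le_total 0 (f x)) => f0; [rewrite (max_l f0) max_r ?oppr_le0// oppr0 addr0|
    rewrite (max_r f0) max_l ?oppr_ge0// opprK add0r].
by apply: spannedD; [apply: h; rewrite normr1|apply: spannedZ; apply: h; rewrite normrN1].
Qed.

End haar_span.

(** * Multipliers of an unconditional system *)

Section multipliers.
Context (R : realType) (k : scalar_kind).
Local Notation K := (scalar R k).
Local Notation sc a := (scalar_of a 0 : K).
Variables (Y X : normedModType K) (B : Y -> X -> K) (pB : pairing B).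
Variables (e : nat -> X) (es : nat -> Y) (C : R).
Hypotheses (e1 : forall j, rn (e j) <= 1) (es1 : forall j, rn (es j) <= 1).
Hypothesis biorth : forall i j, i != j -> B (es j) (e i) = 0.
Hypothesis norming : forall j, B (es j) (e j) *: e j = e j.
Hypothesis C0 : 0 <= C.
Hypothesis sign_bound : forall n (a : nat -> K) (eps : nat -> R),
  (forall j, eps j = 1 \/ eps j = -1) ->
  rn (\sum_(j < n) (sc (eps j) * a j) *: e j) <= C * rn (\sum_(j < n) a j *: e j).
Hypothesis dense : forall z (eps : R), 0 < eps ->
  exists n (a : nat -> K), rn (z - \sum_(j < n) a j *: e j) <= eps.

(** A multiplier with values in [[-1, 1]] is a convex combination of signs,
    one coordinate at a time. *)
Lemma coefficient_bound n (a : nat -> K) (t : nat -> R) :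
  (forall j, -1 <= t j <= 1) ->
  rn (\sum_(j < n) (sc (t j) * a j) *: e j) <= C * rn (\sum_(j < n) a j *: e j).
Proof.
move=> ht; set A := C * _.
suff step m : forall t, (forall j, -1 <= t j <= 1) ->
    (forall j, (m <= j)%N -> t j = 1 \/ t j = -1) ->
    rn (\sum_(j < n) (sc (t j) * a j) *: e j) <= A.
  have := @step n (fun j => if (j < n)%N then t j else 1).
  rewrite (eq_bigr (fun j : 'I_n => (sc (t j) * a j) *: e j)); last by move=> j _; rewrite ltn_ord.
  apply=> j; first by case: ifP => // _; lra.
  by move=> nj; left; rewrite ltnNge nj.
elim: m => [|m IH] {ht}t ht tm; first by apply: sign_bound => j; exact: tm.
(* The point [t] lies on the segment between [tt 1] and [tt (-1)]. *)
pose tt (s : R) j := if j == m then s else t j.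
have htt (s : R) : s = 1 \/ s = -1 -> rn (\sum_(j < n) (sc (tt s j) * a j) *: e j) <= A.
  move=> hs; apply: IH => j; rewrite /tt; case: (eqVneq j m) => [_|jm]; rewrite ?ht//.
    by case: hs => ->; lra.
  by move=> mj; apply: tm; rewrite ltn_neqAle eq_sym jm.
have -> : \sum_(j < n) (sc (t j) * a j) *: e j =
    sc ((1 + t m) / 2) *: \sum_(j < n) (sc (tt 1 j) * a j) *: e j +
    sc ((1 - t m) / 2) *: \sum_(j < n) (sc (tt (-1) j) * a j) *: e j.
  rewrite !scaler_sumr -big_split; apply: eq_bigr => j _ /=.
  rewrite !scalerA !mulrA -!scalar_ofM -scalerDl -mulrDl -scalar_ofD.
  by congr ((scalar_of _ _ * _) *: _); rewrite /tt; case: eqVneq => [->|_]; field.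
have /andP[h1 h2] := ht m.
have u0 : 0 <= (1 + t m) / 2 by lra.
have v0 : 0 <= (1 - t m) / 2 by lra.
apply: le_trans (rnD _ _) _; rewrite !rnZ !modulus_scalar_of !ger0_norm//.
have -> : A = (1 + t m) / 2 * A + (1 - t m) / 2 * A by field.
by apply: lerD; apply: ler_wpM2l => //; apply: htt; [left|right].
Qed.

Definition multiplier n (t : nat -> R) z := \sum_(j < n) (sc (t j) * B (es j) z) *: e j.

Lemma multiplierB n t z w : multiplier n t (z - w) = multiplier n t z - multiplier n t w.
Proof.
rewrite -sumrB; apply: eq_bigr => j _.
by rewrite (pairBr pB) mulrBr scalerBl.
Qed.

(** On a finite combination the multiplier acts on the coefficients, by
    biorthogonality. *)
Lemma multiplier_span n t m (a : nat -> K) :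
  multiplier n t (\sum_(i < m) a i *: e i) =
  \sum_(i < m) (sc (if (i < n)%N then t i else 0) * a i) *: e i.
Proof.
rewrite /multiplier; transitivity (\sum_(j < n) \sum_(i < m) (sc (t j) * (a i * B (es j) (e i))) *: e j).
  apply: eq_bigr => j _; rewrite (pair_sumr pB) mulr_sumr scaler_suml.
  by apply: eq_bigr => i _; rewrite (pairZr pB).
rewrite exchange_big /=; apply: eq_bigr => i _.
case: ifPn => [iN|ni]; last first.
  rewrite sc0 mul0r scale0r big1// => j _.
  by rewrite biorth ?mulr0 ?scale0r//; apply: contra ni => /eqP ->.
rewrite (bigD1 (Ordinal iN))//= big1 ?addr0; last first.
  move=> j ji; rewrite biorth ?mulr0 ?scale0r//.
  by apply: contra ji => /eqP h; apply/eqP/val_inj.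
by rewrite mulrA -[in LHS]scalerA norming.
Qed.

(** The estimate on finite combinations extends by density; the crude bound,
    which depends on [n], only serves to pass to the limit for fixed [n]. *)
Lemma multiplier_le n t z : (forall j, 0 <= t j <= 1) -> rn (multiplier n t z) <= C * rn z.
Proof.
move=> ht.
have crude y : rn (multiplier n t y) <= (2 * n%:R) * rn y.
  apply: le_trans (rn_sum _ _ _) _.
  apply: (@le_trans _ _ (\sum_(j < n) 2 * rn y)); last first.
    by rewrite sumr_const card_ord -[leLHS]mulr_natr mulrAC.
  apply: ler_sum => j _; rewrite rnZ modulusM modulus_scalar_of.
  have /andP[t0 t1] := ht j; rewrite ger0_norm//.
  have h : modulus (B (es j) y) <= 2 * rn y.
    apply: le_trans (pair_le pB _ _) _; rewrite ler_wpM2r ?rn_ge0//.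
    by rewrite -[leRHS]mulr1 ler_wpM2l.
  rewrite -[leRHS]mulr1; apply: ler_pM; rewrite ?mulr_ge0 ?modulus_ge0 ?rn_ge0//.
  by rewrite -[leRHS]mul1r; apply: ler_pM => //; exact: modulus_ge0.
apply/ler_addgt0Pr => eps eps0.
have d0 : 0 < 2 * n%:R + C + 1 by rewrite ltr_wpDl// addr_ge0// mulr_ge0.
have [m [a ha]] := dense z (divr_gt0 eps0 d0).
set w := \sum_(j < m) _ in ha; set et := eps / _ in ha.
have hw : rn (multiplier n t w) <= C * rn w.
  rewrite /w multiplier_span; apply: (@coefficient_bound m a (fun i => if (i < n)%N then t i else 0)) => j.
  by have /andP[t0 t1] := ht j; case: ifP => _; apply/andP; split; lra.
have wz : rn w <= rn z + et.
  have -> : w = z - (z - w) by rewrite subKr.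
  by apply: le_trans (rnB _ _) _; rewrite lerD2l.
have -> : multiplier n t z = multiplier n t (z - w) + multiplier n t w by rewrite multiplierB subrK.
apply: le_trans (rnD _ _) _; apply: le_trans (lerD (crude _) hw) _.
have -> : C * rn z + eps = (2 * n%:R + 1) * et + C * (rn z + et).
  by rewrite /et; field; rewrite gt_eqF.
apply: lerD; last by rewrite ler_wpM2l.
apply: le_trans (ler_wpM2l _ ha) _; first by rewrite mulr_ge0.
by rewrite ler_wpM2r ?lerDl// divr_ge0// ltW.
Qed.

Lemma multiplier_cvg z (eps : R) : 0 < eps -> exists J, forall n (t : nat -> R),
  (forall j, 0 <= t j <= 1) -> (forall j, (j < J)%N -> t j = 1) -> (J <= n)%N ->
  rn (multiplier n t z - z) <= eps.
Proof.
move=> eps0; have C1 : 0 < C + 1 by rewrite ltr_wpDl.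
have [m [a ha]] := dense z (divr_gt0 eps0 C1); exists m => n t ht t1 mn.
set w := \sum_(j < m) _ in ha.
have hw : multiplier n t w = w.
  rewrite multiplier_span; apply: eq_bigr => i _.
  by rewrite (leq_trans (ltn_ord i) mn) t1// sc1 mul1r.
have -> : multiplier n t z - z = multiplier n t (z - w) - (z - w) by rewrite multiplierB hw opprB addrA subrK.
apply: le_trans (rnB _ _) _; apply: le_trans (lerD (multiplier_le n _ ht) (lexx _)) _.
rewrite -{2}[rn _]mul1r -mulrDl; apply: le_trans (ler_wpM2l _ ha) _; first exact: ltW.
by rewrite mulrC divfK// gt_eqF.
Qed.

End multipliers.

(** * The Haar system and the Rademacher functions in [L_p] *)

Section real_functions_in_Lp.
Context d (T : measurableType d) (R : realType) (k : scalar_kind).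
Variables (mu : {measure set T -> \bar R}) (r : R) (r1 : (1 <= r%:E)%E).
Local Notation K := (scalar R k).
Local Notation X := (Lp k mu r1).
Local Open Scope quotient_scope.

Lemma scalar_Im_of0 (a : R) : scalar_Im (scalar_of a 0 : K) = 0.
Proof. by case: (k). Qed.

Lemma real_Lfun (f : T -> R) : pow_integrable mu r f ->
  (fun x => scalar_of (f x) 0 : K) \in scalar_Lfun mu r1.
Proof.
move=> [mf If]; apply: LpFunP; first exact: scalar_measurable_of.
under eq_integral do rewrite modulus_scalar_of.
have /integrableP[_] := If; apply: le_lt_trans; rewrite le_eqVlt; apply/orP; left; apply/eqP.
by apply: eq_integral => x _ /=; rewrite (ger0_norm (powR_ge0 _ _)).
Qed.

Definition LpReal (f : T -> R) (hf : pow_integrable mu r f) : LpFun k mu r1 :=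
  MkLpFun (real_Lfun hf).

Lemma LpRealE f hf x : @LpReal f hf x = scalar_of (f x) 0. Proof. by []. Qed.

Lemma rn_LpReal_le (f : T -> R) hf (M : R) : 0 <= M ->
  (\int[mu]_x (`|f x| `^ r)%:E <= (M `^ r)%:E)%E -> rn (\pi_X (@LpReal f hf)) <= M.
Proof.
move=> M0 h; apply: (rn_le M0); under eq_integral do rewrite LpRealE modulus_scalar_of.
exact: h.
Qed.

Lemma pow_integrable_part (f : LpFun k mu r1) (h : K -> R) :
  (forall z, `|h z| <= modulus z) -> measurable_fun [set: T] (h \o f) ->
  pow_integrable mu r (h \o f).
Proof.
move=> hz mh; split=> //; apply/integrableP; split.
  by apply/measurable_EFinP; exact: measurable_abs_powR.
apply: (@le_lt_trans _ _ (\int[mu]_x (modulus (f x) `^ r)%:E)%E); last by rewrite -rn_pow ltry.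
apply: ge0_le_integral => //.
- apply: measurableT_comp => //; apply/measurable_EFinP; exact: measurable_abs_powR.
- exact: measurable_modulus_pow (LpFun_measurable f).
- move=> x _; rewrite lee_fin /= ger0_norm ?powR_ge0//; apply: ge0_ler_powR (hz _).
  + exact: ltW (exponent_gt0 r1).
  + by rewrite nnegrE.
  + by rewrite nnegrE modulus_ge0.
Qed.

Lemma pow_integrable_Re (f : LpFun k mu r1) : pow_integrable mu r (scalar_Re \o f).
Proof. by apply: pow_integrable_part; [exact: abs_Re_le|exact: (LpFun_measurable f).1]. Qed.

Lemma pow_integrable_Im (f : LpFun k mu r1) : pow_integrable mu r (scalar_Im \o f).
Proof. by apply: pow_integrable_part; [exact: abs_Im_le|exact: (LpFun_measurable f).2]. Qed.

Lemma modulus_pow_le (f : LpFun k mu r1) (u v : T -> R) :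
  pow_integrable mu r u -> pow_integrable mu r v ->
  (forall x, modulus (f x) <= `|u x| + `|v x|) ->
  (\int[mu]_x (modulus (f x) `^ r)%:E <=
    (2 `^ r)%:E * (\int[mu]_x (`|u x| `^ r)%:E + \int[mu]_x (`|v x| `^ r)%:E))%E.
Proof.
move=> pu pv h; have pm : pow_integrable mu r (modulus \o f).
  apply: pow_integrable_part; last exact: measurable_modulus (LpFun_measurable f).
  by move=> z; rewrite ger0_norm ?modulus_ge0.
have hm x : `|(modulus \o f) x| <= `|u x| + `|v x| by rewrite /= ger0_norm ?modulus_ge0.
have := pow_integral_le_add (exponent_gt0 r1) pu pv pm hm.
by under eq_integral do rewrite /= (ger0_norm (modulus_ge0 _)).
Qed.

Lemma part_pow_le (f : LpFun k mu r1) (h : K -> R) :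
  (forall z, `|h z| <= modulus z) -> measurable_fun [set: T] (h \o f) ->
  (\int[mu]_x (`|h (f x)| `^ r)%:E <= \int[mu]_x (modulus (f x) `^ r)%:E)%E.
Proof.
move=> hz mh; apply: ge0_le_integral => //.
- exact: (measurable_abs_pow r mh).
- exact: measurable_modulus_pow (LpFun_measurable f).
- move=> x _; rewrite lee_fin; apply: ge0_ler_powR (hz _).
  + exact: ltW (exponent_gt0 r1).
  + by rewrite nnegrE.
  + by rewrite nnegrE modulus_ge0.
Qed.

(** Linear combinations of real functions with scalar coefficients, of which
    the real and imaginary parts are again such combinations. *)
Definition LpComb (f : nat -> T -> R) (hf : forall j, pow_integrable mu r (f j))
  n (a : nat -> K) : LpFun k mu r1 := \sum_(j < n) a j *: LpReal (hf j).

Lemma LpCombE n (a : nat -> K) (f : nat -> T -> R)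
    (hf : forall j, pow_integrable mu r (f j)) x :
  LpComb hf n a x = \sum_(j < n) a j * scalar_of (f j x) 0.
Proof. by rewrite /LpComb LpFun_sumE. Qed.

Lemma Re_mul_real (z : K) (a : R) : scalar_Re (z * scalar_of a 0) = scalar_Re z * a.
Proof. by rewrite scalar_ReM scalar_Re_of scalar_Im_of0 mulr0 subr0. Qed.

Lemma Im_mul_real (z : K) (a : R) : scalar_Im (z * scalar_of a 0) = scalar_Im z * a.
Proof. by rewrite scalar_ImM scalar_Re_of scalar_Im_of0 mulr0 add0r. Qed.

Lemma Re_LpComb n (a : nat -> K) (f : nat -> T -> R)
    (hf : forall j, pow_integrable mu r (f j)) x :
  scalar_Re (LpComb hf n a x) = \sum_(j < n) scalar_Re (a j) * f j x.
Proof. by rewrite LpCombE scalar_Re_sum; apply: eq_bigr => j _; rewrite Re_mul_real. Qed.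

Lemma Im_LpComb n (a : nat -> K) (f : nat -> T -> R)
    (hf : forall j, pow_integrable mu r (f j)) x :
  scalar_Im (LpComb hf n a x) = \sum_(j < n) scalar_Im (a j) * f j x.
Proof. by rewrite LpCombE scalar_Im_sum; apply: eq_bigr => j _; rewrite Im_mul_real. Qed.

Lemma pi_LpComb n (a : nat -> K) (f : nat -> T -> R)
    (hf : forall j, pow_integrable mu r (f j)) :
  \pi_X (LpComb hf n a) = \sum_(j < n) a j *: \pi_X (LpReal (hf j)).
Proof. by rewrite /LpComb pi_sum; apply: eq_bigr => j _; rewrite [RHS]Lp_piZ. Qed.

End real_functions_in_Lp.

Section haar_orthogonality.
Context (R : realType) (d' : nat).
Local Notation D := d'.+1.
Local Notation V := 'rV[R]_D.
Local Notation mu := (lebesgue_rV R D).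
Implicit Types (x : V).

Lemma abs_haar_le1 j x : `|haar j x| <= 1 :> R.
Proof. by rewrite abs_haar indicE; case: (_ \in _). Qed.

Lemma integrable_haarM i j :
  mu.-integrable [set: V] (EFin \o (fun x => haar i x * haar j x)).
Proof.
have [mi Ii] := @pow_integrable_haar R d' 1 i ltr01.
apply: le_integrable Ii => //.
  by apply/measurable_EFinP; apply: measurable_funM; exact: measurable_haar.
move=> x _ /=; rewrite powRr1// lee_fin normr_id normrM -[leRHS]mulr1.
by rewrite ler_wpM2l// abs_haar_le1.
Qed.

(** For different levels the exchange of halves changes the sign of the finer
    function only; at the same level the supports are disjoint. *)
Lemma haar_orthogonal i j : i != j -> (\int[mu]_x (haar i x * haar j x)%:E = 0)%E.
Proof.
have flipped (i' j' l : nat) : haar_level d' j' = l.+1 -> (haar_level d' i' <= l)%N ->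
    (\int[mu]_x (haar i' x * haar j' x)%:E = 0)%E.
  move=> hj hi; set f := fun x => haar i' x * haar j' x.
  have fphi x : f (flip l x) = - f x by rewrite /f (haar_flip x hj) (haar_flip_lt x hi) mulrN.
  have I := integrable_haarM i' j'.
  have I' : mu.-integrable [set: V] (EFin \o (f \o flip l)).
    have := integrableN I; apply: eq_integrable => // x _.
    by rewrite /= fphi.
  have := @integral_preserving _ V R mu (flip l) f (measurable_flip l)
    (@flip_preserving R d' l) I I'.
  rewrite (eq_integral (fun x => - (f x)%:E)%E); last by move=> x _; rewrite fphi.
  rewrite integralN; last exact: integrable_add_def.
  have fin : (\int[mu]_x (f x)%:E)%E \is a fin_num by exact: integrable_fin_num.
  rewrite -(fineK fin) -EFinN => -[] h; congr EFin; lra.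
move=> ij; case: (ltngtP (haar_level d' i) (haar_level d' j)) => [lij|lji|e].
- case E : (haar_level d' j) lij => [//|l]; rewrite ltnS; exact: flipped.
- under eq_integral do rewrite mulrC.
  by case E : (haar_level d' i) lji => [//|l]; rewrite ltnS; exact: flipped.
rewrite integral0_eq// => x _; congr EFin; move: e ij; rewrite /haar_level /haar.
have := @pickle_invK (nat * 'rV[int]_D)%type i; have := @pickle_invK (nat * 'rV[int]_D)%type j.
case: (pickle_inv i) => [[m v]|]; last by rewrite mul0r.
case: (pickle_inv j) => [[m' w]|]; last by rewrite mulr0.
move=> /= <- <- -> ij; rewrite /haar_node /=; case: eqP => [vx|]; last by rewrite !mul0r.
case: eqP => [wx|]; last by rewrite mul0r mulr0.
by move: ij; rewrite -vx -wx eqxx.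
Qed.

Definition haar_mass j : R := fine (mu (haar_cell j)).

Lemma haar_massE j : (haar_mass j)%:E = mu (haar_cell j).
Proof.
rewrite /haar_mass fineK// ge0_fin_numE ?measure_ge0//.
by apply: le_lt_trans (haar_cell_le1 R d' j) _; exact: ltry.
Qed.

Lemma haar_mass_ge0 j : 0 <= haar_mass j.
Proof. by rewrite fine_ge0. Qed.

Lemma haar_square j : (\int[mu]_x (haar j x * haar j x)%:E = (haar_mass j)%:E)%E.
Proof.
rewrite haar_massE -(@integral_haar_pow R d' 2)//; apply: eq_integral => x _.
by rewrite powR_mulrn// real_normK ?num_real.
Qed.

(** On a null cell the factor is [0 `^ (- r^-1) = 0], and the function is [0]. *)
Definition normalized_haar (r : R) j x : R := haar_mass j `^ (- r^-1) * haar j x.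

Lemma pow_integrable_normalized_haar (r s : R) j : 0 < s -> pow_integrable mu s (normalized_haar r j).
Proof. by move=> s0; apply: pow_integrableZ => //; exact: pow_integrable_haar. Qed.

Lemma normalized_haar_pow (r : R) j : 0 < r ->
  (\int[mu]_x (`|normalized_haar r j x| `^ r)%:E = (haar_mass j != 0)%:R%:E)%E.
Proof.
move=> r0; transitivity ((haar_mass j `^ (- r^-1) `^ r)%:E * \int[mu]_x (`|haar j x| `^ r)%:E)%E.
  rewrite -ge0_integralZl//.
  - by apply: eq_integral => x _; rewrite -EFinM -powRM ?powR_ge0// normrM (ger0_norm (powR_ge0 _ _)).
  - by apply: (measurable_abs_pow r); exact: measurable_haar.
  - by rewrite lee_fin powR_ge0.
rewrite integral_haar_pow// -haar_massE -EFinM -powRrM mulNr (mulVf (lt0r_neq0 r0)).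
have [->|m0] := eqVneq (haar_mass j) 0; first by rewrite mulr0.
by rewrite powRN powRr1 ?haar_mass_ge0// mulVf.
Qed.

End haar_orthogonality.

Section haar_basis.
Context (R : realType) (k : scalar_kind) (d' : nat).
Local Notation D := d'.+1.
Local Notation V := 'rV[R]_D.
Local Notation mu := (lebesgue_rV R D).
Local Notation K := (scalar R k).
Local Notation sc a := (scalar_of a 0 : K).
Local Open Scope quotient_scope.
Variables (p q : R) (p1 : (1 <= p%:E)%E) (q1 : (1 <= q%:E)%E).
Hypothesis p2 : 2 < p.
Hypothesis pq : p^-1 + q^-1 = 1.
Local Notation X := (Lp k mu p1).
Local Notation Y := (Lp k mu q1).
Local Notation B := (@Lp_dual _ V R k mu p%:E q%:E p1 q1).

Let p0 : 0 < p := exponent_gt0 p1.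
Let q0 : 0 < q := exponent_gt0 q1.

Definition haarL (r : R) (r1 : (1 <= r%:E)%E) j : Lp k mu r1 :=
  \pi_(Lp k mu r1) (LpReal k r1 (pow_integrable_normalized_haar d' r j (exponent_gt0 r1))).

Lemma haarL_le1 (r : R) (r1 : (1 <= r%:E)%E) j : rn (haarL r1 j) <= 1.
Proof.
apply: rn_LpReal_le => //; rewrite normalized_haar_pow ?(exponent_gt0 r1)// powR1 lee_fin.
by case: (_ != _).
Qed.

Lemma haarL_null (r : R) (r1 : (1 <= r%:E)%E) j : haar_mass R d' j = 0 -> haarL r1 j = 0.
Proof.
move=> m0; apply: rn_eq0; apply/le_anti; rewrite rn_ge0 andbT.
apply: rn_LpReal_le => //; rewrite normalized_haar_pow ?(exponent_gt0 r1)// m0 eqxx/= lee_fin powR_ge0//.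
Qed.

Lemma dual_haarL i j : B (haarL q1 j) (haarL p1 i) =
  sc (haar_mass R d' j `^ (- q^-1) * haar_mass R d' i `^ (- p^-1) *
      fine (\int[mu]_x (haar j x * haar i x)%:E)%E).
Proof.
rewrite Lp_dual_pi /scalar_integral; congr scalar_of; last first.
  rewrite /Rintegral integral0_eq// => x _.
  by rewrite !LpRealE -scalar_ofM scalar_Im_of0.
rewrite -RintegralZl//; last exact: integrable_haarM.
apply: eq_Rintegral => x _; rewrite !LpRealE -scalar_ofM scalar_Re_of; exact: mulrACA.
Qed.

Lemma haarL_biorth i j : i != j -> B (haarL q1 j) (haarL p1 i) = 0.
Proof.
by move=> ij; rewrite dual_haarL haar_orthogonal 1?eq_sym// mulr0 sc0.
Qed.

Lemma haarL_norming j : B (haarL q1 j) (haarL p1 j) *: haarL p1 j = haarL p1 j.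
Proof.
have [m0|m0] := eqVneq (haar_mass R d' j) 0; first by rewrite (haarL_null p1 m0) scaler0.
rewrite dual_haarL haar_square /= -powRD ?m0 ?implybT// -opprD [q^-1 + _]addrC pq.
by rewrite powRN powRr1 ?haar_mass_ge0// mulVf// sc1 scale1r.
Qed.

Definition haar_cst : R := (2 `^ p * (2 * burkholder_cst (p - 2))) `^ p^-1.

(** The inequality for real coefficients is applied to the real and the imaginary
    part, which costs the factor [2 `^ p * 2] in the [p]-th powers. *)
Lemma haarL_sign_bound n (a : nat -> K) (eps : nat -> R) :
  (forall j, eps j = 1 \/ eps j = -1) ->
  rn (\sum_(j < n) (sc (eps j) * a j) *: haarL p1 j) <=
  haar_cst * rn (\sum_(j < n) a j *: haarL p1 j).
Proof.
move=> heps; have q20 : 0 < p - 2 by rewrite subr_gt0.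
have Cge0 := burkholder_cst_ge0 q20.
have pE : p - 2 + 2 = p by rewrite subrK.
pose comb (c : nat -> K) := LpComb p1 (fun j => pow_integrable_normalized_haar d' p j (exponent_gt0 p1)) n c.
have eF (c : nat -> K) : \sum_(j < n) c j *: haarL p1 j = \pi_X (comb c) by rewrite pi_LpComb.
rewrite (eF (fun j => sc (eps j) * a j)) eF; set F := comb _; set G := comb a.
have part (h : K -> R) (al : nat -> R) :
   (forall x, h (F x) = \sum_(j < n) eps j * al j * normalized_haar p j x) ->
   (forall x, h (G x) = \sum_(j < n) al j * normalized_haar p j x) ->
   (\int[mu]_x (`|h (F x)| `^ p)%:E <=
     (burkholder_cst (p - 2))%:E * \int[mu]_x (`|h (G x)| `^ p)%:E)%E.
  move=> hF hG.
  have := haar_unconditional d' (fun j => al j * haar_mass R d' j `^ (- p^-1)) n q20 heps.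
  rewrite pE; set A := (\int[mu]_x _)%E; set A' := (\int[mu]_x _)%E.
  have -> : A = (\int[mu]_x (`|h (F x)| `^ p)%:E)%E.
    apply: eq_integral => x _; rewrite hF; congr (`| _ | `^ p)%:E.
    by apply: eq_bigr => j _; rewrite /normalized_haar !mulrA.
  have -> // : A' = (\int[mu]_x (`|h (G x)| `^ p)%:E)%E.
  apply: eq_integral => x _; rewrite hG; congr (`| _ | `^ p)%:E.
  by apply: eq_bigr => j _; rewrite /normalized_haar !mulrA.
have hre := part scalar_Re (fun j => scalar_Re (a j)).
have him := part scalar_Im (fun j => scalar_Im (a j)).
apply: rn_le; first by rewrite mulr_ge0 ?powR_ge0 ?rn_ge0.
apply: le_trans (modulus_pow_le (pow_integrable_Re F) (pow_integrable_Im F) _) _.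
  by move=> x; exact: modulus_le_ReIm.
apply: (@le_trans _ _ ((2 `^ p)%:E * ((burkholder_cst (p - 2))%:E * (rn (\pi_X G) `^ p)%:E +
   (burkholder_cst (p - 2))%:E * (rn (\pi_X G) `^ p)%:E)))%E; last first.
  rewrite -!EFinM lee_fin powRM ?powR_ge0 ?rn_ge0//.
  rewrite /haar_cst -powRrM mulVf ?gt_eqF// powRr1 ?mulr_ge0 ?powR_ge0//.
  by rewrite le_eqVlt; apply/orP; left; apply/eqP; ring.
rewrite lee_wpmul2l ?lee_fin ?powR_ge0// rn_pow; apply: leeD.
  apply: le_trans (hre _ _) _.
  - by move=> x; rewrite Re_LpComb; apply: eq_bigr => j _; rewrite [_ * a j]mulrC Re_mul_real [_ * eps j]mulrC.
  - by move=> x; rewrite Re_LpComb.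
  by rewrite lee_wpmul2l ?lee_fin//; apply: part_pow_le; [exact: abs_Re_le|exact: (LpFun_measurable G).1].
apply: le_trans (him _ _) _.
- by move=> x; rewrite Im_LpComb; apply: eq_bigr => j _; rewrite [_ * a j]mulrC Im_mul_real [_ * eps j]mulrC.
- by move=> x; rewrite Im_LpComb.
by rewrite lee_wpmul2l ?lee_fin//; apply: part_pow_le; [exact: abs_Im_le|exact: (LpFun_measurable G).2].
Qed.

(** The normalisation can be undone also on null cells, where both sides vanish
    in [L_p]. *)
Lemma pi_haar j : \pi_X (LpReal k p1 (pow_integrable_haar d' j p0)) =
  sc (haar_mass R d' j `^ p^-1) *: haarL p1 j.
Proof.
have [m0|m0] := eqVneq (haar_mass R d' j) 0.
  rewrite haarL_null// scaler0; apply: rn_eq0; apply/le_anti; rewrite rn_ge0 andbT.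
  by apply: rn_LpReal_le => //; rewrite integral_haar_pow// -haar_massE m0 lee_fin powR_ge0.
rewrite [RHS]Lp_piZ; apply/eqP/Lp_piP; apply: aeW => x.
rewrite [RHS](_ : _ = sc (haar_mass R d' j `^ p^-1) * sc (normalized_haar p j x))// -scalar_ofM.
rewrite LpRealE /normalized_haar mulrA -powRD ?m0 ?implybT// subrr powRr0 mul1r//.
Qed.

Lemma haarL_dense (z : X) (eps : R) : 0 < eps ->
  exists n (a : nat -> K), rn (z - \sum_(j < n) a j *: haarL p1 j) <= eps.
Proof.
elim/Lp_ind: z => f eps0.
have e0 : 0 < (eps `^ p) / (2 `^ p * 2) by rewrite divr_gt0 ?mulr_gt0 ?powR_gt0.
have [_ /(_ _ e0)[n [a ha]]] := haar_dense p0 (pow_integrable_Re f).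
have [_ /(_ _ e0)[m [b hb]]] := haar_dense p0 (pow_integrable_Im f).
pose t (c : nat -> R) n j : R := if (j < n)%N then c j else 0.
pose g j : K := scalar_of (t a n j) (t b m j).
exists (maxn n m), (fun j => g j * sc (haar_mass R d' j `^ p^-1)).
rewrite (eq_bigr (fun j : 'I_(maxn n m) => g j *: \pi_X (LpReal k p1 (pow_integrable_haar d' j p0)))); last first.
  by move=> j _; rewrite pi_haar scalerA.
pose G := LpComb p1 (fun j => pow_integrable_haar d' j p0) (maxn n m) g.
rewrite -(pi_LpComb p1 _ g (fun j => pow_integrable_haar d' j p0)) -/G -pi_B; apply: rn_le; first exact: ltW.
have Re1 x : scalar_Re (G x) = haar_sum n a x.
  rewrite /G Re_LpComb (haar_sum_widen _ a (leq_maxl n m)); apply: eq_bigr => j _.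
  by rewrite scalar_Re_of.
have Im1 x : `|scalar_Im (f x) - scalar_Im (G x)| <= `|scalar_Im (f x) - haar_sum m b x|.
  have : scalar_Im (G x) = haar_sum m b x \/ scalar_Im (f x) - scalar_Im (G x) = 0.
    rewrite /G Im_LpComb (haar_sum_widen _ b (leq_maxr n m)) /haar_sum /g.
    case: (k) (f x) => z; first by right; rewrite big1 ?subrr// => j _; rewrite mul0r.
    by left; apply: eq_bigr => j _.
  by case=> ->; rewrite // normr0.
apply: le_trans (modulus_pow_le (u := fun x => scalar_Re (f x) - haar_sum n a x)
  (v := fun x => scalar_Im (f x) - haar_sum m b x) _ _ _) _.
- apply: pow_integrableB => //; [exact: pow_integrable_Re|exact: pow_integrable_haar_sum].
- apply: pow_integrableB => //; [exact: pow_integrable_Im|exact: pow_integrable_haar_sum].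
- move=> x; apply: le_trans (modulus_le_ReIm _) _.
  by rewrite LpFunBE scalar_ReB scalar_ImB Re1 lerD2l.
apply: le_trans (lee_wpmul2l _ (leeD ha hb)) _; first by rewrite lee_fin powR_ge0.
rewrite -EFinD -EFinM lee_fin le_eqVlt; apply/orP; left; apply/eqP.
by field; rewrite gt_eqF// powR_gt0.
Qed.

Lemma haarL_multipliers (z : X) (eps : R) : 0 < eps -> exists J, forall n (t : nat -> R),
  (forall j, 0 <= t j <= 1) -> (forall j, (j < J)%N -> t j = 1) -> (J <= n)%N ->
  rn (\sum_(j < n) (sc (t j) * B (haarL q1 j) z) *: haarL p1 j - z) <= eps.
Proof.
apply: (multiplier_cvg (Lp_pairing k mu p1 q1 pq) (haarL_le1 p1) (haarL_le1 q1)
  haarL_biorth haarL_norming (powR_ge0 _ _) haarL_sign_bound haarL_dense).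
Qed.

(** The lower corner of the unit cell that contains the support of the [j]-th
    function. *)
Definition haar_corner j : V :=
  if (pickle_inv j : option (nat * 'rV[int]_D)) is Some n
  then (if pselect (exists x : V, cellv n.1.-1 x = n.2) is left h
        then \row_i (cellv 0 (projT1 (cid h)) ord0 i)%:~R else 0) else 0.

Lemma haarL_supported j : Lp_supported (haarL p1 j) [set x | `|x - haar_corner j| <= 1].
Proof.
have := Lp_repr_ae (LpReal k p1 (pow_integrable_normalized_haar d' p j (exponent_gt0 p1))).
apply: filterS => x; rewrite -/(haarL p1 j) => -> out.
rewrite LpRealE /normalized_haar (_ : haar j x = 0) ?mulr0 ?sc0//.
have [//|hx] := eqVneq (haar j x) 0; exfalso; apply: out.
move: hx; rewrite /= /haar_corner /haar; case: pickle_inv => [[l v]|]; last by rewrite eqxx.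
rewrite /haar_node; have [vx _|_] := eqVneq (cellv (l, v).1.-1 x) (l, v).2; last by rewrite mul0r eqxx.
rewrite /= in vx *; case: pselect => [h|]; last by case; exists x.
apply: unit_cell_norm; apply: (@cellv_coarser _ _ 0 l.-1) => //.
by rewrite vx; apply/esym; exact: (svalP (cid h)).
Qed.

End haar_basis.

Section rademacher.
Context (R : realType) (k : scalar_kind) (d' : nat).
Local Notation D := d'.+1.
Local Notation V := 'rV[R]_D.
Local Notation mu := (lebesgue_rV R D).
Local Notation K := (scalar R k).
Local Open Scope quotient_scope.
Variables (r : R) (r1 : (1 <= r%:E)%E).
Hypothesis r2 : r < 2.
Local Notation X := (Lp k mu r1).
Local Notation Q := (cell 0 0 : set V).

Let r0 : 0 < r := exponent_gt0 r1.

Definition rademacher i (x : V) : R := \1_Q x * sgn_bit i x.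

Lemma abs_rademacher i x : `|rademacher i x| = \1_Q x.
Proof.
rewrite /rademacher normrM (_ : `|sgn_bit i x| = 1).
  by rewrite mulr1 indicE normr_nat.
by case: (sgn_bitP i x) => ->; rewrite ?normrN normr1.
Qed.

Lemma measurable_rademacher i : measurable_fun [set: V] (rademacher i).
Proof.
apply: measurable_funM; last exact: measurable_sgn_bit.
by apply/measurable_indicP; exact: measurable_cell.
Qed.

Lemma integral_indic_unit_cell : (\int[mu]_x (\1_Q x)%:E = 1)%E.
Proof.
rewrite integral_indic//; last exact: measurable_cell.
by rewrite setIT; exact: measure_unit_cell.
Qed.

Lemma integral_rademacher_pow s i : 0 < s -> (\int[mu]_x (`|rademacher i x| `^ s)%:E = 1)%E.
Proof.
move=> s0; rewrite -integral_indic_unit_cell; apply: eq_integral => x _.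
rewrite abs_rademacher indicE; case: (_ \in _) => /=; first by rewrite powR1.
by rewrite powR0// gt_eqF.
Qed.

Lemma pow_integrable_rademacher s i : 0 < s -> pow_integrable mu s (rademacher i).
Proof.
move=> s0; split; first exact: measurable_rademacher.
apply/integrableP; split.
  by apply/measurable_EFinP; apply: measurable_abs_powR; exact: measurable_rademacher.
rewrite (_ : (fun x => `|_|%E) = (fun x => (`|rademacher i x| `^ s)%:E)); last first.
  by apply/funext => x /=; rewrite ger0_norm// powR_ge0.
by rewrite integral_rademacher_pow// ltry.
Qed.

Lemma indic_cell_flip n x : \1_Q (flip n x) = \1_Q x :> R.
Proof. by rewrite !indicE !in_set_eq cellv_flip_le. Qed.

Lemma rademacher_flip n x : rademacher n (flip n x) = - rademacher n x.
Proof. by rewrite /rademacher indic_cell_flip sgn_bit_flip mulrN. Qed.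

Lemma rademacher_flip_lt m n x : (m < n)%N -> rademacher m (flip n x) = rademacher m x.
Proof. by move=> mn; rewrite /rademacher indic_cell_flip sgn_bit_flip_lt. Qed.

Lemma integrable_sqr (f : V -> R) : pow_integrable mu 2 f ->
  mu.-integrable [set: V] (EFin \o (fun x => f x ^+ 2)).
Proof.
move=> [_]; apply: eq_integrable => // x _ /=.
by rewrite powR_mulrn// real_normK ?num_real.
Qed.

Lemma pow_integrable_rademacher_sum n (a : nat -> R) :
  pow_integrable mu 2 (fun x => \sum_(i < n) a i * rademacher i x).
Proof. by apply: pow_integrable_sum => // i; apply: pow_integrableZ => //; exact: pow_integrable_rademacher. Qed.

(** By induction: exchanging the halves at level [n] changes the sign of the last
    function only, and the parallelogram identity removes the cross term. *)
Lemma rademacher_orthonormal n (a : nat -> R) :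
  (\int[mu]_x ((\sum_(i < n) a i * rademacher i x) ^+ 2)%:E = (\sum_(i < n) a i ^+ 2)%:E)%E.
Proof.
have par (u v : R) : (u + v) ^+ 2 + (u - v) ^+ 2 = 2 * (u ^+ 2 + v ^+ 2) by ring.
elim: n => [|n IH].
  by rewrite big_ord0 integral0_eq// => x _; rewrite big_ord0 expr0n.
pose S x := \sum_(i < n) a i * rademacher i x.
pose f x := (S x + a n * rademacher n x) ^+ 2.
rewrite (eq_integral (EFin \o f)); last by move=> x _; rewrite big_ord_recr.
have Sflip x : S (flip n x) = S x.
  by apply: eq_bigr => i _; rewrite rademacher_flip_lt.
have fphi x : f (flip n x) = (S x - a n * rademacher n x) ^+ 2.
  by rewrite /f Sflip rademacher_flip mulrN.
have pr c : pow_integrable mu 2 (fun x => c * rademacher n x).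
  by apply: pow_integrableZ => //; exact: pow_integrable_rademacher.
have I : mu.-integrable [set: V] (EFin \o f).
  by apply: integrable_sqr; apply: pow_integrableD => //; exact: pow_integrable_rademacher_sum.
have I' : mu.-integrable [set: V] (EFin \o (f \o flip n)).
  have := integrable_sqr (pow_integrableD (ltr0Sn R 1) (pow_integrable_rademacher_sum n a) (pr (- a n))).
  by apply: eq_integrable => // x _ /=; rewrite fphi mulNr.
have IS := integrable_sqr (pow_integrable_rademacher_sum n a).
have Ir := integrable_sqr (pr (a n)).
have e := @integral_preserving _ V R mu (flip n) f (measurable_flip n)
  (@flip_preserving R d' n) I I'.
have h : (\int[mu]_x (f x)%:E + \int[mu]_x (f (flip n x))%:E =
   2%:E * (\int[mu]_x (S x ^+ 2)%:E + \int[mu]_x ((a n * rademacher n x) ^+ 2)%:E))%E.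
  rewrite -(integralD measurableT IS Ir) -(integralZl measurableT (integrableD measurableT IS Ir)).
  rewrite -(integralD measurableT I I'); apply: eq_integral => x _.
  by rewrite /= fphi; exact: (congr1 EFin (par (S x) (a n * rademacher n x))).
have hr : (\int[mu]_x ((a n * rademacher n x) ^+ 2)%:E = (a n ^+ 2)%:E)%E.
  have <- : ((a n ^+ 2)%:E * \int[mu]_x (\1_Q x)%:E = (a n ^+ 2)%:E)%E.
    by rewrite integral_indic_unit_cell mule1.
  rewrite -ge0_integralZl ?lee_fin ?sqr_ge0//; last first.
    by apply/measurable_EFinP/measurable_indicP; exact: measurable_cell.
  apply: eq_integral => x _; rewrite -EFinM exprMn -[rademacher n x ^+ 2]real_normK ?num_real//.
  by rewrite abs_rademacher indicE; case: (_ \in _); rewrite ?expr1n ?expr0n.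
have fin : (\int[mu]_x (f x)%:E)%E \is a fin_num by exact: integrable_fin_num.
move: h; rewrite e IH hr big_ord_recr/= -(fineK fin) -!EFinD -EFinM => -[] h.
by congr EFin; move: h; rewrite mulr_natl mulr2n; lra.
Qed.

Definition rademacherL i : X := \pi_X (LpReal k r1 (pow_integrable_rademacher i r0)).

Lemma rn_rademacherL i : rn (rademacherL i) = 1.
Proof.
have h : rn (rademacherL i) `^ r = 1.
  apply: EFin_inj; rewrite rn_pow -(integral_rademacher_pow i r0).
  by apply: eq_integral => x _; rewrite LpRealE modulus_scalar_of.
have <- : rn (rademacherL i) `^ (r * r^-1) = rn (rademacherL i).
  by rewrite mulfV ?gt_eqF// powRr1 ?rn_ge0.
by rewrite powRrM h powR1.
Qed.

(** Young's inequality for the product of [t `^ r] and [1]. *)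
Lemma young_lt2 (t : R) : 0 <= t -> t `^ r <= r / 2 * t ^+ 2 + (1 - r / 2).
Proof.
move=> t0; have r20 : 0 < 2 - r by rewrite subr_gt0.
have := @conjugate_powR _ (t `^ r) 1 (2 / r) (2 / (2 - r)) (powR_ge0 _ _) ler01.
rewrite !divr_gt0// => /(_ isT isT); rewrite !invf_div => /(_ _)/le_trans.
rewrite mulr1; apply; first by field.
rewrite powR1 -powRrM [r * _]mulrC divfK ?gt_eqF// powR_mulrn//.
by rewrite le_eqVlt; apply/orP; left; apply/eqP; field.
Qed.

(** On the unit cell, which has measure [1], the norm of order [r < 2] is at most
    that of order [2], by [young_lt2] applied to the modulus divided by the
    norm of order [2]. *)
Lemma rademacherL_upper2 : upper2 rademacherL 1.
Proof.
move=> n a; rewrite mul1r; pose A2 := \sum_(i < n) modulus (a i) ^+ 2; rewrite -/A2.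
have [A0|An0] := eqVneq A2 0.
  rewrite big1 ?rn0 ?sqrtr_ge0// => i _.
  have : modulus (a i) ^+ 2 = 0.
    apply/le_anti; rewrite sqr_ge0 andbT -A0 /A2 (bigD1 i)//= lerDl.
    by rewrite sumr_ge0// => j _; exact: sqr_ge0.
  by move/eqP; rewrite sqrf_eq0 => /eqP/modulus_eq0 ->; rewrite scale0r.
have A2gt : 0 < A2 by rewrite lt_neqAle eq_sym An0 sumr_ge0// => i _; exact: sqr_ge0.
pose A := Num.sqrt A2; have Agt : 0 < A by rewrite sqrtr_gt0.
pose F := LpComb r1 (fun i => pow_integrable_rademacher i r0) n a.
have -> : \sum_(i < n) a i *: rademacherL i = \pi_X F by rewrite /F pi_LpComb.
apply: rn_le; first exact: ltW.
have mod2 z : modulus z ^+ 2 = scalar_Re z ^+ 2 + scalar_Im z ^+ 2 :> R.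
  by rewrite sqr_sqrtr// addr_ge0 ?sqr_ge0.
have parts (c : nat -> R) : mu.-integrable [set: V]
    (EFin \o (fun x => (\sum_(i < n) c i * rademacher i x) ^+ 2)).
  by apply: integrable_sqr; exact: pow_integrable_rademacher_sum.
have e2 : (\int[mu]_x (modulus (F x) ^+ 2)%:E = A2%:E)%E.
  rewrite (eq_integral (fun x => ((\sum_(i < n) scalar_Re (a i) * rademacher i x) ^+ 2)%:E +
     ((\sum_(i < n) scalar_Im (a i) * rademacher i x) ^+ 2)%:E)%E); last first.
    by move=> x _; rewrite mod2 Re_LpComb Im_LpComb EFinD.
  apply: etrans (integralD measurableT (parts (fun i => scalar_Re (a i)))
    (parts (fun i => scalar_Im (a i)))) _; rewrite /=.
  rewrite (rademacher_orthonormal n (fun i => scalar_Re (a i))).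
  rewrite (rademacher_orthonormal n (fun i => scalar_Im (a i))).
  by rewrite -EFinD -big_split; congr EFin; apply: eq_bigr => i _; rewrite mod2.
have r20 : 0 <= 1 - r / 2 by rewrite subr_ge0 ler_pdivrMr// mul1r ltW.
have pw x : modulus (F x) `^ r <= A `^ r * (r / 2 / A2 * modulus (F x) ^+ 2 + (1 - r / 2) * \1_Q x).
  have [xQ|xQ] := boolP (x \in Q); last first.
    have -> : F x = 0.
      rewrite LpCombE big1// => i _.
      by rewrite /rademacher indicE (negbTE xQ) mul0r sc0 mulr0.
    by rewrite modulus0 powR0 ?gt_eqF// expr0n indicE (negbTE xQ) !mulr0 addr0 mulr0.
  rewrite indicE xQ mulr1; have h := young_lt2 (divr_ge0 (modulus_ge0 (F x)) (ltW Agt)).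
  have -> : modulus (F x) `^ r = A `^ r * (modulus (F x) / A) `^ r.
    by rewrite -powRM ?divr_ge0 ?modulus_ge0 ?(ltW Agt)// mulrC divfK// gt_eqF.
  rewrite ler_wpM2l ?powR_ge0//; apply: le_trans h _; rewrite lerD2r.
  have -> : (modulus (F x) / A) ^+ 2 = modulus (F x) ^+ 2 / A2.
    by rewrite expr_div_n /A (sqr_sqrtr (ltW A2gt)).
  by rewrite [leRHS]mulrAC mulrA.
have mF := measurable_modulus (LpFun_measurable F).
have mF2 : measurable_fun [set: V] (fun x => (modulus (F x) ^+ 2)%:E).
  by apply/measurable_EFinP; apply: measurable_funX.
have mQ : measurable_fun [set: V] (fun x : V => (\1_Q x : R)%:E).
  by apply/measurable_EFinP/measurable_indicP; exact: measurable_cell.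
have c1 : 0 <= r / 2 / A2 by rewrite !divr_ge0// ltW.
apply: (@le_trans _ _ (\int[mu]_x ((A `^ r)%:E * ((r / 2 / A2)%:E * (modulus (F x) ^+ 2)%:E +
    (1 - r / 2)%:E * (\1_Q x)%:E)))%E).
  apply: ge0_le_integral => //.
  - by move=> x _; rewrite lee_fin powR_ge0.
  - exact: measurable_modulus_pow (LpFun_measurable F).
  - by apply: measurable_funeM; apply: emeasurable_funD; exact: measurable_funeM.
  - by move=> x _; rewrite -!EFinM lee_fin; exact: pw.
rewrite ge0_integralZl//; last 3 first.
- by apply: emeasurable_funD; exact: measurable_funeM.
- by move=> x _; rewrite adde_ge0// mule_ge0// lee_fin// sqr_ge0.
- by rewrite lee_fin powR_ge0.
rewrite ge0_integralD//; last 4 first.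
- by move=> x _; rewrite mule_ge0// lee_fin// sqr_ge0.
- exact: measurable_funeM.
- by move=> x _; rewrite mule_ge0// lee_fin.
- exact: measurable_funeM.
rewrite ge0_integralZl//; last by move=> x _; rewrite lee_fin sqr_ge0.
rewrite ge0_integralZl// e2 integral_indic_unit_cell mule1 -!EFinM lee_fin.
by rewrite divfK// addrC subrK mulr1.
Qed.

End rademacher.

(** * Sparse subsequences and the conclusion *)

Section consecutive_blocks.
Variable N : nat -> nat.
Hypothesis N_gt0 : forall j, (0 < N j)%N.

Definition block_start j : nat := \sum_(i < j) N i.

Lemma block_startS j : block_start j.+1 = (block_start j + N j)%N.
Proof. by rewrite /block_start big_ord_recr. Qed.

Lemma block_start_le i j : (i <= j)%N -> (block_start i <= block_start j)%N.
Proof.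
move=> ij; rewrite -(subnK ij); elim: (j - i)%N => // m IH.
by rewrite addSn block_startS (leq_trans IH)// leq_addr.
Qed.

Fixpoint block i : nat :=
  if i is i'.+1 then
    if (i < block_start (block i').+1)%N then block i' else (block i').+1
  else 0.

Lemma blockP i : (block_start (block i) <= i < block_start (block i).+1)%N.
Proof.
elim: i => [|i /andP[IH1 IH2]] /=.
  by rewrite block_startS /block_start big_ord0 add0n N_gt0.
case: ifPn => [->|]; first by rewrite (leq_trans IH1).
rewrite -leqNgt => h; rewrite h /= block_startS.
have := N_gt0 (block i).+1; move: IH2 h; lia.
Qed.

Lemma block_le i : (block i <= i)%N.
Proof. by elim: i => //= i IH; case: ifP => _; rewrite // (leq_trans IH). Qed.

Lemma blockE i j : (i < block_start j.+1)%N -> (block i == j) = (block_start j <= i)%N.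
Proof.
move=> ij; have /andP[h1 h2] := blockP i; apply/eqP/idP => [<-//|ji].
apply/eqP; rewrite eqn_leq; apply/andP; split; rewrite leqNgt; apply/negP => h.
  by move: (leq_trans ij (leq_trans (block_start_le h) h1)); rewrite ltnn.
by move: (leq_trans h2 (leq_trans (block_start_le h) ji)); rewrite ltnn.
Qed.

Lemma block_card j : \sum_(i < block_start j.+1 | block i == j) 1%N = N j.
Proof.
rewrite (eq_bigl (fun i : 'I_(block_start j.+1) => true && (block_start j <= i)%N)); last first.
  by move=> i; rewrite /= blockE.
rewrite -(@big_geq_mkord _ _ _ (block_start j) _ (fun=> true) (fun=> 1%N)).
by rewrite sum_nat_const_nat muln1 block_startS addKn.
Qed.

End consecutive_blocks.

Section sparse_subsequence.
Context (R : realType) (d : nat).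
Local Notation V := 'rV[R]_d.
Variables (lambda : nat -> V).
Hypothesis lambda_unbounded : ~ bounded_set (range lambda).

Lemma unbounded_next (n0 : nat) (G : R) : exists n, (n0 < n)%N /\ G < `|lambda n|.
Proof.
apply: contrapT => none; apply: lambda_unbounded.
exists (Num.max G (\sum_(i < n0.+1) `|lambda i|)); split; first exact: num_real.
move=> M hM _ [n _ <-]; have [nn0|n0n] := leqP n n0.
  apply: le_trans (ltW hM); rewrite le_max; apply/orP; right.
  by rewrite (bigD1 (Ordinal (nn0 : (n < n0.+1)%N)))//= lerDl sumr_ge0.
apply: le_trans (ltW hM); rewrite le_max; apply/orP; left.
by rewrite leNgt; apply/negP => h; apply: none; exists n.
Qed.

Variable G : nat -> R -> R.

(** The threshold [G n] may depend on the sum of the norms chosen before, so the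
    recursion carries this sum along. *)
Lemma sparse_subsequence : exists m : nat -> nat, {homo m : i j / (i < j)%N} /\
  forall n, G n (\sum_(i < n) `|lambda (m i)|) < `|lambda (m n)|.
Proof.
have [nx hnx] : {nx : nat -> R -> nat & forall n0 g, (n0 < nx n0 g)%N /\ g < `|lambda (nx n0 g)|}.
  exists (fun n0 g => projT1 (cid (unbounded_next n0 g))) => n0 g.
  exact: (svalP (cid (unbounded_next n0 g))).
pose st := fix st n : nat * R := match n with
  | 0 => let m := nx 0 (G 0 0) in (m, `|lambda m|)
  | n'.+1 => let m := nx (st n').1 (G n'.+1 (st n').2) in (m, (st n').2 + `|lambda m|)
  end.
have stS n : (st n).2 = \sum_(i < n.+1) `|lambda (st i).1|.
  by elim: n => [|n IH]; [rewrite big_ord1|rewrite big_ord_recr /= IH].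
exists (fun n => (st n).1); split.
  by apply: homo_ltn; [exact: ltn_trans|move=> i; exact: (hnx _ _).1].
case=> [|n]; first by rewrite big_ord0; exact: (hnx _ _).2.
by rewrite -stS; exact: (hnx _ _).2.
Qed.

End sparse_subsequence.

(** A vector whose norm exceeds a multiple of the sum of all previous norms
    dominates every combination in which it does not cancel. *)
Section separation.
Context (R : realType) (d : nat).
Local Notation V := 'rV[R]_d.
Variables (x w : nat -> V).
Let W n : R := \sum_(i < n.+1) `|w i|.
Let S n : R := \sum_(i < n) `|x i|.
Hypothesis growth : forall n, 3 + 2 * W n + 4 * S n < `|x n|.

Let w_le i n : (i <= n)%N -> `|w i| <= W n.
Proof. by move=> i_n; rewrite /W (bigD1 (Ordinal (i_n : (i < n.+1)%N)))//= lerDl sumr_ge0. Qed.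

Let y (n i : nat) : V := if i == n then 0 else x i.
Let s (n i : nat) : R := if i == n then 1 else 0.

Let xE n i : x i = s n i *: x n + y n i.
Proof.
by rewrite /s /y; have [->|_] := eqVneq i n; rewrite ?scale1r ?addr0// scale0r add0r.
Qed.

Let y_le n i : (i <= n)%N -> `|y n i| <= S n.
Proof.
rewrite leq_eqVlt /y; have [_ _|ne /= i_n] := eqVneq i n; first by rewrite normr0 sumr_ge0.
by rewrite /S (bigD1 (Ordinal i_n))//= lerDl sumr_ge0.
Qed.

Let dominant n (c : R) (e : V) : 1 <= `|c| -> `|e| <= 2 * W n + 4 * S n ->
  2 < `|c *: x n + e|.
Proof.
move=> c1 he; have := lerB_normD (c *: x n) e; rewrite normrZ => h.
have h2 : `|x n| <= `|c| * `|x n| by rewrite ler_peMl.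
by move: (growth n) he h h2; lra.
Qed.

Lemma separated2 i l (u : V) : i != l -> `|u| <= 2 * W (maxn i l) ->
  2 < `|u - x i + x l|.
Proof.
move=> il; set n := maxn i l => hu.
have i_n : (i <= n)%N by exact: leq_maxl.
have l_n : (l <= n)%N by exact: leq_maxr.
have -> : u - x i + x l = (s n l - s n i) *: x n + (u - y n i + y n l).
  by rewrite (xE n i) (xE n l); apply/rowP => k; rewrite !mxE; ring.
apply: dominant.
  have : (i == n) || (l == n) by rewrite /n /maxn; case: ifP; rewrite eqxx ?orbT.
  move: il; rewrite /s; have [->|_] := eqVneq i n.
    by rewrite eq_sym => /negbTE ->; rewrite sub0r normrN normr1.
  by move=> _ /= ->; rewrite subr0 normr1.
have := ler_normD (u - y n i) (y n l); have := ler_normB u (y n i).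
have := y_le i_n; have := y_le l_n; have : 0 <= S n by rewrite sumr_ge0.
by move: hu; lra.
Qed.

Lemma separated2_shift i l : i != l -> 2 < `|(w i - x i) - (w l - x l)|.
Proof.
move=> il; have -> : (w i - x i) - (w l - x l) = (w i - w l) - x i + x l.
  by apply/rowP => k; rewrite !mxE; ring.
apply: separated2 => //; apply: le_trans (ler_normB _ _) _.
by have := w_le (leq_maxl i l); have := w_le (leq_maxr i l); lra.
Qed.

(** The vector of largest index among the four occurs with a nonzero integer
    coefficient, unless it occurs twice with opposite signs; in that case two
    vectors are left. *)
Lemma separated4 i i' l l' : i != i' -> l != l' -> (i, i') != (l, l') ->
  2 < `|(w i' + (x i - x i')) - (w l' + (x l - x l'))|.
Proof.
move=> ii ll ne; pose n := maxn (maxn i i') (maxn l l').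
have i_n : (i <= n)%N by rewrite /n !leq_max leqnn.
have i'_n : (i' <= n)%N by rewrite /n !leq_max leqnn orbT.
have l_n : (l <= n)%N by rewrite /n !leq_max leqnn !orbT.
have l'_n : (l' <= n)%N by rewrite /n !leq_max leqnn !orbT.
have top : [|| i == n, i' == n, l == n | l' == n] by move: i_n i'_n l_n l'_n; rewrite /n; lia.
have [/andP[/eqP iE /eqP lE]|nil] := boolP ((i == n) && (l == n)).
  have -> : (w i' + (x i - x i')) - (w l' + (x l - x l')) = (w i' - x i') - (w l' - x l').
    by rewrite iE lE; apply/rowP => k; rewrite !mxE; ring.
  apply: separated2_shift; apply: contra ne => /eqP ->; by rewrite iE lE.
have [/andP[/eqP iE /eqP lE]|nil'] := boolP ((i' == n) && (l' == n)).
  (* Here [i' = l'], so that the [w] and the largest vectors cancel. *)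
  have -> : (w i' + (x i - x i')) - (w l' + (x l - x l')) = - (0 - x i + x l).
    by rewrite iE lE; apply/rowP => k; rewrite !mxE; ring.
  rewrite normrN; apply: separated2; first by apply: contra ne => /eqP ->; rewrite iE lE.
  by rewrite normr0 mulr_ge0// sumr_ge0.
have -> : (w i' + (x i - x i')) - (w l' + (x l - x l')) =
    (s n i - s n i' - s n l + s n l') *: x n +
    (w i' - w l' + y n i - y n i' - (y n l - y n l')).
  rewrite (xE n i) (xE n i') (xE n l) (xE n l'); apply/rowP => k; rewrite !mxE; ring.
apply: dominant.
  have ge1 (c : R) : 1 <= c \/ c <= -1 -> 1 <= `|c|.
    by case=> h; [exact: le_trans h (ler_norm _)|rewrite ler_normr; apply/orP; right; lra].
  have nii : ~~ ((i == n) && (i' == n)) by apply: contra ii => /andP[/eqP -> /eqP ->].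
  have nll : ~~ ((l == n) && (l' == n)) by apply: contra ll => /andP[/eqP -> /eqP ->].
  apply: ge1; rewrite /s; move: top nil nil' nii nll.
  case: (i == n); case: (i' == n); case: (l == n); case: (l' == n) => //= _ _ _ _ _;
    by [left; lra|right; lra].
have := ler_normB (w i' - w l' + y n i - y n i') (y n l - y n l').
have := ler_normB (w i' - w l' + y n i) (y n i').
have := ler_normD (w i' - w l') (y n i); have := ler_normB (w i') (w l').
have := ler_normB (y n l) (y n l').
have := w_le i'_n; have := w_le l'_n.
have := y_le i_n; have := y_le i'_n; have := y_le l_n; have := y_le l'_n.
by lra.
Qed.

End separation.

Section dual_elements.
Context (R : realType) (k : scalar_kind).
Variables (Y X : normedModType (scalar R k)) (B : Y -> X -> scalar R k).
Hypothesis pB : pairing B.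

(** Continuity is checked on the real bounds of the pairing. *)
Lemma pairing_dual_element (F : Y) : dual_element (B F).
Proof.
split; first by move=> a x y; rewrite (pairDr pB) (pairZr pB).
move=> x; apply/cvgrPdist_le => eps e0.
have eE : eps = scalar_of (modulus eps) 0 by rewrite -norm_modulus ger0_norm// ltW.
have m0 : 0 < modulus eps.
  by rewrite lt_neqAle modulus_ge0 andbT eq_sym; apply/eqP => /modulus_eq0 h; rewrite h ltxx in e0.
have c0 : 0 < 2 * rn F + 1 by rewrite ltr_wpDl// mulr_ge0// rn_ge0.
have d0 : 0 < (scalar_of (modulus eps / (2 * rn F + 1)) 0 : scalar R k).
  rewrite lt_neqAle; apply/andP; split; last first.
    by rewrite -(sc0 R k) scalar_of_le divr_ge0// ltW.
  by rewrite eq_sym -(sc0 R k); apply/eqP => /scalar_of_inj h; move: (divr_gt0 m0 c0); rewrite h ltxx.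
have := @cvgr_dist_le _ _ _ (nbhs x) _ id x (@cvg_id _ (nbhs x)) _ d0.
move=> /(_ (nbhs_filter x)); apply: filterS => y /=; rewrite normE scalar_of_le => h.
rewrite -(pairBr pB) norm_modulus eE scalar_of_le.
apply: le_trans (pair_le pB _ _) _; apply: (@le_trans _ _ ((2 * rn F + 1) * rn (x - y))).
  by rewrite ler_wpM2r ?rn_ge0// lerDl.
by rewrite mulrC -ler_pdivlMr.
Qed.

End dual_elements.

Section positive_dimension.
Context (R : realType) (k : scalar_kind) (d' : nat) (p p' : R).
Hypotheses (p2 : 2 < p) (pp' : p^-1 + p'^-1 = 1).
Local Notation D := d'.+1.
Local Notation mu := (lebesgue_rV R D).
Local Notation p1 := (exponent_ge1 p2).
Local Notation q1 := (conjugate_exponent_ge1 p2 pp').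
Local Notation sc a := (scalar_of a 0 : scalar R k).
Variable lambda : nat -> 'rV[R]_D.
Hypothesis lambda_unbounded : ~ bounded_set (range lambda).

Let delta : R := 100^-1.
(** The three conditions on the block lengths [N j] hold with the exponents
    [- eta], [- 2 eta] and [- 3 eta]. *)
Let eta : R := (p - 2) / (4 * p).
Let kappa (j : nat) : R := delta * 2^-1 ^+ j.+1.

Let p0 : 0 < p. Proof. by apply: lt_trans p2. Qed.
Let delta0 : 0 < delta. Proof. by rewrite invr_gt0. Qed.
Let eta0 : 0 < eta. Proof. by rewrite divr_gt0 ?subr_gt0// mulr_gt0. Qed.
Let kappa0 j : 0 < kappa j. Proof. by rewrite mulr_gt0// exprn_gt0// invr_gt0. Qed.

Let pE : p^-1 = 2^-1 - 2 * eta.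
Proof. by rewrite /eta; field; rewrite gt_eqF. Qed.

Let N (j : nat) : nat := Num.bound ((kappa j)^-1 `^ eta^-1).

Let N_gt0 j : (0 < N j)%N.
Proof.
rewrite -(ltr0n R); apply: le_lt_trans (archi_boundP _); last exact: powR_ge0.
exact: powR_ge0.
Qed.

Let N_eta j : (N j)%:R `^ (- eta) <= kappa j.
Proof.
rewrite powRN invf_ple ?posrE ?powR_gt0 ?ltr0n//.
have h : (kappa j)^-1 `^ eta^-1 <= (N j)%:R by apply/ltW/archi_boundP/powR_ge0.
have := ge0_ler_powR (ltW eta0) _ _ h; rewrite !nnegrE powR_ge0 ler0n => /(_ isT isT).
by rewrite -powRrM mulVf ?gt_eqF// powRr1// invr_ge0 ltW.
Qed.

Let c j : R := (N j)%:R `^ (- (2^-1 + eta)).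

Let c_gt0 j : 0 < c j. Proof. by rewrite powR_gt0// ltr0n. Qed.

Let Npow j (a : R) : a <= - eta -> (N j)%:R `^ a <= kappa j.
Proof. by move=> h; apply: le_trans (N_eta j); rewrite ler_powR ?ler1n. Qed.

Let NpowD j (a b : R) : (N j)%:R `^ a * (N j)%:R `^ b = (N j)%:R `^ (a + b) :> R.
Proof. by rewrite powRD// pnatr_eq0 -lt0n N_gt0 implybT. Qed.

Let kappa1 j : (N j)%:R `^ p^-1 / ((N j)%:R * c j) <= kappa j.
Proof.
have -> : (N j)%:R * c j = (N j)%:R `^ (2^-1 - eta).
  rewrite -{1}[(N j)%:R](powRr1 (ler0n R (N j))) /c NpowD; by congr powR; field.
rewrite -powRN NpowD; apply: Npow; rewrite pE; lra.
Qed.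

Let kappa2 j : (N j)%:R * c j ^+ 2 <= kappa j.
Proof.
rewrite -{1}[(N j)%:R](powRr1 (ler0n R (N j))) expr2 /c !NpowD; apply: Npow.
by move: eta0; lra.
Qed.

Let kappa3 j : c j * (N j)%:R `^ p^-1 <= kappa j.
Proof. by rewrite /c NpowD; apply: Npow; rewrite pE; move: eta0; lra. Qed.

Let kappa_sum n : \sum_(j < n) kappa j <= delta.
Proof.
suff -> : \sum_(j < n) kappa j = delta * (1 - 2^-1 ^+ n).
  by rewrite ler_piMr ?ltW// ltW// ltrBlDr ltrDl exprn_gt0// invr_gt0.
elim: n => [|n IH]; first by rewrite big_ord0 expr0 subrr mulr0.
by rewrite big_ord_recr/= IH /kappa exprS; field.
Qed.

(** The Haar functions need a coordinate to split; in dimension [0] no sequence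
    is unbounded. *)
Lemma frame_of_translates_pos : exists (m : nat -> nat)
    (f : Lp k mu p1) (F' : nat -> Lp k mu q1),
  [/\ {homo m : i j / (i < j)%N}, seminormalized F' &
      unconditional_schauder_frame (fun i => Lp_translate (lambda (m i)) f)
        (fun i => @Lp_dual _ _ _ _ _ _ _ p1 _ (F' i))].
Proof.
pose b := block N; pose w i := haar_corner R d' (b i).
have [m [m_homo m_growth]] := sparse_subsequence lambda_unbounded
  (fun n S => 3 + 2 * (\sum_(i < n.+1) `|w i|) + 4 * S).
pose lam i := lambda (m i).
have bM i : (i < block_start N (b i).+1)%N by have /andP[] := blockP N_gt0 i.
have [f hf] := @spread_function R k D p p1 (haarL k d' p1) (haar_corner R d') lam b N
  (fun j => block_start N j.+1) c kappa delta (haarL_le1 k d' p1) (haarL_supported k d' p1)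
  (block_card N_gt0) c_gt0 kappa3 kappa_sum (separated4 m_growth)
  (separated2_shift m_growth) bM.
have p'2 : p' < 2.
  have p'V : 2^-1 < p'^-1.
    have -> : p'^-1 = 1 - p^-1 by rewrite -pp' addrC addKr.
    have : p^-1 < 2^-1 by rewrite ltf_pV2 ?posrE.
    lra.
  have p'0 : 0 < p' by rewrite -invr_gt0 (lt_trans _ p'V)// invr_gt0.
  by rewrite -ltf_pV2 ?posrE.
pose v i := Lp_translate (lam i) f.
have vE i : v i = sc (c (b i)) *: haarL k d' p1 (b i) +
    (v i - sc (c (b i)) *: haarL k d' p1 (b i)) by rewrite addrC subrK.
have hn i : 1 <= rn (rademacherL k d' q1 i) by rewrite rn_rademacherL.
have [F' [sF' hF']] := frame_from_blocks (Lp_pairing k mu p1 q1 pp')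
  (@Lp_complete _ _ _ _ _ _ _) (@Lp_complete _ _ _ _ _ _ _) p2 (erefl delta)
  (haarL_le1 k d' p1) (haarL_le1 k d' q1) (haarL_multipliers q1 p2 pp')
  (block_le N) bM (block_card N_gt0) N_gt0 vE hf
  (rademacherL_upper2 d' q1 p'2)
  hn
  c_gt0 kappa1 kappa2 kappa_sum.
exists m, f, F'; split=> //; split; first split.
- by move=> i; exact: pairing_dual_element (Lp_pairing k mu p1 q1 pp') (F' i).
- by move=> g; exact: usum_series (hF' g).
- by move=> g; exact: usum_unconditional (hF' g).
Qed.

End positive_dimension.

Theorem theorem4p1 (R : realType) (k : scalar_kind) (d : nat) (p p' : R)
    (p_gt2 : 2 < p) (pp' : p^-1 + p'^-1 = 1)
    (lambda : nat -> 'rV[R]_d) (lambda_unbounded : ~ bounded_set (range lambda)) :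
  exists (m : nat -> nat)
         (f : Lp k (lebesgue_rV R d) (exponent_ge1 p_gt2))
         (F' : nat -> Lp k (lebesgue_rV R d) (conjugate_exponent_ge1 p_gt2 pp')),
    [/\ {homo m : i j / (i < j)%N},
        seminormalized F' &
        unconditional_schauder_frame
          (fun i => Lp_translate (lambda (m i)) f)
          (fun i => @Lp_dual _ _ _ _ _ _ _ (exponent_ge1 p_gt2) _ (F' i))].
Proof.
case: d lambda lambda_unbounded => [|d'] lambda lambda_unbounded; last exact: frame_of_translates_pos.
exfalso; apply: lambda_unbounded; exists 0; split; first exact: num_real.
move=> M M0 _ [n _ <-]; have -> : lambda n = 0 by apply/rowP => -[].
by rewrite /= normr0 ltW.
Qed.
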